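(* Let $d=d(n)$ be a positive-integer-valued function of $n$. For each $n$, let $X_1,\dots,X_n$ be i.i.d. $\mathsf N(0,I_d)$ and let $Y_1,\dots,Y_n$ be i.i.d. uniform on $\{-1,1\}$, independent of $X_{1:n}$ (the logistic model with parameter $0\in\mathbb R^d$). Let $$\Lambda_{n,d}=\sup_{\eta\in\mathbb R^d}\sum_{i=1}^n\log\big(2\sigma(Y_iX_i^{\mathsf T}\eta)\big).$$ Then: (i) if $d^{3/2}/n\to0$ as $n\to\infty$, then $\lim_{n\to\infty}d_{\mathsf{KS}}(2\Lambda_{n,d},\chi^2_d)=0$; (ii) if $d^{3/2}/n\not\to0$ as $n\to\infty$, then $\limsup_{n\to\infty}d_{\mathsf{KS}}(2\Lambda_{n,d},\chi^2_d)>0$.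
   Context: $\sigma(t)=1/(1+e^{-t})$. For real random variables $U,V$, the Kolmogorov–Smirnov distance is $d_{\mathsf{KS}}(U,V)=\sup_{x\in\mathbb R}|\mathbf P(U\le x)-\mathbf P(V\le x)|$; $\chi^2_d$ stands for a random variable with the chi-square distribution with $d$ degrees of freedom. *)

(* Defs.v *)
From mathcomp Require Import all_boot all_order all_algebra.
From mathcomp Require Import all_classical all_reals all_analysis.
Import Order.TTheory GRing.Theory Num.Theory.
Import numFieldNormedType.Exports.

Set Implicit Arguments.
Unset Strict Implicit.
Unset Printing Implicit Defensive.

Local Open Scope classical_set_scope.
Local Open Scope ring_scope.

Definition mutually_independent (R : realType) (disp disp' : measure_display)
    (T : measurableType disp) (T' : measurableType disp')
    (P : probability T R) (I : finType) (X : I -> T -> T') : Prop :=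
  forall (J : {set I}) (A : I -> set T'),
    (forall i, i \in J -> measurable (A i)) ->
    P (\bigcap_(i in [set` J]) (X i @^-1` A i)) =
    (\prod_(i in J) P (X i @^-1` A i))%E.

(* [g_sigma_preimage X] is the sigma-algebra on T generated by
   X 0, ..., X (m - 1), so this is independence of the two whole families;
   nothing is required inside either family. *)
Definition independent_families (R : realType)
    (disp disp1 disp2 : measure_display) (T : measurableType disp)
    (T1 : measurableType disp1) (T2 : measurableType disp2)
    (P : probability T R) (m n : nat)
    (X : 'I_m -> T -> T1) (Y : 'I_n -> T -> T2) : Prop :=
  forall A B : set T, g_sigma_preimage X A -> g_sigma_preimage Y B ->
    P (A `&` B) = (P A * P B)%E.

(* The law N(0, I_d), given by its coordinates: they are independent and each
   has law N(0, 1).  The second parameter of [normal_prob] is the standard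
   deviation. *)
Definition std_normal_vector (R : realType) (disp : measure_display)
    (T : measurableType disp) (P : probability T R) (d : nat)
    (X : T -> d.-tuple R) : Prop :=
  mutually_independent P (fun (j : 'I_d) (w : T) => tnth (X w) j) /\
  forall (j : 'I_d) (A : set R), measurable A ->
    P [set w | A (tnth (X w) j)] = normal_prob 0 1 A.

Definition uniform_sign (R : realType) (disp : measure_display)
    (T : measurableType disp) (P : probability T R) (Y : T -> R) : Prop :=
  P (Y @^-1` [set -1]) = (2^-1)%:E /\ P (Y @^-1` [set 1]) = (2^-1)%:E.

(* V has the law of Z_1^2 + ... + Z_d^2 for some Z ~ N(0, I_d), which may live
   on another probability space. *)
Definition chi_square (R : realType) (disp : measure_display)
    (T : measurableType disp) (P : probability T R) (d : nat)
    (V : T -> R) : Prop :=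
  exists (disp' : measure_display) (T' : measurableType disp')
         (P' : probability T' R) (Z : {RV P' >-> d.-tuple R}),
    std_normal_vector P' Z /\
    forall A : set R, measurable A ->
      P (V @^-1` A) = P' [set w | A (\sum_(j < d) tnth (Z w) j ^+ 2)].

(* All the values below lie in [0, 1], so the real-valued [sup] is the actual
   supremum. *)
Definition dKS (R : realType) (disp disp' : measure_display)
    (T : measurableType disp) (T' : measurableType disp')
    (P : probability T R) (Q : probability T' R)
    (U : T -> R) (V : T' -> R) : R :=
  sup [set `|fine (P [set w | U w <= x]) - fine (Q [set w | V w <= x])|
      | x in [set: R]].

Definition sigmoid (R : realType) (t : R) : R := (1 + expR (- t))^-1.

Definition dotp (R : realType) (d : nat) (x eta : d.-tuple R) : R :=
  \sum_(j < d) tnth x j * tnth eta j.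

(* The maximized log-likelihood ratio Lambda_{n,d} on the data (x, y).
   Since sigmoid < 1, the set is bounded above by n * ln 2. *)
Definition Lambda (R : realType) (n d : nat)
    (x : 'I_n -> d.-tuple R) (y : 'I_n -> R) : R :=
  sup [set \sum_(i < n) ln (2 * sigmoid (y i * dotp (x i) eta))
      | eta in [set: d.-tuple R]].

(* With parameter 0 the labels are fair signs whatever the covariates, hence the
   independence of the two families. *)
Definition null_logistic_model (R : realType) (disp : measure_display)
    (T : measurableType disp) (P : probability T R) (n d : nat)
    (X : 'I_n -> {RV P >-> d.-tuple R}) (Y : 'I_n -> {RV P >-> R}) :
    Prop :=
  [/\ forall i, std_normal_vector P (X i),
      mutually_independent P (fun i => X i : T -> d.-tuple R),
      forall i, uniform_sign P (Y i),
      mutually_independent P (fun i => Y i : T -> R) &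
      independent_families P (fun i => X i : T -> d.-tuple R)
        (fun i => Y i : T -> R)].

(* Main.v *)
(* By the symmetry of the normal law, the vectors [Y_i X_i] are the rows of a
   matrix Z of n x d independent standard normal entries, and W = |S|^2 / n,
   where S is the sum of the rows, has exactly the chi-square law.  Let H be
   the projection onto the column space of Z, p = H 1 and T = 1^T H 1.
   Evaluating the likelihood at a multiple of the least squares solution gives
   2 Lambda >= T + T^2 / (36 n); by Gibbs' inequality with the weights
   (1 - p_i) / 2 and (1 + p_i) / 2, 2 Lambda <= T + (2 / 3) sum_i p_i^4 as soon
   as all |p_i| < 1.  The law of Z is invariant under sign changes of the rows
   and under rotations; averaging over the signs, and rotating the vector 1 to
   a coordinate axis, bound the second moments of T - d (by 2 d) and of T - W
   (by O(d^2 / n)) and the expectations of sum_i p_i^4 and sum_i p_i^6.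
   If rho = d^(3/2) / n tends to 0, then 2 Lambda - W = o(sqrt d) in
   probability, which suffices because W does not concentrate on intervals of
   length o(sqrt d): the difference of two independent copies of W is a scalar
   product of two independent normal vectors.
   If rho stays away from 0, the term T^2 / (36 n) is at least a multiple of
   sqrt d: for d < n it shifts the law of 2 Lambda away from that of W, on the
   scale sqrt d of the fluctuations of W.  For d >= n the data are separable
   and 2 Lambda = 2 n ln 2 almost surely, whereas W has no atoms. *)
From HB Require Import structures.
Require Import Defs.
From mathcomp Require Import all_boot all_order all_algebra.
From mathcomp Require Import all_classical all_reals all_analysis.
From mathcomp Require Import measurable_realfun ring lra.
Import Order.TTheory GRing.Theory Num.Theory.
Import numFieldNormedType.Exports.

Set Implicit Arguments.
Unset Strict Implicit.
Unset Printing Implicit Defensive.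

Local Open Scope classical_set_scope.
Local Open Scope ring_scope.

(** * Matrices of independent standard normal entries *)

(** The laws of [hotelling], of the leverages [hat M i i] and of the fits [hat_fit M i] are never
    computed. With the rows fixed up to sign, [hotelling] is a quadratic form in random signs with
    matrix [hat M], whose trace and squared Frobenius norm are both d; this gives its second moment,
    and Jensen's inequality its third. Rotating 1 to an axis turns [hotelling / n] into a leverage,
    so leverages inherit these moments; sign averages of linear forms then pass to the fits. Two
    powers are needed: sum p_i^4 is of order d^2 / n = rho sqrt d, negligible against sqrt d, but
    d^2 / n itself need not be small, so the condition |p_i| < 1 is controlled by sum p_i^6, of
    order d^3 / n^2 = rho^2. The variables live on arbitrary spaces. Statements are therefore about
    the law of a matrix, and independence is exploited by replacing some entries with those of a
    copy on a product space, where Fubini applies. Expectations are taken of nonnegative functions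
    only; identities with differences are first rearranged into sums. *)

Section matrix_space.
Variables (R : realType) (n d : nat).

Definition mx_boxes : set (set 'M[R]_(n, d)) :=
  [set B | exists2 A : 'I_n -> 'I_d -> set R,
     forall i j, measurable (A i j) & B = [set M : 'M[R]_(n, d) | forall i j, A i j (M i j)]].

(** The matrices with the product sigma-algebra, which the boxes generate; the casts [(M : 'M[R]_(n,
    d))] go back to the algebraic structure. *)
Definition mx_space := g_sigma_algebraType mx_boxes.

HB.instance Definition _ := Measurable.on mx_space.

Lemma measurable_mx_entry i j :
  measurable_fun setT (fun M : mx_space => (M : 'M[R]_(n, d)) i j).
Proof.
move=> _ B mB; rewrite setTI; apply: sub_sigma_algebra.
exists (fun k l => if (k == i) && (l == j) then B else setT).
  by move=> k l; case: ifP.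
apply/seteqP; split => M /=; last by move/(_ i j); rewrite !eqxx.
by move=> BM k l; case: ifP => // /andP[/eqP-> /eqP->].
Qed.

Lemma measurable_mxP disp (T : measurableType disp) (Z : T -> mx_space) :
  (forall i j, measurable_fun setT (fun w => (Z w : 'M[R]_(n, d)) i j)) <->
  measurable_fun setT Z.
Proof.
split=> [mZ | mZ i j]; last first.
  exact: (measurableT_comp (measurable_mx_entry i j) mZ).
apply: (@measurability _ _ _ _ setT Z mx_boxes) => //.
move=> _ [_ [A mA ->] <-]; rewrite setTI.
rewrite (_ : _ @^-1` _ = \bigcap_(i in [set` [set: 'I_n]%SET])
   \bigcap_(j in [set` [set: 'I_d]%SET]) [set w | A i j ((Z w : 'M[R]_(n, d)) i j)]).
  apply: fin_bigcap_measurable => // i _; apply: fin_bigcap_measurable => // j _.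
  by rewrite -[X in measurable X]setTI; exact: mZ.
apply/seteqP; split=> w /= H; first by move=> i _ j _; exact: H.
by move=> i j; apply: (H i _ j); rewrite /= inE.
Qed.

Lemma mx_boxes_setI : setI_closed mx_boxes.
Proof.
move=> _ _ [A mA ->] [B mB ->]; exists (fun i j => A i j `&` B i j).
  by move=> i j; exact: measurableI.
apply/seteqP; split => M /=; first by move=> [AM BM] i j.
by move=> ABM; split=> i j; have [] := ABM i j.
Qed.

End matrix_space.

(** Independence and marginals at once, on boxes only: these are stable under intersection, so the
    condition determines the law of [Z]. *)
Definition iid_normal (R : realType) n d disp (T : measurableType disp)
    (P : probability T R) (Z : T -> mx_space R n d) :=
  measurable_fun setT Z /\
  forall A : 'I_n -> 'I_d -> set R, (forall i j, measurable (A i j)) ->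
    P [set w | forall i j, A i j ((Z w : 'M[R]_(n, d)) i j)] =
    (\prod_(i < n) \prod_(j < d) normal_prob 0 1 (A i j))%E.

Section law.
Variables (R : realType) (n d : nat).
Variables (disp disp' : measure_display) (T : measurableType disp)
  (T' : measurableType disp') (P : probability T R) (P' : probability T' R).
Variables (Z : T -> mx_space R n d) (Z' : T' -> mx_space R n d).
Hypotheses (GZ : iid_normal P Z) (GZ' : iid_normal P' Z').

(** Uniqueness of measures on a generating pi-system. Invariance of the law under a map thus amounts
    to the image being [iid_normal] again, possibly on another space. *)
Lemma iid_normal_law (B : set (mx_space R n d)) : measurable B ->
  P (Z @^-1` B) = P' (Z' @^-1` B).
Proof.
have [mZ PZ] := GZ; have [mZ' PZ'] := GZ'.
move=> mB; apply: (@measure_unique _ R (mx_space R n d) (@mx_boxes R n d)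
  (fun=> setT) erefl (@mx_boxes_setI R n d) _ _
  (pushforward P Z : {measure set _ -> \bar R})
  (pushforward P' Z' : {measure set _ -> \bar R})) => //.
- by move=> _; exists (fun _ _ => setT) => //; apply/seteqP; split.
- by rewrite bigcup_const.
- by move=> _ [A mA ->]; exact: etrans (PZ _ mA) (esym (PZ' _ mA)).
- move=> _; change (P (Z @^-1` setT) < +oo)%E.
  by rewrite preimage_setT probability_setT ltry.
Qed.

Lemma iid_normal_integral (f : mx_space R n d -> \bar R) :
  measurable_fun setT f -> (forall M, 0 <= f M)%E ->
  (\int[P]_w f (Z w) = \int[P']_w f (Z' w))%E.
Proof.
have [mZ PZ] := GZ; have [mZ' PZ'] := GZ'.
move=> mf f0.
rewrite -[LHS](@ge0_integral_pushforward _ _ _ _ _ _ mZ P setT f) //.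
rewrite -[RHS](@ge0_integral_pushforward _ _ _ _ _ _ mZ' P' setT f) //.
apply: eq_measure_integral => A mA _.
exact: iid_normal_law.
Qed.

End law.

(** The substitute for conditioning: on the product space the entries in [J] depend on the second
    coordinate only and the others on the first, so that Fubini separates them. *)
Lemma iid_normal_resample (R : realType) n d disp (T : measurableType disp)
    (P : probability T R) (Z : T -> mx_space R n d)
    disp' (T' : measurableType disp')
    (P' : probability T' R) (Z' : T' -> mx_space R n d)
    (J : 'I_n -> 'I_d -> bool) :
  iid_normal P Z -> iid_normal P' Z' ->
  iid_normal (P \x P')%E (fun w : T * T' =>
    \matrix_(i, j) if J i j then (Z' w.2 : 'M[R]_(n, d)) i j
                   else (Z w.1 : 'M[R]_(n, d)) i j).
Proof.
move=> [mZ PZ] [mZ' PZ']; split.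
  apply/measurable_mxP => i j; under eq_fun do rewrite mxE.
  case: (J i j).
  - apply: (measurableT_comp (f := fun w => (Z' w : 'M[R]_(n, d)) i j)) => //.
    by move/measurable_mxP : mZ' => /(_ i j).
  - apply: (measurableT_comp (f := fun w => (Z w : 'M[R]_(n, d)) i j)) => //.
    by move/measurable_mxP : mZ => /(_ i j).
move=> A mA.
pose A1 i j := if J i j then setT else A i j.
pose A2 i j := if J i j then A i j else setT.
have mA1 i j : measurable (A1 i j) by rewrite /A1; case: ifP.
have mA2 i j : measurable (A2 i j) by rewrite /A2; case: ifP.
have mbox disp0 (T0 : measurableType disp0) (Z0 : T0 -> mx_space R n d) (B : 'I_n -> 'I_d -> set R) :
    measurable_fun setT Z0 -> (forall i j, measurable (B i j)) ->
    measurable [set w | forall i j, B i j ((Z0 w : 'M[R]_(n, d)) i j)].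
  move=> mZ0 mB; rewrite -[X in measurable X]setTI.
  apply: (mZ0 measurableT [set M : mx_space R n d | forall i j, B i j ((M : 'M[R]_(n, d)) i j)]).
  by apply: sub_sigma_algebra; exists B.
rewrite (_ : [set w | _] =
  [set w | forall i j, A1 i j ((Z w : 'M[R]_(n, d)) i j)] `*`
  [set w | forall i j, A2 i j ((Z' w : 'M[R]_(n, d)) i j)]); last first.
  apply/seteqP; split => -[w w'] /=.
    move=> H; split => i j; have := H i j; rewrite /A1 /A2 mxE; by case: ifP.
  by move=> [H1 H2] i j; have := H1 i j; have := H2 i j; rewrite /A1 /A2 mxE; case: ifP.
rewrite [LHS]product_measure1E; [|exact: mbox|exact: mbox].
transitivity (P [set w | (forall i j, A1 i j ((Z w : 'M[R]_(n, d)) i j))] * P' [set w | (forall i j, A2 i j ((Z' w : 'M[R]_(n, d)) i j))])%E; first by [].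
rewrite PZ // PZ' // -big_split; apply: eq_bigr => i _ /=.
rewrite -big_split; apply: eq_bigr => j _ /=.
by rewrite /A1 /A2; case: ifP => _; rewrite probability_setT ?mul1e ?mule1.
Qed.

Lemma iid_normal_tr (R : realType) n d disp (T : measurableType disp)
    (P : probability T R) (Z : T -> mx_space R n d) :
  iid_normal P Z -> iid_normal P (fun w => (Z w : 'M[R]_(n, d))^T : mx_space R d n).
Proof.
move=> [mZ PZ]; split.
  apply/measurable_mxP => i j; under eq_fun do rewrite mxE.
  by move/measurable_mxP : mZ => /(_ j i).
move=> A mA; rewrite exchange_big /= -(PZ (fun i j => A j i)) //.
by congr (P _); apply/seteqP; split => w /= H i j; have := H j i; rewrite mxE.
Qed.

Lemma iid_normal_sub (R : realType) n d m k disp (T : measurableType disp)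
    (P : probability T R) (Z : T -> mx_space R n d)
    (f : 'I_m -> 'I_n) (g : 'I_k -> 'I_d) : injective f -> injective g ->
  iid_normal P Z ->
  iid_normal P (fun w => mxsub f g (Z w : 'M[R]_(n, d)) : mx_space R m k).
Proof.
move=> finj ginj [mZ PZ]; split.
  apply/measurable_mxP => i j; under eq_fun do rewrite mxE.
  by move/measurable_mxP : mZ => /(_ (f i) (g j)).
move=> A mA.
(* The box carried along [f] and [g], with no constraint ([BT]) outside their ranges. *)
pose B i j := [set x : R | forall i' j', f i' = i -> g j' = j -> A i' j' x].
have BE i j : B (f i) (g j) = A i j.
  apply/seteqP; split => x /=; first by apply.
  by move=> Ax i' j' /finj -> /ginj ->.
have BT i j : (forall i' j', ~ (f i' = i /\ g j' = j)) -> B i j = setT.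
  move=> H; apply/seteqP; split => x //= _ i' j' fi gj.
  by exfalso; apply: (H i' j').
have mB i j : measurable (B i j).
  have [[[i' j'] [<- <-]]|H] := pselect (exists ij, f ij.1 = i /\ g ij.2 = j).
    by rewrite BE.
  by rewrite BT // => i' j' H'; apply: H; exists (i', j').
have -> : [set w | forall i j, A i j (mxsub f g (Z w : 'M[R]_(n, d)) i j)] =
   [set w | forall i j, B i j ((Z w : 'M[R]_(n, d)) i j)].
  apply/seteqP; split => w /= H i j.
    by move=> i' j' <- <-; have := H i' j'; rewrite mxE.
  by rewrite mxE; apply: H.
rewrite PZ //.
have inj_prod q p (h : 'I_q -> 'I_p) (F : 'I_p -> \bar R) : injective h ->
    (forall i, (forall i', h i' <> i) -> F i = 1%E) ->
    (\prod_(i < p) F i = \prod_(i < q) F (h i))%E.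
  move=> hinj F1; rewrite (bigID (fun i => i \in [set h x | x in [set: 'I_q]%SET]%SET)) /=.
  rewrite [X in (_ * X)%E]big1 ?mule1; last first.
    by move=> i /imsetP iP; apply: F1 => i' hi; apply: iP; exists i'; rewrite ?inE.
  rewrite big_imset /=; last by move=> ? ? _ _ /hinj.
  by apply: eq_bigl => i; rewrite inE.
rewrite (inj_prod _ _ f) //; last first.
  move=> i H; rewrite big1 // => j _; rewrite BT ?probability_setT //.
  by move=> i' j' [/H].
apply: eq_bigr => i _; rewrite (inj_prod _ _ g) //; last first.
  by move=> j H; rewrite BT ?probability_setT // => i' j' [_ /H].
by apply: eq_bigr => j _; rewrite BE.
Qed.

(** * Change of variables and rotation invariance of the normal law *)

Section affine.
Variable R : realType.
Notation mu := (@lebesgue_measure R).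

Let aff (c b : R) : measurableTypeR R -> measurableTypeR R := fun y => c * y + b.

Let measurable_aff c b : measurable_fun setT (aff c b).
Proof. by apply: measurable_funD => //; exact: measurable_funM. Qed.

Lemma lebesgue_measure_affine (c b : R) (A : set R) : 0 < c -> measurable A ->
  mu A = (c%:E * mu ((fun y => c * y + b)%R @^-1` A))%E.
Proof.
move=> c0 mA.
pose m' : {measure set _ -> \bar R} := pushforward mu (aff c b).
have H := @lebesgue_measure_unique R (mscale (NngNum (ltW c0)) (m' (measurable_aff c b))).
apply: H => //= _ [[x y]] _ <-; rewrite /m' /mscale /= /pushforward.
rewrite (_ : _ @^-1` _ = `](x - b) / c, (y - b) / c]%classic); last first.
  apply/seteqP; split => z /=; rewrite !in_itv /= ltr_pdivrMr // ler_pdivlMr // mulrC /aff;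
  by rewrite ltrBlDr lerBrDr.
rewrite !lebesgue_measure_itv /= !lte_fin ltr_pM2r ?invr_gt0 // ltrD2r.
case: ifP => _; last by rewrite mule0.
by rewrite -!EFinD -EFinM; congr EFin; field; rewrite gt_eqF.
Qed.

Lemma ge0_integral_affine (c b : R) (f : R -> \bar R) : 0 < c ->
  measurable_fun setT f -> (forall x, 0 <= f x)%E ->
  (\int[mu]_x f x = c%:E * \int[mu]_x f (c * x + b)%R)%E.
Proof.
move=> c0 mf f0.
have := @ge0_integral_pushforward _ _ _ _ R _ (measurable_aff c b) mu setT f
   measurableT mf (fun x _ => f0 x).
rewrite preimage_setT /= => H.
transitivity (c%:E * \int[mu]_x (f \o aff c b) x)%E; last by [].
rewrite -H -[c%:E]/((NngNum (ltW c0))%:num%:E) -ge0_integral_mscale //.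
apply: eq_measure_integral => A mA _; rewrite /mscale /= /pushforward.
exact: lebesgue_measure_affine.
Qed.

End affine.

Section normal.
Variable R : realType.
Notation mu := (@lebesgue_measure R).
Notation N01 := (normal_prob (0 : R) 1).
Notation phi := (normal_pdf (0 : R) 1).

Lemma normal_pdf01E (x : R) : phi x = normal_peak 1 * expR (- x ^+ 2 / 2).
Proof. by rewrite normal_pdfE ?oner_neq0 // /normal_fun subr0 expr1n. Qed.

Lemma integral_normal_prob (f : R -> \bar R) : measurable_fun setT f ->
  (\int[N01]_x `|f x| < +oo)%E ->
  (\int[N01]_x f x = \int[mu]_x (f x * (phi x)%:E))%E.
Proof.
move=> mf finf.
have mphi : measurable_fun setT (fun x => (phi x)%:E).
  by apply/measurable_EFinP; exact: measurable_normal_pdf.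
rewrite -(Radon_Nikodym_change_of_variables (normal_prob_dominates 0 1))//=; last first.
  by apply/integrableP; split.
apply: ae_eq_integral => //.
- apply: emeasurable_funM => //; apply: (measurable_int mu).
  by apply: Radon_Nikodym_integrable; exact: normal_prob_dominates.
- exact: emeasurable_funM.
- apply: ae_eqe_mul2l => /=.
  rewrite Radon_NikodymE//=; first exact: normal_prob_dominates.
  move=> abmu; case: cid => /= h [h1 h2 h3].
  apply: integral_ae_eq => //=.
  by move=> E _ mE; rewrite -h3.
Qed.

End normal.

Section rotation.
Variable R : realType.
Notation mu := (@lebesgue_measure R).
Notation N01 := (normal_prob (0 : R) 1).
Notation phi := (normal_pdf (0 : R) 1).
Variables (c s : R).
Hypotheses (c0 : 0 < c) (cs1 : c ^+ 2 + s ^+ 2 = 1).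

Let mlin (a b : R) : measurable_fun setT (fun p : measurableTypeR R * measurableTypeR R => a * p.1 + b * p.2).
Proof. by apply: measurable_funD; apply: measurable_funM. Qed.

(** Two affine substitutions in one variable, [y = v / c + s * x / c] and then [x = c * u - s * v];
    their Jacobians [c^-1] and [c] cancel. Positivity of [c] keeps both substitutions increasing. *)
Lemma lebesgue_rotation (F : measurableTypeR R * measurableTypeR R -> \bar R) :
  measurable_fun setT F -> (forall p, 0 <= F p)%E ->
  (\int[mu]_x \int[mu]_y F (x, y) =
   \int[mu]_v \int[mu]_u F ((c * u - s * v)%R, (s * u + c * v)%R))%E.
Proof.
move=> mF F0.
have ci0 : 0 < c^-1 by rewrite invr_gt0.
have mG1 : measurable_fun setT (fun p : measurableTypeR R * measurableTypeR R =>
    F (p.1, (c^-1 * p.2 + s * p.1 / c)%R)).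
  apply: (measurableT_comp mF); apply: measurable_fun_pair => //=.
  under eq_fun do rewrite addrC mulrAC.
  exact: mlin.
transitivity (\int[mu]_x (c^-1%:E * \int[mu]_v F (x, (c^-1 * v + s * x / c)%R)))%E.
  apply: eq_integral => x _.
  rewrite (@ge0_integral_affine R c^-1 (s * x / c) (fun y => F (x, y))) //.
  by apply: (measurableT_comp mF); exact: measurable_pair1.
rewrite ge0_integralZl //; last 3 first.
- exact: (@measurable_fun_fubini_tonelli_F _ _ _ _ _ mu
    (fun p => F (p.1, (c^-1 * p.2 + s * p.1 / c)%R))).
- by move=> x _; exact: integral_ge0.
- by rewrite lee_fin ltW.
have -> := @fubini_tonelli _ _ _ _ R mu mu
    (fun p => F (p.1, (c^-1 * p.2 + s * p.1 / c)%R)) mG1 (fun p => F0 _).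
rewrite -ge0_integralZl //; last 3 first.
- exact: (@measurable_fun_fubini_tonelli_G _ _ _ _ _ mu
    (fun p => F (p.1, (c^-1 * p.2 + s * p.1 / c)%R))).
- by move=> x _; exact: integral_ge0.
- by rewrite lee_fin ltW.
apply: eq_integral => v _; rewrite /fubini_G.
rewrite [in LHS](@ge0_integral_affine R c (- (s * v))
  (fun u => F (u, (c^-1 * v + s * u / c)%R))) //=; last first.
  exact: (measurableT_comp mG1 (measurable_pair2 v)).
rewrite muleA -EFinM mulVf ?gt_eqF // mul1e.
apply: eq_integral => u _; congr (F (_, _)).
apply/eqP; rewrite -subr_eq0; apply/eqP.
transitivity (c^-1 * (v * (1 - (c ^+ 2 + s ^+ 2)))); last by rewrite cs1 subrr !mulr0.
by field; rewrite gt_eqF.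
Qed.

Lemma prod_normalE (E : set (R * R)) : measurable E ->
  ((N01 \x N01) E = \int[mu]_x \int[mu]_y ((phi x * phi y)%R%:E * (\1_E (x, y))%:E))%E.
Proof.
move=> mE.
have mphi : measurable_fun setT (fun x => (phi x)%:E).
  by apply/measurable_EFinP; exact: measurable_normal_pdf.
have NX x : N01 (xsection E x) = (\int[mu]_y ((phi y)%:E * (\1_E (x, y))%:E))%E.
  rewrite /normal_prob integral_mkcond; apply: eq_integral => y _.
  rewrite patchE indicE; have -> : (y \in xsection E x) = ((x, y) \in E).
    exact: mem_xsection.
  by case: ifP => _; rewrite ?mule1 ?mule0.
transitivity (\int[N01]_x N01 (xsection E x))%E; first by [].
have mN : measurable_fun setT (fun x => N01 (xsection E x)).
  exact: measurable_fun_xsection.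
rewrite integral_normal_prob //; last first.
  apply: (@le_lt_trans _ _ (\int[N01]_x 1)%E).
    apply: ge0_le_integral => //.
    - exact: measurableT_comp.
    - by move=> x _; rewrite gee0_abs // probability_le1 //; exact: measurable_xsection.
  by rewrite integral_cst // mul1e -ge0_fin_numE // fin_num_measure.
apply: eq_integral => x _; rewrite NX muleC -ge0_integralZl //.
- by apply: eq_integral => y _; rewrite muleA -EFinM.
- apply: emeasurable_funM => //; apply/measurable_EFinP.
  have m1E : measurable_fun setT (\1_E : _ -> R) by exact: measurable_indic.
  exact: (measurableT_comp m1E (measurable_pair1 x)).
- by move=> y _; rewrite mule_ge0 // lee_fin ?normal_pdf_ge0.
- by rewrite lee_fin normal_pdf_ge0.
Qed.

(** The joint density depends on [x ^+ 2 + y ^+ 2] only, which the rotation preserves. *)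
Lemma normal_rotation (A B : set R) : measurable A -> measurable B ->
  ((N01 \x N01) [set p | A (c * p.1 - s * p.2)%R /\ B (s * p.1 + c * p.2)%R] =
   N01 A * N01 B)%E.
Proof.
move=> mA mB; rewrite -(product_measure1E N01 N01 mA mB).
set E := [set p | _].
have mE : measurable E.
  have -> : E = ((fun p : measurableTypeR R * measurableTypeR R =>
     (c * p.1 + (- s) * p.2, s * p.1 + c * p.2)) @^-1` (A `*` B)).
    by apply/seteqP; split => p; rewrite /E /= mulNr.
  rewrite -[X in measurable X]setTI.
  have mf : measurable_fun setT (fun p : measurableTypeR R * measurableTypeR R =>
     (c * p.1 + (- s) * p.2, s * p.1 + c * p.2)).
    by apply: measurable_fun_pair; exact: mlin.
  exact: (mf measurableT _ (measurableX mA mB)).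
rewrite prod_normalE //.
rewrite [RHS]prod_normalE; last exact: measurableX.
have mphi2 : measurable_fun setT (fun p : measurableTypeR R * measurableTypeR R => (phi p.1 * phi p.2)%R%:E).
  apply/measurable_EFinP/measurable_funM;
  by apply: (measurableT_comp (measurable_normal_pdf 0 1)).
have mF : measurable_fun setT (fun p : measurableTypeR R * measurableTypeR R =>
    ((phi p.1 * phi p.2)%R%:E * (\1_(A `*` B) p)%:E)%E).
  apply: emeasurable_funM => //; apply/measurable_EFinP.
  by apply: measurable_indic; exact: measurableX.
have F0 p : (0 <= (phi p.1 * phi p.2)%R%:E * (\1_(A `*` B) p)%:E)%E.
  by rewrite mule_ge0 // lee_fin ?mulr_ge0 ?normal_pdf_ge0.
have mE' : measurable_fun setT (fun p : measurableTypeR R * measurableTypeR R =>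
    ((phi p.1 * phi p.2)%R%:E * (\1_E p)%:E)%E).
  by apply: emeasurable_funM => //; apply/measurable_EFinP/measurable_indic.
have E0 p : (0 <= (phi p.1 * phi p.2)%R%:E * (\1_E p)%:E)%E.
  by rewrite mule_ge0 // lee_fin ?mulr_ge0 ?normal_pdf_ge0.
rewrite (lebesgue_rotation mF F0).
have -> := @fubini_tonelli _ _ _ _ R mu mu (fun p => ((phi p.1 * phi p.2)%R%:E * (\1_E p)%:E)%E) mE' E0.
apply: eq_integral => v _; apply: eq_integral => u _ /=; congr (_ * _)%E.
rewrite !normal_pdf01E mulrACA [in RHS]mulrACA -!expRD; congr (_ * expR _)%:E.
by rewrite -!mulrDl -!opprD; congr (- _ / 2); rewrite -[LHS]mul1r -cs1; ring.
Qed.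

Lemma normal_probN (A : set R) : measurable A -> N01 (-%R @^-1` A) = N01 A.
Proof.
move=> mA; rewrite /normal_prob.
have mphi : measurable_fun setT (fun x => (phi x)%:E).
  by apply/measurable_EFinP; exact: measurable_normal_pdf.
have mN : measurable_fun setT (-%R : measurableTypeR R -> measurableTypeR R) by exact: oppr_measurable.
transitivity (\int[mu]_(x in -%R @^-1` A) ((fun x => (phi x)%:E) \o (-%R : R -> R)) x)%E.
  by apply: eq_integral => x _; rewrite /= !normal_pdf01E sqrrN.
have := @ge0_integral_pushforward _ _ (measurableTypeR R) (measurableTypeR R) R _ mN mu A (fun x => (phi x)%:E) mA.
move=> <- //.
- apply: eq_measure_integral => B mB _;  exact: (@lebesgue_measureN R B mB).
- exact: (measurable_funS measurableT (@subsetT _ _) mphi).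
- by move=> y _; rewrite lee_fin normal_pdf_ge0.
Qed.

End rotation.

(** * Orthogonal invariance of normal matrices *)

Section transforms.
Variables (R : realType) (n d : nat).
Variables (disp : measure_display) (T : measurableType disp) (P : probability T R).
Notation N01 := (normal_prob (0 : R) 1).
Implicit Types Z : T -> 'M[R]_(n, d).
Notation iid Z := (iid_normal P (Z : T -> mx_space R n d)).

Lemma iid_normal_measurable Z i j : iid Z -> measurable_fun setT (fun w => Z w i j).
Proof. by move=> [mZ _]; move/measurable_mxP : mZ => /(_ i j). Qed.

Lemma iid_normal_marginal Z i j (A : set R) : iid Z -> measurable A ->
  P [set w | A (Z w i j)] = N01 A.
Proof.
move=> GZ mA.
have [||_ H] := @iid_normal_sub R n d 1 1 disp T P Z (fun _ => i) (fun _ => j) _ _ GZ.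
- by move=> x y _; rewrite !ord1.
- by move=> x y _; rewrite !ord1.
have := H (fun _ _ => A) (fun _ _ => mA); rewrite !big_ord1 => <-.
congr (P _); apply/seteqP; split => w /=; first by move=> Aw k l; rewrite mxE.
by move=> /(_ ord0 ord0); rewrite mxE.
Qed.

Lemma iid_normal_marginal2 Z a b j (A B : set R) : iid Z -> a != b ->
  measurable A -> measurable B ->
  P [set w | A (Z w a j) /\ B (Z w b j)] = (N01 A * N01 B)%E.
Proof.
move=> GZ ab mA mB.
have [||_ H] := @iid_normal_sub R n d 2 1 disp T P Z
  (fun k => if k == ord0 then a else b) (fun _ => j) _ _ GZ.
- move=> x y; case: (unliftP ord0 x) => [x' ->|->]; case: (unliftP ord0 y) => [y' ->|->] //=.
  + by rewrite !ord1.
  + by move=> E; move: ab; rewrite E eqxx.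
  + by move=> E; move: ab; rewrite E eqxx.
- by move=> x y _; rewrite !ord1.
have mAB k (_ : 'I_1) : measurable (if k == ord0 :> 'I_2 then A else B) by case: ifP.
have := H (fun k _ => if k == ord0 then A else B) mAB.
rewrite big_ord_recl !big_ord1 /= => <-.
congr (P _); apply/seteqP; split => w /=.
  by move=> [Aw Bw] k l; rewrite mxE; case: ifP.
by move=> H'; split; [have := H' ord0 ord0 | have := H' (lift ord0 ord0) ord0]; rewrite mxE.
Qed.

Lemma iid_normal_pair Z a b j (E : set (R * R)) : iid Z -> a != b ->
  measurable E -> P [set w | E (Z w a j, Z w b j)] = (N01 \x N01)%E E.
Proof.
move=> GZ ab mE.
have mab : measurable_fun setT
    (fun w => (Z w a j, Z w b j) : measurableTypeR R * measurableTypeR R).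
  by apply: measurable_fun_pair; exact: iid_normal_measurable.
have := @product_measure_unique _ _ _ _ R N01 N01
  (pushforward P (fun w => (Z w a j, Z w b j) : measurableTypeR R * measurableTypeR R) : {measure set _ -> \bar R}).
move=> /(_ mab) -> // A B mA mB.
exact: iid_normal_marginal2.
Qed.

Lemma iid_normal_flip Z (s : 'I_n -> 'I_d -> bool) : iid Z ->
  iid (fun w => \matrix_(i, j) ((-1) ^+ s i j * Z w i j)).
Proof.
move=> GZ; split.
  apply/measurable_mxP => i j; under eq_fun do rewrite mxE.
  by apply: measurable_funM => //; exact: iid_normal_measurable.
move=> A mA; pose A' i j := (if s i j then -%R @^-1` A i j else A i j) : set R.
have mA' i j : measurable (A' i j).
  rewrite /A'; case: ifP => // _; rewrite -[X in measurable X]setTI.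
  exact: (@oppr_measurable R setT).
rewrite (_ : [set w | _] = [set w | forall i j, A' i j (Z w i j)]).
  rewrite (proj2 GZ) //; apply: eq_bigr => i _; apply: eq_bigr => j _.
  by rewrite /A'; case: ifP => // _; rewrite normal_probN.
apply/seteqP; split => w /= H i j; have := H i j; rewrite /A' mxE;
by case: (s i j); rewrite /= ?expr1 ?expr0 ?mulN1r ?mul1r.
Qed.

(** A plane rotation of rows [a] and [b] in the single column [j]: only two entries change, which
    reduces invariance to the planar case. Whole rows are rotated column by column. *)
Definition givens_entry (c s : R) (a b : 'I_n) (j : 'I_d) (M : 'M[R]_(n, d)) : 'M[R]_(n, d) :=
  \matrix_(i, k) if k == j then
     if i == a then c * M a j - s * M b j
     else if i == b then s * M a j + c * M b j else M i k
   else M i k.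

(** Resampling the two rotated entries turns the event into a product of an event on the untouched
    entries and a planar event, to which [normal_rotation] applies. *)
Lemma iid_normal_givens_entry Z (c s : R) a b j : iid Z -> a != b ->
  0 < c -> c ^+ 2 + s ^+ 2 = 1 ->
  iid (fun w => givens_entry c s a b j (Z w)).
Proof.
move=> GZ ab c0 cs1; have ba : b != a by rewrite eq_sym.
have mgiv : measurable_fun setT (givens_entry c s a b j : mx_space R n d -> mx_space R n d).
  apply: (proj1 (@measurable_mxP R n d _ (mx_space R n d) (givens_entry c s a b j))) => i k; under eq_fun do rewrite mxE.
  case: (k == j); last exact: measurable_mx_entry.
  case: (i == a).
    by apply: measurable_funB; apply: measurable_funM => //; exact: measurable_mx_entry.
  case: (i == b); last exact: measurable_mx_entry.
  by apply: measurable_funD; apply: measurable_funM => //; exact: measurable_mx_entry.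
split; first exact: (measurableT_comp mgiv (proj1 GZ)).
move=> A mA; pose J i k := (k == j) && ((i == a) || (i == b)).
have mbox : measurable [set M : mx_space R n d | forall i k, A i k ((M : 'M[R]_(n, d)) i k)].
  by apply: sub_sigma_algebra; exists A.
have mrect (B : 'I_n -> 'I_d -> set R) : (forall i k, measurable (B i k)) ->
    measurable [set w | forall i k, B i k (Z w i k)].
  move=> mB; rewrite -[X in measurable X]setTI.
  apply: (proj1 GZ measurableT [set M : mx_space R n d | forall i k, B i k ((M : 'M[R]_(n, d)) i k)]).
  by apply: sub_sigma_algebra; exists B.
have GJ := iid_normal_resample J GZ GZ.
set ZJ := (X in iid_normal _ X) in GJ.
(* The constraints of the box on the untouched entries; [E] below collects those on the rotated
   pair. *)
pose O := [set w | forall i k, ~~ J i k -> A i k (Z w i k)].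
have mO : measurable O.
  rewrite (_ : O = [set w | forall i k, (if J i k then setT else A i k) (Z w i k)]).
    by apply: (mrect (fun i k => if J i k then setT else A i k)) => i k; case: ifP.
  apply/seteqP; split => w /= H i k; first by case: ifPn => // /H.
  by move=> /negbTE Jik; have := H i k; rewrite Jik.
pose E := [set p : R * R | A a j (c * p.1 - s * p.2) /\ A b j (s * p.1 + c * p.2)].
have mE : measurable E.
  have mf : measurable_fun setT (fun p : R * R => (c * p.1 - s * p.2, s * p.1 + c * p.2)).
    by apply: measurable_fun_pair; [apply: measurable_funB|apply: measurable_funD];
      apply: measurable_funM.
  have := mf measurableT (A a j `*` A b j) (measurableX (mA _ _) (mA _ _)).
  by rewrite setTI.
have mpair B : measurable B -> measurable [set w | B (Z w a j, Z w b j)].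
  move=> mB; rewrite -[X in measurable X]setTI.
  have mab : measurable_fun setT (fun w => (Z w a j, Z w b j)).
    by apply: measurable_fun_pair; exact: iid_normal_measurable.
  exact: mab.
have J_a : J a j by rewrite /J !eqxx.
have J_b : J b j by rewrite /J !eqxx orbT.
transitivity ((P \x P) (O `*` [set w | E (Z w a j, Z w b j)]))%E.
  transitivity ((P \x P) (ZJ @^-1` (givens_entry c s a b j @^-1`
      [set M : mx_space R n d | forall i k, A i k ((M : 'M[R]_(n, d)) i k)])))%E.
    rewrite -(iid_normal_law GZ GJ) //.
    by rewrite -[X in measurable X]setTI; exact: mgiv.
  congr ((P \x P)%E _); apply/seteqP; split => -[w w'] /=.
    move=> H; split.
      move=> i k /negbTE Jik; have := H i k; rewrite /givens_entry /ZJ !mxE /= Jik J_a J_b.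
      by move: Jik; rewrite /J; case: (k == j) => //=; case: (i == a) => //=; case: (i == b).
    split; [have := H a j | have := H b j]; rewrite /givens_entry /ZJ !mxE /= J_a J_b eqxx.
      by rewrite eqxx.
    by rewrite (negbTE ba) eqxx.
  move=> [HO [Ea Eb]] i k; rewrite /givens_entry /ZJ !mxE /= J_a J_b.
  case: (eqVneq k j) => [->|kj]; last by rewrite /J (negbTE kj) /=; apply: HO; rewrite /J (negbTE kj).
  case: (eqVneq i a) => [-> //|ia]; case: (eqVneq i b) => [-> //|ib].
  by rewrite /J (negbTE ia) (negbTE ib) andbF; apply: HO; rewrite /J (negbTE ia) (negbTE ib) andbF.
transitivity (P O * P [set w | E (Z w a j, Z w b j)])%E.
  by apply: product_measure1E => //; exact: mpair.
rewrite (iid_normal_pair _ GZ ab mE) normal_rotation //.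
rewrite -(iid_normal_marginal2 j GZ ab) // -(proj2 GZ) //.
have mAA : measurable (A a j `*` A b j) by exact: measurableX.
transitivity ((P \x P) (O `*` [set w | A a j (Z w a j) /\ A b j (Z w b j)]))%E.
  by apply/esym/product_measure1E => //; exact: (mpair _ mAA).
transitivity ((P \x P) (ZJ @^-1`
      [set M : mx_space R n d | forall i k, A i k ((M : 'M[R]_(n, d)) i k)]))%E; last first.
  by rewrite -(iid_normal_law GZ GJ).
congr ((P \x P)%E _); apply/seteqP; split => -[w w'] /=.
  move=> [HO [Ea Eb]] i k; rewrite /ZJ mxE /=; case: ifPn => [|/HO //].
  by move=> /andP[/eqP -> /orP[/eqP ->|/eqP ->]].
move=> H; split.
  by move=> i k /negbTE Jik; have := H i k; rewrite /ZJ mxE /= Jik.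
by split; [have := H a j | have := H b j]; rewrite /ZJ mxE /= ?J_a ?J_b.
Qed.

End transforms.

(** * Products of plane rotations *)

Section givens.
Variables (R : realType) (n : nat) (a b : 'I_n).
Hypothesis ab : a != b.

Definition givens d (c s : R) (M : 'M[R]_(n, d)) : 'M[R]_(n, d) :=
  \matrix_(i, k) if i == a then c * M a k - s * M b k
                 else if i == b then s * M a k + c * M b k else M i k.

Lemma givensE d c s (M : 'M[R]_(n, d)) : givens c s M = givens c s 1%:M *m M.
Proof.
apply/row_matrixP => i; rewrite row_mul.
have -> : row i (givens c s (1%:M : 'M[R]_n)) =
    if i == a then c *: row a 1%:M - s *: row b 1%:M
    else if i == b then s *: row a 1%:M + c *: row b 1%:M else row i 1%:M.
  by apply/rowP => k; rewrite !mxE; case: ifP => _; [|case: ifP => _]; rewrite !mxE.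
case: ifP => ia; [|case: ifP => ib];
  rewrite ?mulmxBl ?mulmxDl -?scalemxAl -!row_mul !mul1mx;
  by apply/rowP => k; rewrite !mxE ia ?ib.
Qed.

Lemma givens_orthogonal (c s : R) : c ^+ 2 + s ^+ 2 = 1 ->
  givens c s (1%:M : 'M[R]_n) *m (givens c s 1%:M)^T = 1%:M.
Proof.
move=> cs1; have ba : b != a by rewrite eq_sym.
rewrite -givensE; apply/matrixP => i k; rewrite !mxE !eqxx (negbTE ab) (negbTE ba).
rewrite ![a == i]eq_sym ![b == i]eq_sym.
have [ia|ia] := eqVneq i a; [|have [ib|ib] := eqVneq i b];
  (have [ka|ka] := eqVneq k a; [|have [kb|kb] := eqVneq k b]);
  rewrite ?ia ?ib ?ka ?kb ?eqxx ?(negbTE ab) ?(negbTE ba) ?[a == k]eq_sym ?[b == k]eq_sym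
    ?(negbTE ka) ?(negbTE kb) ?(negbTE ia) ?(negbTE ib) //=; try (by ring); try by rewrite -[RHS]mul1r -cs1; ring.
by rewrite eq_sym.
Qed.

Lemma iid_normal_givens d disp (T : measurableType disp) (P : probability T R)
    (Z : T -> 'M[R]_(n, d)) (c s : R) :
  0 < c -> c ^+ 2 + s ^+ 2 = 1 -> iid_normal P (Z : T -> mx_space R n d) ->
  iid_normal P (fun w => givens c s 1%:M *m Z w : mx_space R n d).
Proof.
move=> c0 cs1 GZ; have ba : b != a by rewrite eq_sym.
(* Induction on the list [js] of columns already rotated. *)
pose G js (M : 'M[R]_(n, d)) : 'M[R]_(n, d) :=
  \matrix_(i, k) if k \in (js : seq 'I_d) then givens c s M i k else M i k.
suff {}H js : iid_normal P (fun w => G js (Z w) : mx_space R n d).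
  have := H (enum 'I_d); congr iid_normal; apply/funext => w; rewrite -givensE.
  by apply/matrixP => i k; rewrite mxE mem_enum inE.
elim: js => [|j js IH].
  by move: GZ; congr iid_normal; apply/funext => w; apply/matrixP => i k; rewrite mxE.
have [jjs|jjs] := boolP (j \in js).
  move: IH; congr iid_normal; apply/funext => w; apply/matrixP => i k.
  by rewrite !mxE inE; case: (eqVneq k j) => [->|] //=; rewrite jjs.
have := iid_normal_givens_entry j IH ab c0 cs1.
congr iid_normal; apply/funext => w; apply/matrixP => i k.
rewrite !mxE inE; have [->|kj] //= := eqVneq k j.
by rewrite (negbTE jjs).
Qed.

End givens.

(** A product of plane rotations, each of which merges one more coordinate of [v] into row [i0].
    Since [v i0] is positive, all the cosines are positive, as the invariance of the law
    requires. *)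
Lemma exists_iid_normal_orthogonal (R : realType) n (v : 'I_n -> R) (i0 : 'I_n) :
  0 < v i0 -> exists O : 'M[R]_n, [/\ O *m O^T = 1%:M,
    (forall j, O i0 j = v j / Num.sqrt (\sum_k v k ^+ 2)) &
    forall d disp (T : measurableType disp) (P : probability T R)
      (Z : T -> 'M[R]_(n, d)), iid_normal P (Z : T -> mx_space R n d) ->
      iid_normal P (fun w => O *m Z w : mx_space R n d)].
Proof.
move=> v0.
(* The norm of [v] restricted to [i0 :: js]. *)
pose r js := Num.sqrt (v i0 ^+ 2 + \sum_(j <- js) v j ^+ 2).
have rgt0 js : 0 < r js.
  by rewrite sqrtr_gt0 ltr_pwDl ?exprn_gt0 // sumr_ge0 // => j _; exact: sqr_ge0.
(* The third clause says that rows not yet merged are still those of the identity; the next rotation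
   relies on it to insert exactly one new entry in row [i0]. *)
suff H js : uniq (i0 :: js) -> exists O : 'M[R]_n, [/\ O *m O^T = 1%:M,
    (forall j, O i0 j = (if j \in i0 :: js then v j else 0) / r js),
    (forall j k, j \notin i0 :: js -> O j k = (j == k)%:R) &
    forall d disp (T : measurableType disp) (P : probability T R)
      (Z : T -> 'M[R]_(n, d)), iid_normal P (Z : T -> mx_space R n d) ->
      iid_normal P (fun w => O *m Z w : mx_space R n d)].
  have [|O [OO Oi0 _ OZ]] := H (rem i0 (enum 'I_n)).
    by rewrite /= rem_uniq ?enum_uniq // mem_rem_uniqF ?enum_uniq.
  exists O; split => // j; rewrite Oi0.
  have p := perm_to_rem (mem_enum predT i0).
  rewrite -(perm_mem p) mem_enum inE /r; congr (_ / Num.sqrt _).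
  by rewrite -big_enum (perm_big _ p) /= big_cons.
elim: js => [|j js IH] js_uniq.
  exists 1%:M; split => [|j|j k _|d disp T P Z GZ].
  - by rewrite mul1mx trmx1.
  - rewrite mxE /r big_nil addr0 sqrtr_sqr gtr0_norm // inE eq_sym.
    by case: eqVneq => [->|_]; rewrite ?mul0r // divff // gt_eqF.
  - by rewrite mxE.
  - by under [X in iid_normal _ X]eq_fun do rewrite mul1mx.
have [|O [OO Oi0 Oj OZ]] := IH.
  by move: js_uniq => /=; rewrite inE negb_or => /and3P[/andP[_ ->] _ ->].
move: js_uniq; rewrite /= inE negb_or => /and3P[/andP[i0j i0js] jjs js_uniq].
have jjs' : j \notin i0 :: js by rewrite inE negb_or eq_sym i0j.
have rE : r (j :: js) ^+ 2 = r js ^+ 2 + v j ^+ 2.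
  rewrite !sqr_sqrtr ?addr_ge0 ?sqr_ge0 ?sumr_ge0 // => [|k _|k _]; rewrite ?sqr_ge0 //.
  by rewrite big_cons addrCA addrC.
(* The angle that scales the old part of row [i0] to the new norm and puts [v j / r (j :: js)] at
   place [j]. *)
pose c := r js / r (j :: js); pose s := - (v j / r (j :: js)).
have c0 : 0 < c by rewrite divr_gt0.
have cs1 : c ^+ 2 + s ^+ 2 = 1.
  by rewrite /c /s sqrrN !expr_div_n -mulrDl -rE divff // sqrf_eq0 gt_eqF.
exists (givens i0 j c s 1%:M *m O); split => [|k|k l kjs|d disp T P Z GZ].
- rewrite trmx_mul mulmxA -[_ *m O *m _]mulmxA OO mulmx1.
  exact: givens_orthogonal.
- rewrite -givensE mxE eqxx Oi0 (Oj _ _ jjs') /c /s !inE mulNr opprK.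
  have [<-|kj] := eqVneq j k.
    rewrite ?eqxx ?orbT ?[j == i0]eq_sym (negbTE i0j) (negbTE jjs) /=.
    by rewrite mul0r mulr0 add0r mulr1.
  rewrite mulr0 addr0 ?[k == j]eq_sym ?(negbTE kj) /=.
  by rewrite mulrC -mulrA; congr (_ * _); rewrite mulrA mulVf ?gt_eqF // mul1r.
- move: kjs; rewrite !inE !negb_or => /and3P[ki0 kj kjs].
  by rewrite -givensE mxE (negbTE ki0) (negbTE kj) Oj // inE negb_or ki0.
- under [X in iid_normal _ X]eq_fun do rewrite -mulmxA.
  by apply: iid_normal_givens => //; exact: OZ.
Qed.

(** * Moments of the normal law *)

Section normal_moments.
Variable R : realType.
Notation mu := (@lebesgue_measure R).
Notation N01 := (normal_prob (0 : R) 1).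
Notation phi := (normal_pdf (0 : R) 1).

Lemma ge0_integral_normal_prob (f : R -> \bar R) : measurable_fun setT f ->
  (forall x, 0 <= f x)%E ->
  (\int[N01]_x f x = \int[mu]_x (f x * (phi x)%:E))%E.
Proof.
move=> mf f0.
have mphi : measurable_fun setT (fun x => (phi x)%:E).
  by apply/measurable_EFinP; exact: measurable_normal_pdf.
(* Truncation makes [f] integrable, as [integral_normal_prob] requires; monotone convergence then
   removes it. *)
pose g k x := mine (f x) k%:R%:E.
have mg k : measurable_fun setT (g k) by exact: measurable_mine.
have g0 k x : (0 <= g k x)%E by rewrite /g le_min f0 lee_fin ler0n.
have ndg x : {homo g^~ x : k l / (k <= l)%N >-> (k <= l)%E}.
  move=> k l kl; rewrite /g le_min ge_min lexx /= ge_min; apply/orP; right.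
  by rewrite lee_fin ler_nat.
have cvg_g x : (fun k => g k x) @ \oo --> f x.
  have [fx|fx] := eqVneq (f x) +oo%E.
    have -> : (fun k => g k x) = (fun k => (k%:R : R)%:E).
      by apply/funext => k; rewrite /g fx minye.
    by rewrite fx; apply/cvgeryP; exact: cvgr_idn.
  have fin : f x \is a fin_num by rewrite ge0_fin_numE // ltey.
  have [k0 fk0] : exists k0 : nat, fine (f x) <= k0%:R.
    by exists (Num.bound (fine (f x))); rewrite ltW // archi_boundP // fine_ge0.
  apply: cvg_near_cst; exists k0 => // k /= k0k; rewrite /g; apply/min_idPl.
  by rewrite -(fineK fin) lee_fin (le_trans fk0) // ler_nat.
have E1 : (\int[N01]_x g k x @[k --> \oo] --> \int[N01]_x f x)%E.
  have -> : (\int[N01]_x f x = \int[N01]_x limn (g^~ x))%E.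
    by apply: eq_integral => x _; apply/esym/cvg_lim.
  by apply: cvg_monotone_convergence.
have E2 : (\int[mu]_x (g k x * (phi x)%:E) @[k --> \oo] --> \int[mu]_x (f x * (phi x)%:E))%E.
  have -> : (\int[mu]_x (f x * (phi x)%:E) = \int[mu]_x limn (fun k => g k x * (phi x)%:E))%E.
    apply: eq_integral => x _; apply/esym/cvg_lim => //.
    by apply: cvgeZr; [|exact: cvg_g].
  apply: cvg_monotone_convergence => //.
  - by move=> k; exact: (emeasurable_funM (mg k) mphi).
  - by move=> k x _; rewrite mule_ge0 // lee_fin normal_pdf_ge0.
  - by move=> x _ k l kl; rewrite lee_wpmul2r ?lee_fin ?normal_pdf_ge0 //; exact: ndg.
rewrite -(cvg_lim _ E1) // -(cvg_lim _ E2) //; congr (limn _); apply/funext => k.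
apply: integral_normal_prob => //.
apply: (@le_lt_trans _ _ (\int[N01]_x (cst k%:R%:E) x)%E).
  apply: ge0_le_integral => //.
  - exact: (measurableT_comp (@abse_measurable R setT) (mg k)).
  - by move=> x _; rewrite gee0_abs // /g ge_min lexx orbT.
rewrite integral_cst; last by [].
change (k%:R%:E * N01 setT < +oo)%E; rewrite (_ : N01 setT = 1%E) ?mule1 ?ltry //; exact: (@probability_setT _ _ _ N01).
Qed.

(** The exponential factor turns the density of N(0, 1) into [sg] times that of N(0, [sg]^2). These
    exponential moments yield the second moment without integration by parts. *)
Lemma integral_normal_expR_sqr (sg : R) : 0 < sg ->
  (\int[N01]_x (expR ((1 - sg ^- 2) / 2 * x ^+ 2))%:E = sg%:E)%E.
Proof.
move=> s0; rewrite ge0_integral_normal_prob; last 2 first.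
- by apply/measurable_EFinP/measurableT_comp => //; apply: measurable_funM => //.
- by move=> x; rewrite lee_fin expR_ge0.
transitivity (\int[mu]_x (sg%:E * (normal_pdf 0 sg x)%:E))%E; last first.
  rewrite ge0_integralZl //; last 3 first.
  - by apply/measurable_EFinP; exact: measurable_normal_pdf.
  - by move=> x _; rewrite lee_fin normal_pdf_ge0.
  - by rewrite lee_fin ltW.
  by rewrite integral_normal_pdf mule1.
apply: eq_integral => x _; rewrite -!EFinM; congr EFin.
rewrite normal_pdf01E normal_pdfE ?gt_eqF // /normal_fun subr0 mulrCA -expRD.
rewrite [RHS]mulrA; congr (_ * expR _).
  rewrite /normal_peak expr1n mul1r -[in RHS]mulrnAr sqrtrM ?sqr_ge0 // sqrtr_sqr.
  by rewrite gtr0_norm // invfM mulrA divff ?gt_eqF // mul1r.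
by field; rewrite gt_eqF.
Qed.

(** After division by [sg - 1], [r] lies below [2 * sg ^+ 2 / (sg + 1)] for [sg > 1] and above it
    for [sg < 1]; this quantity tends to 1 with [sg]. *)
Lemma sandwich_eq1 (r : R) :
  (forall sg, 1 < sg -> 1 + (1 - sg ^- 2) / 2 * r <= sg) ->
  (forall sg, 0 < sg -> sg < 1 -> 1 <= sg + (sg ^- 2 - 1) / 2 * r) -> r = 1.
Proof.
move=> up lo.
have {}up (sg : R) : 1 < sg -> r <= 2 * sg ^+ 2 / (sg + 1).
  move=> s1; have H := up _ s1.
  have s0 : 0 < sg by lra.
  rewrite ler_pdivlMr; last lra.
  have : (1 - sg ^- 2) / 2 * r <= sg - 1 by lra.
  have -> : (1 - sg ^- 2) / 2 * r = (sg - 1) * ((sg + 1) * r) / (2 * sg ^+ 2) by field; lra.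
  rewrite ler_pdivrMr; last by rewrite mulr_gt0 // exprn_gt0.
  by rewrite ler_pM2l ?subr_gt0 // mulrC.
have {}lo (sg : R) : 0 < sg -> sg < 1 -> 2 * sg ^+ 2 / (sg + 1) <= r.
  move=> s0 s1; have H := lo _ s0 s1.
  rewrite ler_pdivrMr; last lra.
  have : (1 - sg) <= (sg ^- 2 - 1) / 2 * r by lra.
  have -> : (sg ^- 2 - 1) / 2 * r = (1 - sg) * ((sg + 1) * r) / (2 * sg ^+ 2) by field; lra.
  rewrite ler_pdivlMr; last by rewrite mulr_gt0 // exprn_gt0.
  by rewrite ler_pM2l ?subr_gt0 // [r * _]mulrC.
apply/eqP; rewrite eq_le; apply/andP; split.
  apply/ler_addgt0Pr => e e0; pose s := 1 + Num.min 1 (e / 4).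
  have s1 : 1 < s by rewrite ltrDl lt_min ltr01 divr_gt0.
  have s2 : s <= 2 by rewrite (_ : 2 = 1 + 1) // lerD2l ge_min lexx.
  have s3 : s <= 1 + e / 4 by rewrite lerD2l ge_min lexx orbT.
  apply: (le_trans (up _ s1)); rewrite ler_pdivrMr; last lra.
  move: s s1 s2 s3 => s s1 s2 s3; nra.
apply/ler_addgt0Pr => e e0; pose s := 1 - Num.min (1 / 2) (e / 4).
have s1 : s < 1 by rewrite ltrBlDr ltrDl lt_min; apply/andP; split; lra.
have s0 : 1 - 1 / 2 <= s by rewrite lerD2l lerN2 ge_min lexx.
have s3 : 1 - e / 4 <= s by rewrite lerD2l lerN2 ge_min lexx orbT.
move: s s1 s0 s3 => s s1 s0 s3.
rewrite -lerBlDr; apply: le_trans (lo s _ s1); last lra.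
rewrite ler_pdivlMr; last lra.
nra.
Qed.

(** Integrating [1 + t <= expR t] at [t = (1 - sg ^- 2) / 2 * x ^+ 2] gives [up] and [lo]; for
    [sg < 1], [t] is negative and moves to the other side, so that all integrands stay
    nonnegative. *)
Lemma integral_normal_sqr : (\int[N01]_x (x ^+ 2)%:E = 1)%E.
Proof.
set m := (\int[N01]_x _)%E.
have m0 : (0 <= m)%E by apply: integral_ge0 => x _; rewrite lee_fin sqr_ge0.
have mX : measurable_fun setT (fun x : R => (x ^+ 2)%:E).
  by apply/measurable_EFinP; exact: exprn_measurable.
have mexp (a : R) : measurable_fun setT (fun x : R => (expR (a * x ^+ 2))%:E).
  by apply/measurable_EFinP/measurableT_comp => //; apply: measurable_funM.
have int1 : (\int[N01]_x 1 = 1)%E.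
  by rewrite integral_cst; [rewrite mul1e; exact: (@probability_setT _ _ _ N01)|].
have up (sg : R) : 1 < sg -> (1 + ((1 - sg ^- 2) / 2)%:E * m <= sg%:E)%E.
  move=> s1; have s0 : 0 < sg by rewrite (lt_trans ltr01).
  have t0 : 0 <= (1 - sg ^- 2) / 2.
    by rewrite divr_ge0 // subr_ge0 invf_le1 ?exprn_gt0 // exprn_ege1 // ltW.
  rewrite -(integral_normal_expR_sqr s0) -ge0_integralZl //; last first.
    by move=> x _; rewrite lee_fin sqr_ge0.
  rewrite -[in X in (X + _)%E]int1 -ge0_integralD //; last 2 first.
  - by move=> x _; rewrite mule_ge0 // lee_fin sqr_ge0.
  - exact: emeasurable_funM.
  apply: ge0_le_integral => //.
  - by move=> x _; rewrite adde_ge0 // mule_ge0 // lee_fin sqr_ge0.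
  - by apply: emeasurable_funD => //; exact: emeasurable_funM.
  - exact: mexp.
  - by move=> x _; rewrite -EFinM -EFinD lee_fin expR_ge1Dx.
have lo (sg : R) : 0 < sg -> sg < 1 -> (1 <= sg%:E + ((sg ^- 2 - 1) / 2)%:E * m)%E.
  move=> s0 s1.
  have t0 : 0 <= (sg ^- 2 - 1) / 2.
    by rewrite divr_ge0 // subr_ge0 invf_ge1 ?exprn_gt0 // exprn_ile1 // ltW.
  rewrite -(integral_normal_expR_sqr s0) -ge0_integralZl //; last first.
    by move=> x _; rewrite lee_fin sqr_ge0.
  rewrite -[in X in (X <= _)%E]int1 -ge0_integralD //; last 3 first.
  - exact: mexp.
  - by move=> x _; rewrite mule_ge0 // lee_fin sqr_ge0.
  - exact: emeasurable_funM.
  apply: ge0_le_integral => //.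
  - by apply: emeasurable_funD; [exact: mexp|exact: emeasurable_funM].
  - move=> x _; rewrite -EFinM -EFinD lee_fin.
    have := expR_ge1Dx ((1 - sg ^- 2) / 2 * x ^+ 2); lra.
(* Any single [sg > 1] in [up] excludes an infinite moment. *)
have mfin : m \is a fin_num.
  rewrite ge0_fin_numE // ltNge; apply/negP => moo.
  have : m = +oo%E by apply/eqP; rewrite eq_le leey moo.
  move=> mE; have := up 2 ltac:(lra).
  rewrite mE gt0_muley ?addey // lte_fin; lra.
rewrite -(fineK mfin); congr EFin; apply: sandwich_eq1 => [sg s1|sg s0 s1].
  by have := up _ s1; rewrite -(fineK mfin) -EFinM -EFinD lee_fin.
by have := lo _ s0 s1; rewrite -(fineK mfin) -EFinM -EFinD lee_fin.
Qed.

End normal_moments.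

(** * Averages over random signs *)

Section rademacher.
Variables (R : realType) (n : nat).
Notation signs := {ffun 'I_n -> bool}.
Notation N := (#|{: signs}|%:R : R).
Implicit Types (e : signs) (i j : 'I_n) (a : 'I_n -> R).

Definition sgn e i : R := (-1) ^+ e i.

Lemma sgn_sqr e i : sgn e i ^+ 2 = 1.
Proof. exact: sqrr_sign. Qed.

Definition flip_sign i e : signs := [ffun j => (j == i) (+) e j].

Lemma flip_signK i : involutive (flip_sign i).
Proof. by move=> e; apply/ffunP => j; rewrite !ffunE addbA addbb. Qed.

Lemma sgn_flip i e j : sgn (flip_sign i e) j = if j == i then - sgn e j else sgn e j.
Proof. by rewrite /sgn ffunE; case: eqVneq => //= _; case: (e j); rewrite /= ?opprK. Qed.

Lemma sum_flip i (f : signs -> R) : \sum_e f e = \sum_e f (flip_sign i e).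
Proof. by rewrite (reindex_inj (can_inj (flip_signK i))). Qed.

(** Summed over a list, so that an induction can add one sign at a time. *)
Definition lsum a e (s : seq 'I_n) : R := \sum_(j <- s) a j * sgn e j.

Lemma lsum_flip a i e s : i \notin s -> lsum a (flip_sign i e) s = lsum a e s.
Proof.
move=> is_; rewrite /lsum big_seq [RHS]big_seq; apply: eq_bigr => j js.
by rewrite sgn_flip; case: eqVneq => // ji; move: is_; rewrite -ji js.
Qed.

(* Each new sign [e i] is independent of the others, so that averaging over
   its two values kills the odd powers of [a i * sgn e i]. *)
Lemma sum_average i (f : signs -> R) :
  \sum_e f e = \sum_e (f e + f (flip_sign i e)) / 2.
Proof. by rewrite -mulr_suml big_split /= -sum_flip; field. Qed.

Lemma sum_lsum_sqr a s : uniq s ->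
  \sum_e lsum a e s ^+ 2 = N * \sum_(j <- s) a j ^+ 2.
Proof.
elim: s => [_|i s IH /= /andP[is_ us]].
  by rewrite big_nil mulr0 big1 // => e _; rewrite /lsum big_nil expr0n.
rewrite big_cons mulrDr -IH // (sum_average i).
rewrite [in RHS]mulr_natl -sumr_const -big_split /=; apply: eq_bigr => e _.
rewrite /lsum !big_cons -!/(lsum _ _ _) lsum_flip // sgn_flip eqxx.
have x2 := sgn_sqr e i; move: (sgn e i) x2 (lsum a e s) => x x2 y.
by transitivity (a i ^+ 2 * x ^+ 2 + y ^+ 2); [field|rewrite x2 mulr1].
Qed.

(** The constant 3 is the fourth moment of N(0, 1), as 15 is the sixth in the next lemma; the
    expansion over one new sign has smaller coefficients on the pure powers of [a i], and the
    difference is given away. *)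
Lemma sum_lsum_4 a s : uniq s ->
  \sum_e lsum a e s ^+ 4 <= N * (3 * (\sum_(j <- s) a j ^+ 2) ^+ 2).
Proof.
elim: s => [_|i s IH /= /andP[is_ us]].
  by rewrite big_nil expr0n !mulr0 big1 // => e _; rewrite /lsum big_nil expr0n.
have -> : \sum_e lsum a e (i :: s) ^+ 4 = \sum_e lsum a e s ^+ 4 +
    6 * a i ^+ 2 * \sum_e lsum a e s ^+ 2 + N * a i ^+ 4.
  rewrite (sum_average i) [N * _]mulr_natl -sumr_const mulr_sumr -!big_split /=.
  apply: eq_bigr => e _.
  rewrite /lsum !big_cons -!/(lsum _ _ _) lsum_flip // sgn_flip eqxx.
  have x2 := sgn_sqr e i; move: (sgn e i) x2 (lsum a e s) => x x2 y.
  have x4 : x ^+ 4 = 1 by rewrite (exprM _ 2 2) x2 expr1n.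
  transitivity (y ^+ 4 + 6 * a i ^+ 2 * x ^+ 2 * y ^+ 2 + a i ^+ 4 * x ^+ 4); first by field.
  by rewrite x2 x4 !mulr1.
rewrite (sum_lsum_sqr _ us) big_cons.
set S := \sum_(j <- s) _ in IH *; have S0 : 0 <= S by apply: sumr_ge0 => j _; exact: sqr_ge0.
have := IH us; set F := \sum_e _; have a20 := sqr_ge0 (a i).
have -> : a i ^+ 4 = (a i ^+ 2) ^+ 2 by rewrite -exprM.
move: (a i ^+ 2) a20 => b b0 HF; have N0 : 0 <= N by exact: ler0n.
have : 0 <= N * b ^+ 2 by rewrite mulr_ge0 ?sqr_ge0.
have -> : N * (3 * (b + S) ^+ 2) = N * (3 * S ^+ 2) + 6 * b * (N * S) + N * b ^+ 2 + 2 * (N * b ^+ 2) by ring.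
by lra.
Qed.

Lemma sum_lsum_6 a s : uniq s ->
  \sum_e lsum a e s ^+ 6 <= N * (15 * (\sum_(j <- s) a j ^+ 2) ^+ 3).
Proof.
elim: s => [_|i s IH /= /andP[is_ us]].
  by rewrite big_nil expr0n !mulr0 big1 // => e _; rewrite /lsum big_nil expr0n.
have -> : \sum_e lsum a e (i :: s) ^+ 6 = \sum_e lsum a e s ^+ 6 +
    15 * a i ^+ 2 * \sum_e lsum a e s ^+ 4 + 15 * a i ^+ 4 * \sum_e lsum a e s ^+ 2 + N * a i ^+ 6.
  rewrite (sum_average i) [N * _]mulr_natl -sumr_const !mulr_sumr -!big_split /=.
  apply: eq_bigr => e _.
  rewrite /lsum !big_cons -!/(lsum _ _ _) lsum_flip // sgn_flip eqxx.
  have x2 := sgn_sqr e i; move: (sgn e i) x2 (lsum a e s) => x x2 y.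
  have x4 : x ^+ 4 = 1 by rewrite (exprM _ 2 2) x2 expr1n.
  have x6 : x ^+ 6 = 1 by rewrite (exprM _ 2 3) x2 expr1n.
  transitivity (y ^+ 6 + 15 * a i ^+ 2 * x ^+ 2 * y ^+ 4 + 15 * a i ^+ 4 * x ^+ 4 * y ^+ 2 + a i ^+ 6 * x ^+ 6).
    by field.
  by rewrite x2 x4 x6 !mulr1.
rewrite (sum_lsum_sqr _ us) big_cons; have H4 := sum_lsum_4 a us.
set S := \sum_(j <- s) _ in IH H4 *; have S0 : 0 <= S by apply: sumr_ge0 => j _; exact: sqr_ge0.
have := IH us; set F := \sum_e _ ^+ 6; have a20 := sqr_ge0 (a i).
set F4 := \sum_e _ ^+ 4 in H4 *.
have -> : a i ^+ 4 = (a i ^+ 2) ^+ 2 by rewrite -exprM.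
have -> : a i ^+ 6 = (a i ^+ 2) ^+ 3 by rewrite -exprM.
move: (a i ^+ 2) a20 => b b0 HF; have N0 : 0 <= N by exact: ler0n.
have H4' : 15 * b * F4 <= 15 * b * (N * (3 * S ^+ 2)) by rewrite ler_wpM2l // mulr_ge0.
have : 0 <= N * (30 * (b ^+ 2 * S)) by rewrite !mulr_ge0 ?sqr_ge0.
have : 0 <= N * (14 * b ^+ 3) by rewrite !mulr_ge0 ?exprn_ge0.
have -> : N * (15 * (b + S) ^+ 3) = N * (15 * S ^+ 3) + 15 * b * (N * (3 * S ^+ 2)) +
  15 * b ^+ 2 * (N * S) + N * b ^+ 3 + N * (30 * (b ^+ 2 * S)) + N * (14 * b ^+ 3) by ring.
by lra.
Qed.

Implicit Types M : 'M[R]_n.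

(** The off-diagonal part of a quadratic form in the signs; the diagonal part is the constant
    [\tr M]. *)
Definition qsum M e (s : seq 'I_n) : R :=
  \sum_(i <- s) \sum_(j <- s | j != i) M i j * (sgn e i * sgn e j).

Lemma qsum_cons M i e s : i \notin s ->
  qsum M e (i :: s) = qsum M e s + sgn e i * lsum (fun j => M i j + M j i) e s.
Proof.
move=> is_; have ne j : j \in s -> (j != i) /\ (i != j).
  by move=> js; split; [|rewrite eq_sym]; apply: contraNneq is_ => <-.
rewrite /qsum big_cons big_cons eqxx /= addrC.
have -> : \sum_(j <- s) \sum_(k <- i :: s | k != j) M j k * (sgn e j * sgn e k) =
    qsum M e s + \sum_(j <- s) M j i * (sgn e j * sgn e i).
  rewrite -big_split /= big_seq [RHS]big_seq; apply: eq_bigr => j js.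
  by rewrite big_cons (proj2 (ne j js)) addrC.
rewrite -addrA; congr (_ + _).
have -> : \sum_(j <- s | j != i) M i j * (sgn e i * sgn e j) =
    \sum_(j <- s) M i j * (sgn e i * sgn e j).
  rewrite big_seq_cond [RHS]big_seq; apply: eq_bigl => j.
  by case: (boolP (j \in s)) => // js; rewrite (proj1 (ne j js)).
rewrite /lsum mulr_sumr -big_split /=; apply: eq_bigr => j _; ring.
Qed.

Lemma qsum_flip M i e s : i \notin s -> qsum M (flip_sign i e) s = qsum M e s.
Proof.
move=> is_; rewrite /qsum big_seq [RHS]big_seq; apply: eq_bigr => j js.
rewrite big_seq_cond [RHS]big_seq_cond; apply: eq_bigr => k /andP[ks _].
rewrite !sgn_flip; case: eqVneq => [ji|_]; first by move: is_; rewrite -ji js.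
by case: eqVneq => [ki|//]; move: is_; rewrite -ki ks.
Qed.

Lemma sum_qsum M s : uniq s -> \sum_e qsum M e s = 0.
Proof.
elim: s => [_|i s IH /= /andP[is_ us]].
  by rewrite big1 // => e _; rewrite /qsum big_nil.
rewrite (sum_average i) -[RHS](IH us); apply: eq_bigr => e _.
by rewrite !qsum_cons // qsum_flip // lsum_flip // sgn_flip eqxx; field.
Qed.

(** A new sign contributes an uncorrelated linear form with coefficients [M i j + M j i]; bounding
    their squares by [2 * (M i j ^+ 2 + M j i ^+ 2)] produces the factor 2 without symmetry of
    [M]. *)
Lemma sum_qsum_sqr M s : uniq s ->
  \sum_e qsum M e s ^+ 2 <= N * (2 * \sum_(i <- s) \sum_(j <- s) M i j ^+ 2).
Proof.
elim: s => [_|i s IH /= /andP[is_ us]].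
  by rewrite big_nil !mulr0 big1 // => e _; rewrite /qsum big_nil expr0n.
have -> : \sum_e qsum M e (i :: s) ^+ 2 = \sum_e qsum M e s ^+ 2 +
    \sum_e lsum (fun j => M i j + M j i) e s ^+ 2.
  rewrite (sum_average i) -big_split /=; apply: eq_bigr => e _.
  rewrite !qsum_cons // qsum_flip // lsum_flip // sgn_flip eqxx.
  have x2 := sgn_sqr e i; move: (sgn e i) x2 (lsum _ e s) (qsum M e s) => x x2 y z.
  by transitivity (z ^+ 2 + x ^+ 2 * y ^+ 2); [field|rewrite x2 mul1r].
rewrite (sum_lsum_sqr _ us).
apply: le_trans (lerD (IH us) (lexx _)) _.
rewrite -mulrDr ler_wpM2l ?ler0n // !big_cons.
have -> : \sum_(j <- s) \sum_(k <- i :: s) M j k ^+ 2 =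
   \sum_(j <- s) M j i ^+ 2 + \sum_(j <- s) \sum_(k <- s) M j k ^+ 2.
  by rewrite -big_split /=; apply: eq_bigr => j _; rewrite big_cons.
have H : \sum_(j <- s) (M i j + M j i) ^+ 2 <=
   2 * (\sum_(j <- s) M i j ^+ 2 + \sum_(j <- s) M j i ^+ 2).
  rewrite -big_split mulr_sumr /=; apply: ler_sum => j _.
  rewrite -subr_ge0 (_ : _ - _ = (M i j - M j i) ^+ 2) ?sqr_ge0 //; ring.
have := sqr_ge0 (M i i); lra.
Qed.

Lemma qsumE M e : \sum_i \sum_j M i j * (sgn e i * sgn e j) =
  \tr M + qsum M e (index_enum 'I_n).
Proof.
rewrite /mxtrace /qsum -big_split /=; apply: eq_bigr => i _.
by rewrite (bigD1 i) //= -expr2 sgn_sqr mulr1.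
Qed.

(** Squared bias plus variance: the mean of the form is [\tr M]. *)
Lemma sum_quadratic_form M (t : R) :
  \sum_e (\sum_i \sum_j M i j * (sgn e i * sgn e j) - t) ^+ 2 <=
  N * ((\tr M - t) ^+ 2 + 2 * \sum_i \sum_j M i j ^+ 2).
Proof.
have us : uniq (index_enum 'I_n) by exact: index_enum_uniq.
have -> : \sum_e (\sum_i \sum_j M i j * (sgn e i * sgn e j) - t) ^+ 2 =
    N * (\tr M - t) ^+ 2 + \sum_e qsum M e (index_enum 'I_n) ^+ 2.
  transitivity (\sum_e ((\tr M - t) ^+ 2 + qsum M e (index_enum 'I_n) ^+ 2 +
      2 * (\tr M - t) * qsum M e (index_enum 'I_n))).
    by apply: eq_bigr => e _; rewrite qsumE; ring.
  rewrite !big_split /=.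
  have -> : \sum_e 2 * (\tr M - t) * qsum M e (index_enum 'I_n) = 0.
    by rewrite -mulr_sumr sum_qsum // mulr0.
  by rewrite addr0 sumr_const [N * _]mulr_natl.
by rewrite mulrDr lerD2l; exact: sum_qsum_sqr.
Qed.

End rademacher.

(** * The hat matrix *)

Section hat.
Variables (R : realType) (n d : nat).
Implicit Types M : 'M[R]_(n, d).

(** Cramer's formula: total, and rational in the entries, hence visibly measurable. *)
Definition ginv (A : 'M[R]_d) : 'M[R]_d := (\det A)^-1 *: \adj A.

(* The orthogonal projection onto the column space of [M]; it is 0, thanks to
   [0^-1 = 0], when [M] has not full column rank. *)
Definition hat M : 'M[R]_n := M *m ginv (M^T *m M) *m M^T.

Definition gram_det M : R := \det (M^T *m M).

Lemma ginv_mul (A : 'M[R]_d) : \det A != 0 -> ginv A *m A = 1%:M.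
Proof. by move=> A0; rewrite -scalemxAl mul_adj_mx scale_scalar_mx mulVf. Qed.

Lemma hat_sym M : (hat M)^T = hat M.
Proof.
rewrite /hat !trmx_mul trmxK mulmxA /ginv linearZ /= trmx_adj.
by rewrite trmx_mul trmxK.
Qed.

Lemma hat_eq0 M : gram_det M = 0 -> hat M = 0.
Proof. by rewrite /gram_det /hat /ginv => ->; rewrite invr0 scale0r mulmx0 mul0mx. Qed.

Lemma hat_mul M : gram_det M != 0 -> hat M *m M = M.
Proof. by move=> M0; rewrite /hat -mulmxA -mulmxA ginv_mul // mulmx1. Qed.

Lemma hat_idem M : hat M *m hat M = hat M.
Proof.
have [/hat_eq0 ->|M0] := eqVneq (gram_det M) 0; first by rewrite mulmx0.
by rewrite {2}/hat !mulmxA hat_mul.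
Qed.

Lemma hat_tr M : gram_det M != 0 -> \tr (hat M) = d%:R.
Proof. by move=> M0; rewrite /hat -mulmxA mxtrace_mulC -mulmxA ginv_mul // mxtrace1. Qed.

Lemma hat_tr_le M : 0 <= \tr (hat M) <= d%:R.
Proof.
have [/hat_eq0 ->|M0] := eqVneq (gram_det M) 0; first by rewrite mxtrace0 lexx ler0n.
by rewrite hat_tr // ler0n lexx.
Qed.

(** Because [hat M] is symmetric and idempotent. So the leverage of row [i] is the squared norm of
    the coefficients of [hat_fit M i], seen as a linear form in the signs. *)
Lemma hat_diag M i : \sum_j hat M i j ^+ 2 = hat M i i.
Proof.
have -> : hat M i i = (hat M *m hat M) i i by rewrite hat_idem.
rewrite mxE; apply: eq_bigr => j _.
by have -> : hat M j i = hat M i j by rewrite -[in LHS]hat_sym mxE.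
Qed.

Lemma hat_diag_ge0 M i : 0 <= hat M i i.
Proof. by rewrite -hat_diag sumr_ge0 // => j _; exact: sqr_ge0. Qed.

Lemma hat_norm M : \sum_i \sum_j hat M i j ^+ 2 = \tr (hat M).
Proof. by apply: eq_bigr => i _; exact: hat_diag. Qed.

Lemma hat_orthogonal (O : 'M[R]_n) M : O *m O^T = 1%:M ->
  hat (O *m M) = O *m hat M *m O^T.
Proof.
move=> /mulmx1C OO; rewrite /hat trmx_mul.
have -> : M^T *m O^T *m (O *m M) = M^T *m M by rewrite mulmxA -[_ *m O^T *m O]mulmxA OO mulmx1.
by rewrite !mulmxA.
Qed.

Definition hat_fit M i : R := \sum_j hat M i j.
(* The statistics [T] and [W] of the header are [hotelling] and [score]. *)
Definition hotelling M : R := \sum_i hat_fit M i.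

Lemma hat_fit_sqr M : \sum_i hat_fit M i ^+ 2 = hotelling M.
Proof.
pose u : 'cV[R]_n := const_mx 1.
have fE i : hat_fit M i = (hat M *m u) i 0.
  by rewrite mxE; apply: eq_bigr => j _; rewrite [u _ _]mxE mulr1.
transitivity ((u^T *m hat M *m (hat M *m u)) 0 0).
  rewrite -[u^T *m _]trmxK trmx_mul trmxK hat_sym mxE; apply: eq_bigr => i _.
  by rewrite [_^T _ _]mxE fE expr2.
rewrite mulmxA -[u^T *m _ *m _]mulmxA hat_idem -mulmxA mxE.
by apply: eq_bigr => i _; rewrite [_^T _ _]mxE [u _ _]mxE mul1r fE.
Qed.

Lemma hotelling_ge0 M : 0 <= hotelling M.
Proof. by rewrite -hat_fit_sqr sumr_ge0 // => i _; exact: sqr_ge0. Qed.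

Lemma hat_fit_mul M k : gram_det M != 0 ->
  \sum_i hat_fit M i * M i k = \sum_i M i k.
Proof.
move=> M0; under eq_bigr do rewrite /hat_fit mulr_suml.
rewrite exchange_big /=; apply: eq_bigr => j _.
rewrite -[in RHS](hat_mul M0) mxE; apply: eq_bigr => i _.
by rewrite -[in LHS]hat_sym mxE.
Qed.

(** The least squares coefficients for the constant response 1. *)
Definition hat_coef M : 'cV[R]_d := ginv (M^T *m M) *m M^T *m const_mx 1.

Lemma hat_fitE M i : hat_fit M i = \sum_k M i k * hat_coef M k 0.
Proof.
have -> : hat_fit M i = (hat M *m (const_mx 1 : 'cV[R]_n)) i 0.
  by rewrite mxE; apply: eq_bigr => j _; rewrite [const_mx _ _ _]mxE mulr1.
by rewrite /hat -!mulmxA mxE; apply: eq_bigr => k _; rewrite /hat_coef -!mulmxA.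
Qed.

Definition flip_rows (e : {ffun 'I_n -> bool}) M : 'M[R]_(n, d) :=
  \matrix_(i, j) ((-1) ^+ e i * M i j).

(** Flipping rows conjugates [hat M] by a diagonal sign matrix; in particular the leverages do not
    change. *)
Lemma hat_flip_rows e M i j :
  hat (flip_rows e M) i j = hat M i j * (sgn R e i * sgn R e j).
Proof.
pose D := diag_mx (\row_i sgn R e i).
have DD : D *m D^T = 1%:M.
  rewrite tr_diag_mx mulmx_diag; apply/matrixP => k l; rewrite !mxE -expr2 sgn_sqr.
  by [].
have -> : flip_rows e M = D *m M.
  by apply/matrixP => k l; rewrite mul_diag_mx !mxE.
rewrite hat_orthogonal // tr_diag_mx mul_mx_diag mul_diag_mx !mxE.
by rewrite mulrCA mulrA mulrC mulrA mulrC [X in _ * X]mulrC.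
Qed.

Lemma gram_det_flip_rows e M : gram_det (flip_rows e M) = gram_det M.
Proof.
rewrite /gram_det; congr (\det _); apply/matrixP => k l; rewrite !mxE.
apply: eq_bigr => i _; rewrite !mxE mulrACA -expr2.
by rewrite (sqrr_sign R (e i)) mul1r.
Qed.

Lemma hotelling_flip_rows e M :
  hotelling (flip_rows e M) = \sum_i \sum_j hat M i j * (sgn R e i * sgn R e j).
Proof. by apply: eq_bigr => i _; apply: eq_bigr => j _; rewrite hat_flip_rows. Qed.

Lemma hat_fit_flip_rows e M i :
  hat_fit (flip_rows e M) i = sgn R e i * lsum (hat M i) e (index_enum 'I_n).
Proof.
rewrite /hat_fit /lsum mulr_sumr; apply: eq_bigr => j _.
by rewrite hat_flip_rows mulrCA.
Qed.

Notation N := (#|{: {ffun 'I_n -> bool}}|%:R : R).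

Lemma sum_hat_fit_4 M i :
  \sum_e hat_fit (flip_rows e M) i ^+ 4 <= N * (3 * hat M i i ^+ 2).
Proof.
under eq_bigr do rewrite hat_fit_flip_rows exprMn (exprM (sgn _ _ _) 2 2) sgn_sqr expr1n mul1r.
by rewrite -hat_diag; apply: sum_lsum_4; exact: index_enum_uniq.
Qed.

Lemma sum_hat_fit_6 M i :
  \sum_e hat_fit (flip_rows e M) i ^+ 6 <= N * (15 * hat M i i ^+ 3).
Proof.
under eq_bigr do rewrite hat_fit_flip_rows exprMn (exprM (sgn _ _ _) 2 3) sgn_sqr expr1n mul1r.
by rewrite -hat_diag; apply: sum_lsum_6; exact: index_enum_uniq.
Qed.

Lemma sum_hotelling_sub M (t : R) :
  \sum_e (hotelling (flip_rows e M) - t) ^+ 2 <=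
  N * ((\tr (hat M) - t) ^+ 2 + 2 * \tr (hat M)).
Proof.
under eq_bigr do rewrite hotelling_flip_rows.
by rewrite -[X in _ + 2 * X]hat_norm; exact: sum_quadratic_form.
Qed.

(* Jensen's inequality for the weights [hat M i i / d]. *)
Lemma hotelling_cube M e : gram_det M != 0 ->
  hotelling (flip_rows e M) ^+ 3 <=
  d%:R ^+ 2 * \sum_i hat_fit (flip_rows e M) i ^+ 6 / hat M i i ^+ 2.
Proof.
move=> M0; set F := flip_rows e M; set T := hotelling F.
have T0 : 0 <= T by exact: hotelling_ge0.
have [d0|d0] := eqVneq d 0%N.
  have h0 i : hat M i i = 0.
    have := hat_tr M0; rewrite d0 /mxtrace => /eqP.
    rewrite psumr_eq0; last by move=> j _; exact: hat_diag_ge0.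
    by move/allP/(_ i); rewrite mem_index_enum => /(_ isT)/implyP/(_ isT)/eqP.
  have -> : T = 0.
    rewrite /T /hotelling big1 // => i _; rewrite /hat_fit big1 // => j _.
    apply/eqP; rewrite -sqrf_eq0 hat_flip_rows exprMn mulf_eq0; apply/orP; left.
    have := hat_diag M i; rewrite h0 => /eqP; rewrite psumr_eq0; last by move=> ? _; exact: sqr_ge0.
    by move/allP/(_ j); rewrite mem_index_enum => /(_ isT)/implyP/(_ isT).
  by rewrite exprS mul0r mulr_ge0 ?sqr_ge0 // sumr_ge0 // => i _; rewrite divr_ge0 ?sqr_ge0 // (exprM _ 3 2) sqr_ge0.
have dp : 0 < d%:R :> R by rewrite ltr0n lt0n.
(* The inequality [x * T ^+ 2 <= x ^+ 3 / 3 + 2 * T ^+ 3 / 3] for [x = hat_fit F i ^+ 2 / w], with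
   weight [w = hat M i i / d]. Summed over [i], the left side is [T ^+ 3] and the weights add up to
   1. A zero leverage makes the whole row of the projection, hence the fit, vanish. *)
have H i : hat_fit F i ^+ 2 * T ^+ 2 <=
    3^-1 * (d%:R ^+ 2 * (hat_fit F i ^+ 6 / hat M i i ^+ 2)) + 2 / 3 * (hat M i i / d%:R * T ^+ 3).
  have [h0|h0] := eqVneq (hat M i i) 0.
    have -> : hat_fit F i = 0.
      rewrite /hat_fit big1 // => j _.
      apply/eqP; rewrite -sqrf_eq0 hat_flip_rows exprMn mulf_eq0; apply/orP; left.
      have := hat_diag M i; rewrite h0 => /eqP; rewrite psumr_eq0; last by move=> ? _; exact: sqr_ge0.
      by move/allP/(_ j); rewrite mem_index_enum => /(_ isT)/implyP/(_ isT).
    by rewrite h0 !expr0n /= !(mul0r, mulr0) addr0.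
  have hp : 0 < hat M i i by rewrite lt_def h0 hat_diag_ge0.
  pose w := hat M i i / d%:R; have w0 : 0 < w by rewrite divr_gt0.
  pose x := hat_fit F i ^+ 2 / w; have x0 : 0 <= x by rewrite divr_ge0 ?sqr_ge0 // ltW.
  have -> : d%:R ^+ 2 * (hat_fit F i ^+ 6 / hat M i i ^+ 2) = w * x ^+ 3.
    by rewrite /x /w; field; rewrite !gt_eqF.
  have -> : hat_fit F i ^+ 2 = w * x by rewrite /x; field; rewrite gt_eqF.
  rewrite -/w -subr_ge0.
  have -> : 3^-1 * (w * x ^+ 3) + 2 / 3 * (w * T ^+ 3) - w * x * T ^+ 2 =
    w * ((x - T) ^+ 2 * (x + 2 * T)) / 3 by field.
  apply: divr_ge0 => //; apply: mulr_ge0; first exact: ltW.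
  by apply: mulr_ge0; [exact: sqr_ge0|apply: addr_ge0 => //; exact: mulr_ge0].
have : \sum_i hat_fit F i ^+ 2 * T ^+ 2 <= \sum_i (3^-1 * (d%:R ^+ 2 * (hat_fit F i ^+ 6 / hat M i i ^+ 2)) + 2 / 3 * (hat M i i / d%:R * T ^+ 3)).
  by apply: ler_sum => i _; exact: H.
rewrite -mulr_suml hat_fit_sqr -/T big_split /= -!mulr_sumr -mulr_suml -mulr_suml.
rewrite -[\sum_i hat M i i]/(\tr (hat M)) hat_tr // divff ?gt_eqF // mul1r -exprS.
by set U := d%:R ^+ 2 * _; lra.
Qed.

(** The third moment of a quadratic form is thus reduced to sixth moments of linear forms: each
    average [15 * hat M i i ^+ 3], divided by [hat M i i ^+ 2], leaves a multiple of the trace. *)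
Lemma sum_hotelling_cube M : gram_det M != 0 ->
  \sum_e hotelling (flip_rows e M) ^+ 3 <= N * (15 * d%:R ^+ 3).
Proof.
move=> M0; apply: (@le_trans _ _ (\sum_e d%:R ^+ 2 * \sum_i hat_fit (flip_rows e M) i ^+ 6 / hat M i i ^+ 2)).
  by apply: ler_sum => e _; exact: hotelling_cube.
rewrite -mulr_sumr exchange_big /=.
under eq_bigr do rewrite -mulr_suml.
have -> : N * (15 * d%:R ^+ 3) = d%:R ^+ 2 * \sum_i N * (15 * hat M i i).
  by rewrite -!mulr_sumr -[\sum_i hat M i i]/(\tr (hat M)) hat_tr //; ring.
rewrite ler_wpM2l ?sqr_ge0 //; apply: ler_sum => i _.
have [h0|h0] := eqVneq (hat M i i) 0.
  by rewrite h0 expr0n /= invr0 !mulr0.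
have hp : 0 < hat M i i by rewrite lt_def h0 hat_diag_ge0.
rewrite ler_pdivrMr ?exprn_gt0 //; apply: le_trans (sum_hat_fit_6 _ _) _.
by rewrite -!mulrA -exprS.
Qed.

(** * Comparison of the two statistics under sign changes *)

Definition score M : R := (\sum_j (\sum_i M i j) ^+ 2) / n%:R.

Definition sum_sqr M : R := \sum_i \sum_j M i j ^+ 2.
(** The squared Frobenius norm of [M *m M^T], as [sum_sqr M] is its trace. *)
Definition gram_norm M : R := \sum_i \sum_k (\sum_j M i j * M k j) ^+ 2.

(** The difference is the quadratic form with matrix [B = hat M - A], where [A] is [M *m M^T] over
    n. As [hat M *m A = A], the squared norm of [B] is the trace of [hat M - 2 A + A^2]. *)
Lemma sum_hotelling_sub_score M : gram_det M != 0 ->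
  \sum_e (hotelling (flip_rows e M) - score (flip_rows e M)) ^+ 2 <=
  N * ((d%:R - sum_sqr M / n%:R) ^+ 2 +
       2 * (d%:R - 2 * (sum_sqr M / n%:R) + gram_norm M / n%:R ^+ 2)).
Proof.
move=> M0; pose A := n%:R^-1 *: (M *m M^T); pose B := hat M - A.
have E e : hotelling (flip_rows e M) - score (flip_rows e M) =
    \sum_i \sum_j B i j * (sgn R e i * sgn R e j) - 0.
  have -> : score (flip_rows e M) = \sum_i \sum_j A i j * (sgn R e i * sgn R e j).
    rewrite /score mulr_suml.
    transitivity (\sum_k \sum_i \sum_j n%:R^-1 * (M i k * M j k) * (sgn R e i * sgn R e j)).
      apply: eq_bigr => k _; rewrite expr2 mulr_suml mulr_suml; apply: eq_bigr => i _.
      rewrite mulr_sumr mulr_suml; apply: eq_bigr => j _; rewrite !mxE /sgn; ring.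
    rewrite exchange_big /=; apply: eq_bigr => i _; rewrite exchange_big /=.
    apply: eq_bigr => j _; rewrite !mxE mulr_sumr mulr_suml; apply: eq_bigr => k _.
    by rewrite mxE.
  rewrite subr0 hotelling_flip_rows -sumrB; apply: eq_bigr => i _.
  by rewrite -sumrB; apply: eq_bigr => j _; rewrite !mxE mulrBl.
under eq_bigr do rewrite E.
apply: le_trans (sum_quadratic_form _ _) _; rewrite subr0.
have AS : A^T = A by rewrite /A linearZ /= trmx_mul trmxK.
have trA : \tr A = sum_sqr M / n%:R.
  rewrite /A mxtraceZ mulrC; congr (_ / _); apply: eq_bigr => i _.
  by rewrite mxE; apply: eq_bigr => j _; rewrite mxE.
have trAA : \tr (A *m A) = gram_norm M / n%:R ^+ 2.
  rewrite /mxtrace /gram_norm mulr_suml; apply: eq_bigr => i _.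
  rewrite mxE mulr_suml; apply: eq_bigr => k _.
  rewrite -[in X in _ * X]AS !mxE -expr2 exprMn exprVn mulrC; congr (_ ^+ 2 / _).
  by apply: eq_bigr => j _; rewrite mxE.
have hA : hat M *m A = A by rewrite /A -scalemxAr mulmxA hat_mul.
have -> : \tr B = d%:R - sum_sqr M / n%:R by rewrite raddfB /= hat_tr // trA.
suff -> : \sum_i \sum_j B i j ^+ 2 = d%:R - 2 * (sum_sqr M / n%:R) + gram_norm M / n%:R ^+ 2 by [].
have -> : \sum_i \sum_j B i j ^+ 2 = \tr (B *m B).
  apply: eq_bigr => i _; rewrite mxE; apply: eq_bigr => j _.
  have BS : B^T = B by rewrite /B linearB /= AS hat_sym.
  by have -> : B j i = B i j by rewrite -[in LHS]BS [_^T _ _]mxE.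
rewrite /B mulmxBl !mulmxBr hat_idem hA !raddfB /= hat_tr // trAA.
have -> : \tr (A *m hat M) = \tr A by rewrite mxtrace_mulC hA.
rewrite trA; ring.
Qed.

End hat.

(** * Scalar inequalities *)

Section scalar.
Variable R : realType.
Implicit Types (f g df : R -> R) (a b c u x : R).

Lemma derive_ge0_le f df a b : a <= b ->
  (forall x, a <= x <= b -> is_derive x 1 f (df x)) ->
  (forall x, a < x < b -> 0 <= df x) -> f a <= f b.
Proof.
rewrite le_eqVlt => /predU1P[-> //|ab] fd df0.
have fd' x : x \in `]a, b[%R -> is_derive x 1 f (df x).
  by rewrite in_itv /= => /andP[ax xb]; apply: fd; rewrite !ltW.
have fc : {within `[a, b], continuous f}.
  apply: derivable_within_continuous => x; rewrite in_itv /= => axb.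
  by have [] := fd x axb.
have [c cab E] := @MVT R f df a b ab fd' fc.
by rewrite -subr_ge0 E mulr_ge0 ?subr_ge0 ?(ltW ab) // df0 //; rewrite in_itv in cab.
Qed.

Lemma derive_addE f g x a b : is_derive x 1 f a -> is_derive x 1 g b ->
  is_derive x 1 (fun u => f u + g u) (a + b).
Proof. exact: is_deriveD. Qed.

Lemma derive_subE f g x a b : is_derive x 1 f a -> is_derive x 1 g b ->
  is_derive x 1 (fun u => f u - g u) (a - b).
Proof. exact: is_deriveB. Qed.

Lemma derive_mulE f g x a b : is_derive x 1 f a -> is_derive x 1 g b ->
  is_derive x 1 (fun u => f u * g u) (f x * b + g x * a).
Proof. exact: is_deriveM. Qed.

Lemma derive_cstE c x : is_derive x 1 (fun=> c) 0.
Proof. exact: is_derive_cst. Qed.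

Lemma derive_idE x : is_derive x 1 (fun u => u) 1.
Proof. exact: is_derive_id. Qed.

Lemma derive_expE n x : is_derive x 1 (fun u => u ^+ n) (n%:R * x ^+ n.-1).
Proof.
have := @is_deriveX R _ id n x 1 1 (derive_idE x).
by rewrite /GRing.scale /= mulr1; congr is_derive; apply/funext => u; rewrite exprfctE.
Qed.

Lemma derive_expRN x : is_derive x 1 (fun u => expR (- u)) (- expR (- x)).
Proof.
have H : is_derive x 1 (-%R : R -> R) (-1) by exact: is_deriveNid.
have := is_derive1_comp (is_derive_expR (- x)) H.
by rewrite mulrN1.
Qed.

Lemma derive_ln_comp g x b : 0 < g x -> is_derive x 1 g b ->
  is_derive x 1 (fun u => ln (g u)) (b / g x).
Proof.
move=> g0 gb; have := is_derive1_comp (is_derive1_ln g0) gb.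
by rewrite mulrC.
Qed.

(** Twice the hyperbolic cosine and, below, twice the hyperbolic sine. *)
Let ch u := expR u + expR (- u).
Let sh u := expR u - expR (- u).

Let ch_gt0 u : 0 < ch u. Proof. by rewrite addr_gt0 ?expR_gt0. Qed.

Let sh_ge0 u : 0 <= u -> 0 <= sh u.
Proof. by move=> u0; rewrite subr_ge0 ler_expR; lra. Qed.

Let sh0 : sh 0 = 0.
Proof. by rewrite /sh oppr0 subrr. Qed.

Let ch_derive u : is_derive u 1 ch (sh u).
Proof. exact: derive_addE (is_derive_expR u) (derive_expRN u). Qed.

Let sh_derive u : is_derive u 1 sh (ch u).
Proof.
have := derive_subE (is_derive_expR u) (derive_expRN u).
by rewrite opprK.
Qed.

Let sh_le u : 0 <= u -> sh u <= u * ch u.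
Proof.
move=> u0; rewrite -subr_ge0.
have := @derive_ge0_le (fun u => u * ch u - sh u) (fun u => u * sh u) 0 u u0.
rewrite sh0 mul0r subr0; apply => [x /andP[x0 xu]|x /andP[x0 xu]].
  apply: (is_derive_eq (derive_subE (derive_mulE (derive_idE x) (ch_derive x)) (sh_derive x))).
  by rewrite /=; ring.
by rewrite mulr_ge0 ?sh_ge0 // ltW.
Qed.

(** The differentiated form of [ln_cosh_le], cleared of denominators: tanh u is at most u - u^3 / (6
    (1 + u^2)). The Taylor coefficient 1/3 leaves room for 1/6. *)
Let tanh_le u : 0 <= u -> (1 + u ^+ 2) * sh u <= (u + 5 / 6 * u ^+ 3) * ch u.
Proof.
move=> u0; rewrite -subr_ge0.
have := @derive_ge0_le (fun u => (u + 5 / 6 * u ^+ 3) * ch u - (1 + u ^+ 2) * sh u)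
  (fun u => 3 / 2 * u ^+ 2 * ch u + (5 / 6 * u ^+ 3 - u) * sh u) 0 u u0.
rewrite sh0 mulr0 subr0 add0r expr0n /= mulr0 mul0r.
apply => [x /andP[x0 xu]|x /andP[x0 xu]].
  apply: (is_derive_eq (derive_subE
    (derive_mulE (derive_addE (derive_idE x) (derive_mulE (derive_cstE (5 / 6) x) (derive_expE 3 x)))
      (ch_derive x))
    (derive_mulE (derive_addE (derive_cstE 1 x) (derive_expE 2 x)) (sh_derive x)))).
  rewrite /=; move: (sh x) (ch x) => s c. by field.
have s0 := sh_ge0 (ltW x0); have sc := sh_le (ltW x0); have c0 := ch_gt0 x.
move: (sh x) (ch x) s0 sc c0 => s c s0 sc c0.
have H : x * s <= x * (x * c) by rewrite ler_wpM2l // ltW.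
have H2 : 0 <= x ^+ 3 * s by rewrite mulr_ge0 // exprn_ge0 // ltW.
have H3 : 0 <= x ^+ 2 * c by rewrite mulr_ge0 ?sqr_ge0 // ltW.
have : x * (x * c) = x ^+ 2 * c by ring.
lra.
Qed.

Let lc u := ln (ch u / 2).

Let lcN u : lc (- u) = lc u.
Proof. by rewrite /lc /ch opprK addrC. Qed.

(** The gain over u^2 / 2 is of order u^4 near 0, yet the bound is global; and ln (1 + u^2) is
    concave in u^2, so Jensen's inequality sums it in terms of [hotelling] alone. *)
Lemma ln_cosh_le u :
  lc u <= u ^+ 2 / 2 - (u ^+ 2 - ln (1 + u ^+ 2)) / 12.
Proof.
wlog u0 : u / 0 <= u.
  move=> H; have [/H //|/ltW u0] := leP 0 u.
  by rewrite -lcN -sqrrN; apply: H; rewrite oppr_ge0.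
rewrite -subr_ge0.
have := @derive_ge0_le (fun u => u ^+ 2 / 2 - (u ^+ 2 - ln (1 + u ^+ 2)) / 12 - ln (ch u / 2))
  (fun u => u - (2 * u - (2 * u) / (1 + u ^+ 2)) / 12 - sh u / ch u) 0 u u0.
have -> : ln (ch 0 / 2) = 0 by rewrite /ch oppr0 expR0 divff ?ln1.
rewrite expr0n /= addr0 ln1 !(mul0r, subr0).
have p0 x : 0 < 1 + x ^+ 2 by rewrite ltr_pwDl // sqr_ge0.
apply => [x /andP[x0 xu]|x /andP[x0 xu]].
  have c2 : 0 < ch x / 2 by rewrite divr_gt0.
  apply: (is_derive_eq (derive_subE
    (derive_subE (derive_mulE (derive_expE 2 x) (derive_cstE 2^-1 x))
      (derive_mulE (derive_subE (derive_expE 2 x)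
         (derive_ln_comp (g := fun u => 1 + u ^+ 2) (p0 x) (derive_addE (derive_cstE 1 x) (derive_expE 2 x))))
         (derive_cstE 12^-1 x)))
    (derive_ln_comp (g := fun u => ch u / 2) c2 (derive_mulE (ch_derive x) (derive_cstE 2^-1 x))))).
  by rewrite /=; field; rewrite gt_eqF //= gt_eqF.
have c0 := ch_gt0 x; have H := tanh_le (ltW x0).
rewrite subr_ge0 ler_pdivrMr //.
have -> : x - (2 * x - 2 * x / (1 + x ^+ 2)) / 12 = (x + 5 / 6 * x ^+ 3) / (1 + x ^+ 2).
  by field; rewrite gt_eqF.
by rewrite mulrAC ler_pdivlMr // mulrC.
Qed.

(** The difference has derivative [y ^+ 3 / (1 + y)], of the sign of [y], so its minimum is at 0. *)
Lemma ln1D_le x : -1 < x -> ln (1 + x) <= x - x ^+ 2 / 2 + x ^+ 3 / 3.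
Proof.
move=> x1; rewrite -subr_ge0.
pose F (y : R) := y - y ^+ 2 / 2 + y ^+ 3 / 3 - ln (1 + y).
have F0 : F 0 = 0 by rewrite /F !expr0n /= addr0 ln1 !mul0r !subr0 addr0.
have Fd (y : R) : -1 < y -> is_derive y 1 F (y ^+ 3 / (1 + y)).
  move=> y1; have y0 : 0 < 1 + y by lra.
  apply: (is_derive_eq (derive_subE
    (derive_addE
      (derive_subE (derive_idE y) (derive_mulE (derive_expE 2 y) (derive_cstE 2^-1 y)))
      (derive_mulE (derive_expE 3 y) (derive_cstE 3^-1 y)))
    (derive_ln_comp (g := fun u => 1 + u) y0 (derive_addE (derive_cstE 1 y) (derive_idE y))))).
  by rewrite /=; field; rewrite gt_eqF.
rewrite -/(F x) -F0; have [x0|/ltW x0] := leP 0 x.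
  apply: (@derive_ge0_le F (fun y => y ^+ 3 / (1 + y)) 0 x x0) => y /andP[y0 yx].
    by apply: Fd; lra.
  by rewrite divr_ge0 ?exprn_ge0 //; lra.
rewrite -[F x]opprK -[F 0]opprK lerN2.
apply: (@derive_ge0_le (fun y => - F y) (fun y => - (y ^+ 3 / (1 + y))) x 0 x0) => y /andP[xy y0].
  by apply: (is_deriveN (f := F)); apply: Fd; lra.
rewrite -mulNr divr_ge0 //; last lra.
rewrite (_ : - y ^+ 3 = (- y) ^+ 3) ?exprn_ge0 ?oppr_ge0 ?ltW //; ring.
Qed.

(** The tangent of the concave function [ln] at [a]. *)
Lemma ln_sub_le a x : 0 < a -> 0 < x -> ln x <= ln a + (x - a) / a.
Proof.
move=> a0 x0; have -> : ln x = ln a + ln (x / a).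
  by rewrite -lnM ?posrE ?divr_gt0 // mulrC divfK // gt_eqF.
rewrite lerD2l; have -> : x / a = 1 + (x - a) / a by field; rewrite gt_eqF.
apply: le_ln1Dx; have xa0 : 0 < x / a by rewrite divr_gt0.
have -> : (x - a) / a = x / a - 1 by field; rewrite gt_eqF.
lra.
Qed.

Lemma ln_sigmoidE u : ln (2 * sigmoid (2 * u)) = u - lc u.
Proof.
rewrite /lc /sigmoid /ch.
have e0 : 0 < 1 + expR (- (2 * u)) by rewrite addr_gt0 ?expR_gt0.
have -> : (expR u + expR (- u)) / 2 = expR u * ((1 + expR (- (2 * u))) / 2).
  by rewrite mulrA mulrDr mulr1 -expRD; congr ((_ + expR _) / _); ring.
rewrite [in RHS]lnM ?posrE ?expR_gt0 ?divr_gt0 // expRK opprD addrA subrr add0r.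
rewrite -lnV ?posrE ?divr_gt0 //; congr ln.
by field; rewrite gt_eqF.
Qed.

Lemma ln_sigmoid_ge u :
  u - u ^+ 2 / 2 + (u ^+ 2 - ln (1 + u ^+ 2)) / 12 <= ln (2 * sigmoid (2 * u)).
Proof. by rewrite ln_sigmoidE; have := ln_cosh_le u; lra. Qed.

(* Gibbs' inequality for the weights [(1 + p) / 2] and [(1 - p) / 2]. *)
Lemma ln_sigmoid_le (p t : R) : `|p| < 1 ->
  ln (2 * sigmoid t) <= (1 - p) / 2 * t + p ^+ 2 / 2 + p ^+ 4 / 3.
Proof.
rewrite ltr_norml => /andP[p1 p2].
have c0 : 0 < (1 + expR (- t)) / 2 by rewrite divr_gt0 ?addr_gt0 ?expR_gt0.
set c := (1 + expR (- t)) / 2 in c0 *.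
have -> : 2 * sigmoid t = c^-1.
  by rewrite /sigmoid /c invfM invrK mulrC.
rewrite lnV //.
have H1 : ln ((1 + p) * c) >= ln c + ln (1 + p) by rewrite -lnM ?posrE // ?[c * _]mulrC //; lra.
have H2 := @ln1D_le p ltac:(lra).
have H3 := @ln1D_le (- p) ltac:(lra).
have w0 : 0 < 1 + p by lra.
have w1 : 0 < 1 - p by lra.
have G1 : - ln c - ln (1 + p) <= ((1 + p) * c)^-1 - 1.
  have := @ln_sub_le 1 ((1 + p) * c)^-1 ltr01.
  rewrite lnV ?posrE ?mulr_gt0 // lnM ?posrE // ln1 invr_gt0 mulr_gt0 // => /(_ isT); lra.
have G2 : - t - ln c - ln (1 - p) <= expR (- t) / ((1 - p) * c) - 1.
  have wc : 0 < (1 - p) * c by rewrite mulr_gt0.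
  have x0 : 0 < expR (- t) / ((1 - p) * c) by rewrite divr_gt0 ?expR_gt0.
  have := ln_sub_le ltr01 x0; rewrite ln1 add0r divr1.
  rewrite ln_div ?posrE ?expR_gt0 // expRK lnM ?posrE //.
  lra.
(* With the weights, the right sides of [G1] and [G2] add up to
   [sigmoid t + (1 - sigmoid t) - 1 = 0]. *)
have E : (1 + p) / 2 * (((1 + p) * c)^-1 - 1) + (1 - p) / 2 * (expR (- t) / ((1 - p) * c) - 1) = 0.
  have -> : (1 + p) / 2 * (((1 + p) * c)^-1 - 1) + (1 - p) / 2 * (expR (- t) / ((1 - p) * c) - 1) =
    ((1 + expR (- t)) / 2) / c - 1 by field; rewrite !gt_eqF.
  by rewrite -/c divff ?subrr // gt_eqF.
have := ler_wpM2l (ltW (divr_gt0 w0 (ltr0Sn _ 1))) G1.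
have := ler_wpM2l (ltW (divr_gt0 w1 (ltr0Sn _ 1))) G2.
have := ler_wpM2l (ltW (divr_gt0 w0 (ltr0Sn _ 1))) H2.
have := ler_wpM2l (ltW (divr_gt0 w1 (ltr0Sn _ 1))) H3.
move: (ln c) (ln (1 + p)) (ln (1 - p)) (((1 + p) * c)^-1) (expR (- t) / _) E => l1 l2 l3 l4 l5 E K1 K2 K3 K4.
(* The entropy of the weights, expanded to third order on each side: the odd terms combine into
   [p ^+ 2 / 2 + p ^+ 4 / 3]. *)
have -> : (1 - p) / 2 * t + p ^+ 2 / 2 + p ^+ 4 / 3 = (1 - p) / 2 * t +
   (1 + p) / 2 * (p - p ^+ 2 / 2 + p ^+ 3 / 3) + (1 - p) / 2 * (- p - (- p) ^+ 2 / 2 + (- p) ^+ 3 / 3).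
  by field.
nra.
Qed.

Lemma ln_sigmoid_le_ln2 (t : R) : ln (2 * sigmoid t) <= ln 2.
Proof.
rewrite ler_ln ?posrE //; last first.
  by rewrite mulr_gt0 // invr_gt0 addr_gt0 ?expR_gt0.
by rewrite ger_pMr // invf_le1 ?lerDl ?expR_ge0 // addr_gt0 ?expR_gt0.
Qed.

Lemma ln_sigmoid_lipschitz (s t : R) :
  ln (2 * sigmoid s) <= ln (2 * sigmoid t) + `|s - t|.
Proof.
have p0 x : 0 < 1 + expR (- x) by rewrite addr_gt0 ?expR_gt0.
have E x : ln (2 * sigmoid x) = ln 2 - ln (1 + expR (- x)).
  by rewrite lnM ?posrE ?invr_gt0 // lnV ?posrE.
rewrite !E; suff : ln (1 + expR (- t)) <= ln (1 + expR (- s)) + `|s - t| by lra.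
rewrite -[in leRHS](expRK `|s - t|) -lnM ?posrE ?expR_gt0 // ler_ln ?posrE ?mulr_gt0 ?expR_gt0 //.
rewrite mulrDl mul1r -expRD; apply: lerD.
  by rewrite -[leLHS]expR0 ler_expR.
by rewrite ler_expR; have := ler_norm (s - t); lra.
Qed.

End scalar.

(** * Bounds on the maximized log-likelihood *)

Section log_likelihood.
Variables (R : realType) (n d : nat).
Implicit Types (M : 'M[R]_(n, d)) (eta : 'I_d -> R).

Definition loglik M eta : R :=
  \sum_i ln (2 * sigmoid (\sum_j M i j * eta j)).

Definition max_loglik M : R := sup [set loglik M eta | eta in [set: 'I_d -> R]].

Lemma loglik_le_ln2 M eta : loglik M eta <= n%:R * ln 2.
Proof.
rewrite mulr_natl -[n in leRHS]card_ord -sumr_const.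
by apply: ler_sum => i _; exact: ln_sigmoid_le_ln2.
Qed.

Lemma has_sup_loglik M : has_sup [set loglik M eta | eta in [set: 'I_d -> R]].
Proof.
split; first by exists (loglik M (fun=> 0)), (fun=> 0).
by exists (n%:R * ln 2) => _ [eta _ <-]; exact: loglik_le_ln2.
Qed.

Lemma loglik_le_max M eta : loglik M eta <= max_loglik M.
Proof. by apply: (sup_upper_bound (has_sup_loglik M)); exists eta. Qed.

Lemma max_loglik_le M (b : R) :
  (forall eta, loglik M eta <= b) -> max_loglik M <= b.
Proof.
move=> H; apply: sup_le_ub; first by have [] := has_sup_loglik M.
by move=> _ [eta _ <-].
Qed.

Lemma max_loglik_leP M (b : R) :
  max_loglik M <= b <-> forall eta, loglik M eta <= b.
Proof.
split=> [H eta|]; last exact: max_loglik_le.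
exact: le_trans (loglik_le_max M eta) H.
Qed.

Lemma Lambda_max_loglik (x : 'I_n -> d.-tuple R) (y : 'I_n -> R) :
  Lambda x y = max_loglik (\matrix_(i, j) (y i * tnth (x i) j)).
Proof.
rewrite /Lambda /max_loglik; congr sup; apply/seteqP; split => _ [eta _ <-].
  exists (fun j => tnth eta j) => //; apply: eq_bigr => i _; congr (ln (_ * sigmoid _)).
  by rewrite /dotp mulr_sumr; apply: eq_bigr => j _; rewrite mxE mulrA.
exists (mktuple eta) => //; apply: eq_bigr => i _; congr (ln (_ * sigmoid _)).
by rewrite /dotp mulr_sumr; apply: eq_bigr => j _; rewrite mxE mulrA tnth_mktuple.
Qed.

(** The residual [1 - hat_fit M i] has squared norm [n - hotelling M]. *)
Lemma hotelling_le M : hotelling M <= n%:R.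
Proof.
have H : 0 <= \sum_i (1 - hat_fit M i) ^+ 2 by apply: sumr_ge0 => i _; exact: sqr_ge0.
have : \sum_i (1 - hat_fit M i) ^+ 2 = n%:R - hotelling M.
  transitivity (\sum_i (1 + hat_fit M i ^+ 2 - 2 * hat_fit M i)).
    by apply: eq_bigr => i _; ring.
  rewrite sumrB big_split /= hat_fit_sqr -mulr_sumr -/(hotelling M) sumr_const card_ord; ring.
lra.
Qed.

Lemma max_loglik_ge M : gram_det M != 0 -> (0 < n)%N ->
  hotelling M + hotelling M ^+ 2 / (36 * n%:R) <= 2 * max_loglik M.
Proof.
move=> M0 n0; have np : 0 < n%:R :> R by rewrite ltr0n.
pose T := hotelling M; have T0 : 0 <= T := hotelling_ge0 M.
have Tn : T <= n%:R := hotelling_le M.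
(* The mean of the [hat_fit M i ^+ 2], at which Jensen's inequality is applied in [lnsum], as a
   tangent bound for [ln]. *)
pose a := T / n%:R; have a0 : 0 <= a by rewrite divr_ge0 // ltW.
have a1 : a <= 1 by rewrite ler_pdivrMr // mul1r.
have aT : T = a * n%:R by rewrite /a divfK // gt_eqF.
have ap : 0 < 1 + a by lra.
have lnsum : \sum_i ln (1 + hat_fit M i ^+ 2) <= n%:R * ln (1 + a).
  have : \sum_i ln (1 + hat_fit M i ^+ 2) <=
      \sum_i (ln (1 + a) + (1 + hat_fit M i ^+ 2 - (1 + a)) / (1 + a)).
    apply: ler_sum => i _; apply: ln_sub_le => //.
    by rewrite ltr_pwDl // sqr_ge0.
  move=> /le_trans; apply; rewrite big_split /= -mulr_suml sumrB big_split /=.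
  rewrite hat_fit_sqr !sumr_const card_ord -/T aT.
  rewrite -[ln (1 + a) *+ n]mulr_natl -[(1 + a) *+ n]mulr_natl.
  by rewrite (_ : _ - _ = 0) ?mul0r ?addr0 //; ring.
have := loglik_le_max M (fun j => 2 * hat_coef M j 0).
have -> : loglik M (fun j => 2 * hat_coef M j 0) = \sum_i ln (2 * sigmoid (2 * hat_fit M i)).
  apply: eq_bigr => i _; congr (ln (_ * sigmoid _)).
  by rewrite hat_fitE mulr_sumr; apply: eq_bigr => j _; rewrite mulrCA.
have : \sum_i (hat_fit M i - hat_fit M i ^+ 2 / 2 +
    (hat_fit M i ^+ 2 - ln (1 + hat_fit M i ^+ 2)) / 12) <=
    \sum_i ln (2 * sigmoid (2 * hat_fit M i)).
  by apply: ler_sum => i _; exact: ln_sigmoid_ge.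
have -> : \sum_i (hat_fit M i - hat_fit M i ^+ 2 / 2 +
    (hat_fit M i ^+ 2 - ln (1 + hat_fit M i ^+ 2)) / 12) =
    T - T / 2 + (T - \sum_i ln (1 + hat_fit M i ^+ 2)) / 12.
  by rewrite big_split sumrB -!mulr_suml sumrB hat_fit_sqr.
have la := @ln1D_le R a ltac:(lra).
have : n%:R * ln (1 + a) <= n%:R * (a - a ^+ 2 / 2 + a ^+ 3 / 3) by rewrite ler_pM2l.
(* Since [a <= 1], a^2 / 2 - a^3 / 3 is at least a^2 / 6; times the 1/12 of [ln_cosh_le] and
   doubled, this is the 1/36. *)
have a3 : n%:R * a ^+ 3 <= n%:R * a ^+ 2.
  by rewrite ler_pM2l // exprS ler_piMl // sqr_ge0.
have -> : T ^+ 2 / (36 * n%:R) = n%:R * a ^+ 2 / 36 by rewrite aT; field; rewrite gt_eqF.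
have : n%:R * (a - a ^+ 2 / 2 + a ^+ 3 / 3) = T - n%:R * a ^+ 2 / 2 + n%:R * a ^+ 3 / 3.
  by rewrite aT; field.
rewrite -/T; lra.
Qed.

(** The residual [1 - hat_fit M i] is orthogonal to the columns of [M], so the terms linear in [eta]
    cancel and the bound is uniform in [eta]. *)
Lemma max_loglik_le_hotelling M : gram_det M != 0 ->
  (forall i, `|hat_fit M i| < 1) ->
  2 * max_loglik M <= hotelling M + 2 / 3 * \sum_i hat_fit M i ^+ 4.
Proof.
move=> M0 H; rewrite -ler_pdivlMl //; apply: max_loglik_le => eta.
have : loglik M eta <= \sum_i ((1 - hat_fit M i) / 2 * (\sum_j M i j * eta j) +
    hat_fit M i ^+ 2 / 2 + hat_fit M i ^+ 4 / 3).
  by apply: ler_sum => i _; exact: ln_sigmoid_le.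
move=> /le_trans; apply; rewrite !big_split /= -!mulr_suml hat_fit_sqr.
have -> : \sum_i (1 - hat_fit M i) / 2 * (\sum_j M i j * eta j) = 0.
  transitivity (\sum_j ((\sum_i M i j - \sum_i hat_fit M i * M i j) / 2 * eta j)).
    rewrite (eq_bigr (fun i => \sum_j (1 - hat_fit M i) / 2 * (M i j * eta j))); last first.
      by move=> i _; rewrite mulr_sumr.
    rewrite exchange_big /=; apply: eq_bigr => j _.
    rewrite -sumrB 2!mulr_suml; apply: eq_bigr => i _; ring.
  by rewrite big1 // => j _; rewrite hat_fit_mul // subrr !mul0r.
lra.
Qed.

End log_likelihood.

(** * Measurability *)

Section measurability.
Variables (R : realType) (disp : measure_display) (T : measurableType disp).
Notation mfun f := (measurable_fun [set: T] (f : T -> R)).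

Lemma measurable_invr (f : T -> R) : mfun f -> mfun (fun w => (f w)^-1).
Proof.
move=> mf; have -> : (fun w => (f w)^-1) = (fun w => f w * powR (f w ^+ 2) (-1)).
  apply/funext => w; rewrite powR_inv1 ?sqr_ge0 //.
  have [->|f0] := eqVneq (f w) 0; first by rewrite mul0r invr0.
  by rewrite expr2 invfM mulrA divff // mul1r.
apply: measurable_funM => //.
have H := measurable_funX 2 mf.
exact: (measurableT_comp (measurable_powR (-1)) H).
Qed.

Definition mx_measurable n d (A : T -> 'M[R]_(n, d)) :=
  forall i j, mfun (fun w => A w i j).

Lemma mx_measurable_mul n d m (A : T -> 'M[R]_(n, d)) (B : T -> 'M[R]_(d, m)) :
  mx_measurable A -> mx_measurable B -> mx_measurable (fun w => A w *m B w).
Proof.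
move=> mA mB i j; under eq_fun do rewrite mxE.
by apply: measurable_sum => k; exact: measurable_funM.
Qed.

Lemma mx_measurable_tr n d (A : T -> 'M[R]_(n, d)) :
  mx_measurable A -> mx_measurable (fun w => (A w)^T).
Proof. by move=> mA i j; under eq_fun do rewrite mxE; exact: mA. Qed.

Lemma measurable_det n (A : T -> 'M[R]_n) :
  mx_measurable A -> mfun (fun w => \det (A w)).
Proof.
move=> mA; apply: measurable_sum => s; apply: measurable_funM => //.
by apply: measurable_prod => i.
Qed.

Lemma mx_measurable_ginv n (A : T -> 'M[R]_n) :
  mx_measurable A -> mx_measurable (fun w => ginv (A w)).
Proof.
move=> mA i j; under eq_fun do rewrite mxE.
apply: measurable_funM; first by apply: measurable_invr; exact: measurable_det.
under eq_fun do rewrite mxE /cofactor.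
apply: measurable_funM => //; apply: measurable_det => k l.
by under eq_fun do rewrite !mxE; exact: mA.
Qed.

Lemma mx_measurable_hat n d (A : T -> 'M[R]_(n, d)) :
  mx_measurable A -> mx_measurable (fun w => hat (A w)).
Proof.
move=> mA; have mAT := mx_measurable_tr mA.
apply: mx_measurable_mul => //; apply: mx_measurable_mul => //.
by apply: mx_measurable_ginv; exact: mx_measurable_mul.
Qed.

Lemma measurable_hat_fit n d (A : T -> 'M[R]_(n, d)) i :
  mx_measurable A -> mfun (fun w => hat_fit (A w) i).
Proof. by move=> mA; apply: measurable_sum => j; exact: mx_measurable_hat. Qed.

Lemma measurable_hotelling n d (A : T -> 'M[R]_(n, d)) :
  mx_measurable A -> mfun (fun w => hotelling (A w)).
Proof. by move=> mA; apply: measurable_sum => j; exact: measurable_hat_fit. Qed.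

Lemma measurable_gram_det n d (A : T -> 'M[R]_(n, d)) :
  mx_measurable A -> mfun (fun w => gram_det (A w)).
Proof.
move=> mA; apply: measurable_det; apply: mx_measurable_mul => //.
exact: mx_measurable_tr.
Qed.

Lemma measurable_score n d (A : T -> 'M[R]_(n, d)) :
  mx_measurable A -> mfun (fun w => score (A w)).
Proof.
move=> mA; apply: measurable_funM => //; apply: measurable_sum => j.
by apply: measurable_funX; apply: measurable_sum.
Qed.

Lemma measurable_sum_sqr n d (A : T -> 'M[R]_(n, d)) :
  mx_measurable A -> mfun (fun w => sum_sqr (A w)).
Proof.
by move=> mA; apply: measurable_sum => i; apply: measurable_sum => j; apply: measurable_funX.
Qed.

Lemma measurable_gram_norm n d (A : T -> 'M[R]_(n, d)) :
  mx_measurable A -> mfun (fun w => gram_norm (A w)).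
Proof.
move=> mA; apply: measurable_sum => i; apply: measurable_sum => k.
by apply: measurable_funX; apply: measurable_sum => j; exact: measurable_funM.
Qed.

Lemma measurable_set_le (f : T -> R) (x : R) : mfun f -> measurable [set w | f w <= x].
Proof.
move=> mf; rewrite -[X in measurable X]setTI.
rewrite (_ : [set w | f w <= x] = f @^-1` `]-oo, x]%classic).
  exact: (mf measurableT `]-oo, x]%classic (measurable_itv _)).
by apply/seteqP; split => w /=; rewrite in_itv.
Qed.

End measurability.

(** * Expectations over normal matrices *)

Section real_integral.
Variables (R : realType) (disp : measure_display) (T : measurableType disp).
Variable P : probability T R.
Notation mfun f := (measurable_fun [set: T] (f : T -> R)).
Implicit Types f g : T -> R.

Lemma integral_addr f g : mfun f -> mfun g -> (forall w, 0 <= f w) -> (forall w, 0 <= g w) ->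
  (\int[P]_w (f w + g w)%:E = \int[P]_w (f w)%:E + \int[P]_w (g w)%:E)%E.
Proof.
move=> mf mg f0 g0; under eq_integral do rewrite EFinD.
apply: ge0_integralD => //; try (by move=> w _; rewrite lee_fin).
- exact/measurable_EFinP.
- exact/measurable_EFinP.
Qed.

Lemma integral_sumr I (s : seq I) (f : I -> T -> R) :
  (forall i, mfun (f i)) -> (forall i w, 0 <= f i w) ->
  (\int[P]_w (\sum_(i <- s) f i w)%:E = \sum_(i <- s) \int[P]_w (f i w)%:E)%E.
Proof.
move=> mf f0; under eq_integral do rewrite -sumEFin.
apply: (@ge0_integral_sum _ _ _ P setT measurableT _ (fun i w => (f i w)%:E)).
- by move=> i; exact/measurable_EFinP.
- by move=> i w _; rewrite lee_fin.
Qed.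

Lemma integral_mulr (k : R) f : 0 <= k -> mfun f -> (forall w, 0 <= f w) ->
  (\int[P]_w (k * f w)%:E = k%:E * \int[P]_w (f w)%:E)%E.
Proof.
move=> k0 mf f0; under eq_integral do rewrite EFinM.
apply: ge0_integralZl => //; first exact/measurable_EFinP.
by move=> w _; rewrite lee_fin.
Qed.

Lemma integral_cstr (k : R) : (\int[P]_w k%:E = k%:E)%E.
Proof. by rewrite integral_cst//=; rewrite [X in (_ * X)%E](probability_setT P) mule1. Qed.

Lemma le_integralr f g : mfun f -> mfun g -> (forall w, 0 <= f w) ->
  (forall w, f w <= g w) -> (\int[P]_w (f w)%:E <= \int[P]_w (g w)%:E)%E.
Proof.
move=> mf mg f0 fg; apply: ge0_le_integral => //.
- by move=> w _; rewrite lee_fin.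
- exact/measurable_EFinP.
- exact/measurable_EFinP.
- by move=> w _; rewrite lee_fin.
Qed.

Lemma markov_real f (a e : R) : mfun f -> (forall w, 0 <= f w) -> 0 < a ->
  (\int[P]_w (f w)%:E <= e%:E)%E -> (P [set w | (a <= f w)%R] <= (e / a)%:E)%E.
Proof.
move=> mf f0 a0 fe.
have mA : measurable [set w | a <= f w].
  rewrite (_ : [set w | _] = f @^-1` `[a, +oo[%classic).
    by rewrite -[X in measurable X]setTI; apply: mf => //; exact: measurable_itv.
  by apply/seteqP; split => w /=; rewrite in_itv /= andbT.
rewrite EFinM lee_pdivlMr //; apply: le_trans fe.
have -> : P [set w | a <= f w] = (\int[P]_w (\1_[set w | (a <= f w)%R] w)%:E)%E.
  by rewrite integral_indic // setIT.
rewrite muleC -integral_mulr ?(ltW a0) //.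
apply: le_integralr => // [|w|w].
- exact: measurable_funM.
- by rewrite mulr_ge0 // ltW.
- rewrite indicE; case: (boolP (w \in _)) => [|_]; last by rewrite mulr0.
  by rewrite inE mulr1.
Qed.

End real_integral.

Section moments.
Variables (R : realType) (n d : nat).
Variables (disp : measure_display) (T : measurableType disp) (P : probability T R).
Notation N01 := (normal_prob (0 : R) 1).
Variable Z : T -> 'M[R]_(n, d).
Hypothesis GZ : iid_normal P (Z : T -> mx_space R n d).

Lemma iid_mx_measurable : mx_measurable Z.
Proof. by move=> i j; exact: iid_normal_measurable GZ. Qed.

Lemma integral_entry i j (f : R -> R) : measurable_fun setT f ->
  (forall x, 0 <= f x) ->
  (\int[P]_w (f (Z w i j))%:E = \int[N01]_x (f x)%:E)%E.
Proof.
move=> mf f0.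
have mZ : measurable_fun setT (fun w => Z w i j : measurableTypeR R).
  exact: iid_normal_measurable GZ.
have H := @ge0_integral_pushforward _ _ _ _ R _ mZ P setT (fun x => (f x)%:E) measurableT.
rewrite preimage_setT /= in H; rewrite -H.
- apply: eq_measure_integral => A mA _; exact: (iid_normal_marginal i j GZ mA).
- exact/measurable_EFinP.
- by move=> y _; rewrite lee_fin.
Qed.

Lemma integral_entry_sqr i j : (\int[P]_w (Z w i j ^+ 2)%:E = 1)%E.
Proof.
rewrite (integral_entry i j (f := fun x => x ^+ 2)) ?integral_normal_sqr //.
by move=> x; exact: sqr_ge0.
Qed.

(** Resampling the entry [(k, l)] makes the integrand a product over the two coordinates, and Fubini
    gives 1 times 1. *)
Lemma integral_entry_mul i j k l : (i, j) != (k, l) ->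
  (\int[P]_w (Z w i j ^+ 2 * Z w k l ^+ 2)%:E = 1)%E.
Proof.
move=> ijkl; pose J i' j' := (i' == k) && (j' == l).
have Jij : J i j = false by apply/negbTE; move: ijkl; apply: contra => /andP[/eqP-> /eqP->].
have Jkl : J k l by rewrite /J !eqxx.
have GJ := iid_normal_resample J GZ GZ.
pose f (M : mx_space R n d) := (((M : 'M[R]_(n, d)) i j ^+ 2 * (M : 'M[R]_(n, d)) k l ^+ 2)%:E : \bar R).
have mf : measurable_fun setT f.
  apply/measurable_EFinP; apply: measurable_funM; apply: measurable_funX; exact: measurable_mx_entry.
have f0 M : (0 <= f M)%E by rewrite lee_fin mulr_ge0 // sqr_ge0.
have -> : (\int[P]_w (Z w i j ^+ 2 * Z w k l ^+ 2)%:E = \int[P]_w f (Z w))%E by [].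
rewrite (iid_normal_integral GZ GJ mf f0).
pose g (w : T * T) := ((Z w.1 i j ^+ 2 * Z w.2 k l ^+ 2)%:E : \bar R).
have -> : (\int[(P \x P)]_w f (\matrix_(i, j) (if J i j then Z w.2 i j else Z w.1 i j)) =
    \int[(P \x P)]_w g w)%E.
  by apply: eq_integral => w _; rewrite /f /g !mxE Jij Jkl.
have mg : measurable_fun setT g.
  apply/measurable_EFinP; apply: measurable_funM; apply: measurable_funX.
  - exact: (measurableT_comp (iid_mx_measurable i j) measurable_fst).
  - exact: (measurableT_comp (iid_mx_measurable k l) measurable_snd).
rewrite (@fubini_tonelli1 _ _ _ _ R P P g mg); last first.
  by move=> w; rewrite lee_fin mulr_ge0 // sqr_ge0.
rewrite -[RHS](integral_entry_sqr i j); apply: eq_integral => w _.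
rewrite /fubini_F /g /= integral_mulr ?sqr_ge0 ?integral_entry_sqr ?mule1 //.
- by apply: measurable_funX; exact: iid_mx_measurable.
- by move=> w'; exact: sqr_ge0.
Qed.

(** Each sign pattern preserves the law, so the integrand may be averaged over any finite family of
    patterns. *)
Lemma integral_average (K : finType) (s : K -> 'I_n -> 'I_d -> bool)
    (g : 'M[R]_(n, d) -> R) : (0 < #|K|)%N ->
  measurable_fun setT (g : mx_space R n d -> R) -> (forall M, 0 <= g M) ->
  (\int[P]_w (g (Z w))%:E = \int[P]_w ((\sum_k g (\matrix_(i, j) ((-1) ^+ s k i j * Z w i j))) / #|K|%:R)%:E)%E.
Proof.
move=> K0 mg g0; pose G k w := g (\matrix_(i, j) ((-1) ^+ s k i j * Z w i j)).
have mG k : measurable_fun setT (G k).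
  exact: (measurableT_comp mg (proj1 (iid_normal_flip (s k) GZ))).
have G0 k w : 0 <= G k w by exact: g0.
have EG k : (\int[P]_w (G k w)%:E = \int[P]_w (g (Z w))%:E)%E.
  apply: (iid_normal_integral (iid_normal_flip (s k) GZ) GZ (f := fun M => (g M)%:E)).
  - exact/measurable_EFinP.
  - by move=> M; rewrite lee_fin.
under [RHS]eq_integral do rewrite mulrC.
rewrite integral_mulr ?invr_ge0 //; last 2 first.
- exact: measurable_sum.
- by move=> w; apply: sumr_ge0 => k _.
rewrite (integral_sumr P (index_enum K) mG G0).
under eq_bigr do rewrite EG.
set x := (\int[P]_w (g (Z w))%:E)%E.
have -> : (\sum_(k in K) x = #|K|%:R%:E * x)%E.
  under eq_bigr do rewrite -[x]mul1e.
  by rewrite -ge0_sume_distrl // sumEFin sumr_const.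
by rewrite muleA -EFinM mulVf ?mul1e // pnatr_eq0 -lt0n.
Qed.

End moments.

Lemma iid_normal_pair_col (R : realType) :
  iid_normal (normal_prob (0 : R) 1 \x normal_prob (0 : R) 1)%E
    (fun p : measurableTypeR R * measurableTypeR R =>
       (\matrix_(i, j) if i == ord0 then p.1 else p.2) : mx_space R 2 1).
Proof.
split.
  by apply/measurable_mxP => i j; under eq_fun do rewrite mxE; case: (i == ord0); [exact: measurable_fst|exact: measurable_snd].
move=> A mA; rewrite big_ord_recl !big_ord1 /=.
rewrite (_ : [set w | _] = A ord0 ord0 `*` A (lift ord0 ord0) ord0); last first.
  apply/seteqP; split => -[x y] /=.
    by move=> H; split; [have := H ord0 ord0|have := H (lift ord0 ord0) ord0]; rewrite mxE.
  move=> [Ax Ay] i j; rewrite mxE ord1; case: (unliftP ord0 i) => [i' ->|->] //=.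
  by rewrite ord1.
exact: (product_measure1E (normal_prob 0 1) (normal_prob 0 1) (mA _ _) (mA _ _)).
Qed.

(** By rotation through 45 degrees, half of x^2 - y^2 is a product of two independent normal
    variables. Hence E (x^2 - y^2)^2 = 4, while expansion gives 2 m - 2 for the fourth moment m.
    [S0] states this without subtraction, as m might a priori be infinite. *)
Lemma integral_normal_4 (R : realType) : (\int[normal_prob (0 : R) 1]_x (x ^+ 4)%:E = 3%:E)%E.
Proof.
set N := normal_prob (0 : R) 1.
pose P2 : probability _ R := (N \x N)%E.
have G := iid_normal_pair_col R.
set Z := (X in iid_normal _ X) in G.
pose a : 'I_2 := ord0; pose b : 'I_2 := lift ord0 ord0; pose j : 'I_1 := ord0.
have ab : a != b by [].
have aj : (a, j) != (b, j) by [].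
pose c : R := Num.sqrt 2^-1.
have c0 : 0 < c by rewrite sqrtr_gt0 invr_gt0.
have c2 : c ^+ 2 = 2^-1 by rewrite sqr_sqrtr // invr_ge0.
have cc : c ^+ 2 + c ^+ 2 = 1 by rewrite c2; lra.
have G' := iid_normal_givens_entry j G ab c0 cc.
have mX k : measurable_fun setT (fun w => (Z w : 'M[R]_(2, 1)) k j).
  exact: (iid_normal_measurable k j G).
have H1 := integral_entry_mul G aj.
have H2 := integral_entry_mul G' aj.
have E4 k : (\int[(N \x N)]_w ((Z w : 'M[R]_(2, 1)) k j ^+ 4)%:E = \int[N]_x (x ^+ 4)%:E)%E.
  rewrite (integral_entry G k j (f := fun x => x ^+ 4)) //.
  by move=> x; rewrite (exprM _ 2 2) sqr_ge0.
pose f w : R := (Z w : 'M[R]_(2, 1)) a j; pose g w : R := (Z w : 'M[R]_(2, 1)) b j.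
have mf : measurable_fun setT f by exact: mX.
have mg : measurable_fun setT g by exact: mX.
have H2' : (\int[(N \x N)]_w ((f w ^+ 2 - g w ^+ 2) ^+ 2)%:E = 4%:E)%E.
  rewrite -[RHS]mule1 -[X in (_ * X)%E]H2 -integral_mulr //.
  - apply: eq_integral => w _; congr EFin; rewrite /f /g; move: (Z w) => M.
    rewrite !mxE !eqxx /=.
    transitivity (4 * (c ^+ 2) ^+ 2 * (M a j ^+ 2 - M b j ^+ 2) ^+ 2); last by ring.
    by rewrite c2; field.
  - by apply: measurable_funM; apply: measurable_funX; exact: (iid_normal_measurable _ _ G').
  - by move=> w; rewrite mulr_ge0 ?sqr_ge0.
have S0 : (\int[(N \x N)]_w ((f w ^+ 2 - g w ^+ 2) ^+ 2 + 2 * (f w ^+ 2 * g w ^+ 2))%:E =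
  \int[(N \x N)]_w (f w ^+ 4 + g w ^+ 4)%:E)%E.
  by apply: eq_integral => w _; congr EFin; ring.
rewrite integral_addr in S0; last 4 first.
- by apply: measurable_funX; apply: measurable_funB; apply: measurable_funX.
- by apply: measurable_funM => //; apply: measurable_funM; apply: measurable_funX.
- by move=> w; exact: sqr_ge0.
- by move=> w; apply: mulr_ge0 => //; rewrite mulr_ge0 ?sqr_ge0.
rewrite H2' integral_mulr // in S0; last 2 first.
- by apply: measurable_funM; apply: measurable_funX.
- by move=> w; rewrite mulr_ge0 ?sqr_ge0.
rewrite H1 mule1 -EFinD integral_addr in S0; last 4 first.
- by apply: measurable_funX.
- by apply: measurable_funX.
- by move=> w; rewrite (exprM _ 2 2) sqr_ge0.
- by move=> w; rewrite (exprM _ 2 2) sqr_ge0.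
rewrite !E4 in S0.
set m := (\int[N]_x _)%E in S0 *.
have m0 : (0 <= m)%E by apply: integral_ge0 => x _; rewrite lee_fin (exprM _ 2 2) sqr_ge0.
move: m m0 S0 => [r| |] //= r0 [E]; congr EFin; lra.
Qed.

Lemma gram_normE (R : realType) n d (M : 'M[R]_(n, d)) :
  gram_norm M = \sum_j \sum_l (\sum_i M i j * M i l) ^+ 2.
Proof.
transitivity (\sum_i \sum_k \sum_j \sum_l (M i j * M k j) * (M i l * M k l)).
  apply: eq_bigr => i _; apply: eq_bigr => k _; rewrite expr2 mulr_suml.
  by apply: eq_bigr => j _; rewrite mulr_sumr.
transitivity (\sum_j \sum_l \sum_i \sum_k (M i j * M i l) * (M k j * M k l)).
  under eq_bigr do rewrite exchange_big /=.
  rewrite exchange_big /=; apply: eq_bigr => j _.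
  under eq_bigr do rewrite exchange_big /=.
  rewrite exchange_big /=; apply: eq_bigr => l _.
  by apply: eq_bigr => i _; apply: eq_bigr => k _; rewrite mulrACA.
apply: eq_bigr => j _; apply: eq_bigr => l _; rewrite expr2 mulr_suml.
by apply: eq_bigr => i _; rewrite mulr_sumr.
Qed.

(** Nonnegativity of the squared Frobenius norm of the identity minus [t] times [M^T *m M]. *)
Lemma sum_sqr_le_gram_norm (R : realType) n d (M : 'M[R]_(n, d)) (t : R) :
  2 * t * sum_sqr M <= d%:R + t ^+ 2 * gram_norm M.
Proof.
have -> : sum_sqr M = \sum_j \sum_i M i j * M i j.
  by rewrite /sum_sqr exchange_big.
have -> : d%:R = \sum_(j < d) 1 :> R by rewrite sumr_const card_ord.
rewrite gram_normE !mulr_sumr -big_split /=.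
apply: ler_sum => j _; set g := \sum_i _.
apply: (@le_trans _ _ (1 + t ^+ 2 * g ^+ 2)).
  by rewrite -subr_ge0 (_ : _ - _ = (1 - t * g) ^+ 2) ?sqr_ge0 //; ring.
rewrite lerD2l ler_wpM2l ?sqr_ge0 // (bigD1 j) //= lerDl sumr_ge0 // => l _.
exact: sqr_ge0.
Qed.

Lemma measurable_mx_id (R : realType) n d :
  mx_measurable (fun M : mx_space R n d => (M : 'M[R]_(n, d))).
Proof. by move=> i j; exact: measurable_mx_entry. Qed.

Section expectations.
Variables (R : realType) (n d : nat).
Variables (disp : measure_display) (T : measurableType disp) (P : probability T R).
Variable Z : T -> 'M[R]_(n, d).
Hypothesis GZ : iid_normal P (Z : T -> mx_space R n d).
Notation "''E' f" := (\int[P]_w (f (Z w))%:E)%E (at level 10, f at level 9).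

Let mZ := iid_mx_measurable GZ.

Lemma integral_sqr_mul i j k l :
  (\int[P]_w (Z w i j ^+ 2 * Z w k l ^+ 2)%:E = (if (i, j) == (k, l) then 3 else 1)%:E)%E.
Proof.
have [[<- <-]|ijkl] := eqVneq (i, j) (k, l); last exact: integral_entry_mul.
rewrite -(@integral_normal_4 R) -(integral_entry GZ i j (f := fun x => x ^+ 4)) //.
- by apply: eq_integral => w _; rewrite -exprD.
- by move=> x; rewrite (exprM _ 2 2) sqr_ge0.
Qed.

Lemma integral_sum_sqr : ('E (@sum_sqr R n d) = (n * d)%:R%:E)%E.
Proof.
rewrite integral_sumr; last 2 first.
- by move=> i; apply: measurable_sum => j; apply: measurable_funX.
- by move=> i w; apply: sumr_ge0 => j _; exact: sqr_ge0.
transitivity (\sum_(i < n) \sum_(j < d) (1%:E : \bar R))%E.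
  apply: eq_bigr => i _; rewrite integral_sumr; last 2 first.
  - by move=> j; apply: measurable_funX.
  - by move=> j w; exact: sqr_ge0.
  by apply: eq_bigr => j _; rewrite integral_entry_sqr.
under eq_bigr do rewrite sumEFin.
rewrite sumEFin; congr EFin.
by rewrite !sumr_const !card_ord -mulrnA mulnC.
Qed.

Lemma integral_sum_sqr_sqr :
  (\int[P]_w (sum_sqr (Z w) ^+ 2)%:E = ((n * d)%:R * ((n * d)%:R + 2))%:E)%E.
Proof.
have E w : sum_sqr (Z w) ^+ 2 =
   \sum_(p : 'I_n * 'I_d) \sum_(q : 'I_n * 'I_d) Z w p.1 p.2 ^+ 2 * Z w q.1 q.2 ^+ 2.
  rewrite /sum_sqr pair_big /= expr2 mulr_suml; apply: eq_bigr => p _.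
  by rewrite mulr_sumr.
under eq_integral do rewrite E.
rewrite integral_sumr; last 2 first.
- move=> p; apply: measurable_sum => q.
  by apply: measurable_funM; apply: measurable_funX.
- by move=> p w; apply: sumr_ge0 => q _; rewrite mulr_ge0 ?sqr_ge0.
transitivity (\sum_(p : 'I_n * 'I_d) (((n * d)%:R + 2 : R)%:E)).
  apply: eq_bigr => p _; rewrite integral_sumr; last 2 first.
  - by move=> q; apply: measurable_funM; apply: measurable_funX.
  - by move=> q w; rewrite mulr_ge0 ?sqr_ge0.
  transitivity (\sum_(q : 'I_n * 'I_d) ((1 + (if p == q then 2 else 0))%:E : \bar R)).
    apply: eq_bigr => q _; rewrite integral_sqr_mul; case: p q => [i j] [k l] /=.
    by case: eqP => _; congr EFin; lra.
  rewrite sumEFin big_split /= sumr_const card_prod !card_ord; congr (_ + _)%:E.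
  by rewrite (bigD1 p) //= eqxx big1 ?addr0 // => q /negbTE; rewrite eq_sym => ->.
by rewrite sumEFin sumr_const card_prod !card_ord -[_ *+ (n * d)]mulr_natl.
Qed.

Lemma integral_inner_sqr i k : (\int[P]_w ((\sum_j Z w i j * Z w k j) ^+ 2)%:E =
  (if i == k then d%:R * (d%:R + 2) else d%:R)%:E)%E.
Proof.
have [<-|ik] := eqVneq i k.
  have E w : (\sum_j Z w i j * Z w i j) ^+ 2 = \sum_j \sum_l Z w i j ^+ 2 * Z w i l ^+ 2.
    rewrite expr2 mulr_suml; apply: eq_bigr => j _; rewrite mulr_sumr.
    by apply: eq_bigr => l _; rewrite -!expr2.
  under eq_integral do rewrite E.
  rewrite integral_sumr; last 2 first.
  - move=> j; apply: measurable_sum => l.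
    by apply: measurable_funM; apply: measurable_funX.
  - by move=> j w; apply: sumr_ge0 => l _; rewrite mulr_ge0 ?sqr_ge0.
  transitivity (\sum_(j < d) ((d%:R + 2 : R)%:E)).
    apply: eq_bigr => j _; rewrite integral_sumr; last 2 first.
    - by move=> l; apply: measurable_funM; apply: measurable_funX.
    - by move=> l w; rewrite mulr_ge0 ?sqr_ge0.
    transitivity (\sum_(l < d) ((1 + (if j == l then 2 else 0))%:E : \bar R)).
      apply: eq_bigr => l _; rewrite integral_sqr_mul xpair_eqE eqxx /=.
      by case: eqP => _; congr EFin; lra.
    rewrite sumEFin big_split /= sumr_const card_ord; congr (_ + _)%:E.
    by rewrite (bigD1 j) //= eqxx big1 ?addr0 // => l /negbTE; rewrite eq_sym => ->.
  by rewrite sumEFin sumr_const card_ord -[_ *+ d]mulr_natl.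
(* Only row [i] is flipped: the scalar product becomes a linear form in the signs, and the average
   of its square has no cross terms. *)
pose s (e : {ffun 'I_d -> bool}) (i' : 'I_n) (j : 'I_d) := (i' == i) && e j.
pose g (M : 'M[R]_(n, d)) := (\sum_j M i j * M k j) ^+ 2.
have mg : measurable_fun setT (g : mx_space R n d -> R).
  apply: measurable_funX; apply: measurable_sum => j.
  by apply: measurable_funM; exact: measurable_mx_entry.
have K0 : (0 < #|{: {ffun 'I_d -> bool}}|)%N by rewrite card_ffun card_bool expn_gt0.
rewrite (integral_average GZ s K0 mg); last by move=> M; exact: sqr_ge0.
transitivity (\int[P]_w (\sum_j Z w i j ^+ 2 * Z w k j ^+ 2)%:E)%E.
  apply: eq_integral => w _; congr EFin.
  have -> : \sum_j Z w i j ^+ 2 * Z w k j ^+ 2 =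
     \sum_(j <- index_enum 'I_d) (Z w i j * Z w k j) ^+ 2.
    by apply: eq_bigr => j _; rewrite exprMn.
  set S := \sum_(j <- _) _.
  apply: (canLR (mulfK _)); first by rewrite pnatr_eq0 -lt0n.
  rewrite mulrC /S.  rewrite -(sum_lsum_sqr _ (index_enum_uniq _)); apply: eq_bigr => e _.
  rewrite /g /lsum; congr (_ ^+ 2); apply: eq_bigr => j _.
  rewrite !mxE /s eqxx eq_sym (negbTE ik) /= expr0 mul1r /sgn; ring.
rewrite integral_sumr; last 2 first.
- by move=> j; apply: measurable_funM; apply: measurable_funX.
- by move=> j w; rewrite mulr_ge0 ?sqr_ge0.
transitivity (\sum_(j < d) (1%:E : \bar R)).
  by apply: eq_bigr => j _; rewrite integral_sqr_mul xpair_eqE (negbTE ik).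
by rewrite sumEFin sumr_const card_ord.
Qed.

Lemma integral_gram_norm :
  ('E (@gram_norm R n d) = (n%:R * d%:R * (n%:R + d%:R + 1))%:E)%E.
Proof.
rewrite integral_sumr; last 2 first.
- move=> i; apply: measurable_sum => k; apply: measurable_funX.
  by apply: measurable_sum => j; apply: measurable_funM.
- by move=> i w; apply: sumr_ge0 => k _; exact: sqr_ge0.
transitivity (\sum_(i < n) ((d%:R * (n%:R + d%:R + 1) : R)%:E)).
  apply: eq_bigr => i _; rewrite integral_sumr; last 2 first.
  - by move=> k; apply: measurable_funX; apply: measurable_sum => j; apply: measurable_funM.
  - by move=> k w; exact: sqr_ge0.
  transitivity (\sum_(k < n) ((d%:R + (if i == k then d%:R * (d%:R + 1) else 0))%:E : \bar R)).
    apply: eq_bigr => k _; rewrite integral_inner_sqr.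
    by case: eqP => _; congr EFin; ring.
  rewrite sumEFin big_split /= sumr_const card_ord; congr EFin.
  rewrite (bigD1 i) //= eqxx big1 ?addr0; last by move=> k /negbTE; rewrite eq_sym => ->.
  by rewrite -mulr_natl; ring.
by rewrite sumEFin sumr_const card_ord -[_ *+ n]mulr_natl mulrA.
Qed.

End expectations.

(** * Rotating the vector 1 to a coordinate axis *)

Section hat_rotation.
Variables (R : realType) (n d : nat) (i0 : 'I_n) (O : 'M[R]_n).
Hypotheses (OO : O *m O^T = 1%:M) (Oi : forall j, O i0 j = (Num.sqrt n%:R)^-1).
Implicit Types M : 'M[R]_(n, d).

Let sqn : (Num.sqrt n%:R)^-1 ^+ 2 = n%:R^-1 :> R.
Proof. by rewrite exprVn sqr_sqrtr ?ler0n. Qed.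

Lemma hat_rotate_diag M : hat (O *m M) i0 i0 = hotelling M / n%:R.
Proof.
rewrite hat_orthogonal // mxE /hotelling mulr_suml.
transitivity (\sum_j \sum_i (hat M i j) / n%:R).
  apply: eq_bigr => j _; rewrite [(O *m _) _ _]mxE mulr_suml; apply: eq_bigr => i _.
  rewrite [_^T _ _]mxE !Oi -sqn; ring.
rewrite exchange_big /=; apply: eq_bigr => i _.
by rewrite /hat_fit mulr_suml.
Qed.

Lemma score_rotate M : score M = \sum_j (O *m M) i0 j ^+ 2.
Proof.
rewrite /score mulr_suml; apply: eq_bigr => j _.
have -> : (O *m M) i0 j = (Num.sqrt n%:R)^-1 * \sum_i M i j.
  by rewrite mxE mulr_sumr; apply: eq_bigr => i _; rewrite Oi.
by rewrite exprMn sqn mulrC.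
Qed.

End hat_rotation.

Lemma exists_mean_rotation (R : realType) n (i0 : 'I_n) :
  exists O : 'M[R]_n, [/\ O *m O^T = 1%:M,
    (forall j, O i0 j = (Num.sqrt n%:R)^-1) &
    forall d disp (T : measurableType disp) (P : probability T R)
      (Z : T -> 'M[R]_(n, d)), iid_normal P (Z : T -> mx_space R n d) ->
      iid_normal P (fun w => O *m Z w : mx_space R n d)].
Proof.
have [ O [OO Oi OZ]] := @exists_iid_normal_orthogonal R n (fun=> 1) i0 ltr01.
exists O; split => // j; rewrite Oi mul1r; congr (Num.sqrt _)^-1.
by under eq_bigr do rewrite expr1n; rewrite sumr_const card_ord.
Qed.

Section hat_expectations.
Variables (R : realType) (n d : nat).
Variables (disp : measure_display) (T : measurableType disp) (P : probability T R).
Variable Z : T -> 'M[R]_(n, d).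
Hypothesis GZ : iid_normal P (Z : T -> mx_space R n d).
Notation "''E' f" := (\int[P]_w (f (Z w))%:E)%E (at level 10, f at level 9).

Let mZ := iid_mx_measurable GZ.
Let mI := @measurable_mx_id R n d.

(* Flipping the signs of the rows of [Z] does not change its law. *)
Lemma integral_flip_rows_le (g h : 'M[R]_(n, d) -> R) :
  measurable_fun setT (g : mx_space R n d -> R) ->
  measurable_fun setT (h : mx_space R n d -> R) -> (forall M, 0 <= g M) ->
  (forall M, \sum_e g (flip_rows e M) <= #|{: {ffun 'I_n -> bool}}|%:R * h M) ->
  ('E g <= 'E h)%E.
Proof.
move=> mg mh g0 gh; pose s (e : {ffun 'I_n -> bool}) (i : 'I_n) (j : 'I_d) := e i.
have K0 : (0 < #|{: {ffun 'I_n -> bool}}|)%N by rewrite card_ffun card_bool expn_gt0.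
rewrite (integral_average GZ s K0 mg g0).
have mF e : measurable_fun setT (fun w => g (flip_rows e (Z w))).
  exact: (measurableT_comp mg (proj1 (iid_normal_flip (s e) GZ))).
apply: le_integralr.
- by apply: measurable_funM => //; apply: measurable_sum => e; exact: mF.
- exact: (measurableT_comp mh (proj1 GZ)).
- by move=> w; rewrite mulr_ge0 ?invr_ge0 // sumr_ge0.
- move=> w; rewrite ler_pdivrMr ?ltr0n // mulrC; exact: gh.
Qed.

Lemma integral_hotelling_sqr :
  (\int[P]_w (hotelling (Z w) ^+ 2)%:E <= (d%:R ^+ 2 + 2 * d%:R)%:E)%E.
Proof.
rewrite -(integral_cstr P (d%:R ^+ 2 + 2 * d%:R)).
apply: (@integral_flip_rows_le (fun M => hotelling M ^+ 2) (fun=> d%:R ^+ 2 + 2 * d%:R)) => //.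
- by apply: measurable_funX; exact: measurable_hotelling.
- by move=> M; exact: sqr_ge0.
- move=> M; under eq_bigr do rewrite -[hotelling _]subr0.
  apply: le_trans (sum_hotelling_sub _ _) _; rewrite subr0 ler_wpM2l ?ler0n //.
  have /andP[t0 td] := hat_tr_le M; rewrite lerD ?ler_pM2l //.
  by rewrite ler_pXn2r ?nnegrE.
Qed.

Lemma integral_hotelling_cube :
  (\int[P]_w (hotelling (Z w) ^+ 3)%:E <= (15 * d%:R ^+ 3)%:E)%E.
Proof.
rewrite -(integral_cstr P (15 * d%:R ^+ 3)).
apply: (@integral_flip_rows_le (fun M => hotelling M ^+ 3) (fun=> 15 * d%:R ^+ 3)) => //.
- by apply: measurable_funX; exact: measurable_hotelling.
- by move=> M; rewrite exprn_ge0 // hotelling_ge0.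
- move=> M; have [M0|M0] := eqVneq (gram_det M) 0; last exact: sum_hotelling_cube.
  rewrite big1 => [|e _]; first by rewrite mulr_ge0 // mulr_ge0 // exprn_ge0.
  rewrite (_ : hotelling _ = 0) ?expr0n //.
  by rewrite /hotelling big1 // => i _; rewrite /hat_fit hat_eq0 ?gram_det_flip_rows // big1 // => j _; rewrite mxE.
Qed.

(** The indicator of full rank, as a quotient so that it is measurable along with [gram_det]. It
    discards singular matrices, for which [hat] is 0, at a stage where [d <= n] is not yet
    assumed. *)
Definition full_rank (M : 'M[R]_(n, d)) : R := gram_det M / gram_det M.

Lemma full_rankE M : full_rank M = (gram_det M != 0)%:R.
Proof. by rewrite /full_rank; have [->|M0] := eqVneq; rewrite ?mul0r // divff. Qed.

Let mfr : measurable_fun setT (full_rank : mx_space R n d -> R).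
Proof.
apply: measurable_funM; first exact: measurable_gram_det.
by apply: measurable_invr; exact: measurable_gram_det.
Qed.

Lemma integral_hotelling_variance :
  (\int[P]_w (full_rank (Z w) * (hotelling (Z w) - d%:R) ^+ 2)%:E <= (2 * d%:R)%:E)%E.
Proof.
rewrite -(integral_cstr P (2 * d%:R)).
apply: (@integral_flip_rows_le (fun M => full_rank M * (hotelling M - d%:R) ^+ 2) (fun=> 2 * d%:R)) => //.
- apply: measurable_funM => //; apply: measurable_funX.
  by apply: measurable_funB => //; exact: measurable_hotelling.
- by move=> M; rewrite full_rankE mulr_ge0 ?sqr_ge0.
- move=> M; under eq_bigr do rewrite full_rankE gram_det_flip_rows.
  have [M0|M0] := eqVneq (gram_det M) 0.
    by rewrite big1 => [|e _]; rewrite ?mul0r // !mulr_ge0.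
  under eq_bigr do rewrite mul1r.
  apply: le_trans (sum_hotelling_sub _ _) _.
  by rewrite hat_tr // subrr expr0n add0r.
Qed.

Lemma integral_hotelling_sub_score : (0 < n)%N ->
  (\int[P]_w (full_rank (Z w) * (hotelling (Z w) - score (Z w)) ^+ 2)%:E <=
   (2 * d%:R * (d%:R + 2) / n%:R)%:E)%E.
Proof.
move=> n0; have np : 0 < n%:R :> R by rewrite ltr0n.
pose g (M : 'M[R]_(n, d)) := full_rank M * (hotelling M - score M) ^+ 2.
(* Minus [k] is the coefficient of [sum_sqr] in the bound of [sum_hotelling_sub_score];
   [k * sum_sqr] is added to both sides so that only nonnegative functions are integrated. *)
pose k : R := (2 * d%:R + 4) / n%:R.
pose h (M : 'M[R]_(n, d)) := d%:R ^+ 2 + 2 * d%:R + n%:R ^- 2 * sum_sqr M ^+ 2 + 2 * n%:R ^- 2 * gram_norm M.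
have k0 : 0 <= k by rewrite divr_ge0 // addr_ge0 // mulr_ge0.
have s0 (M : 'M[R]_(n, d)) : 0 <= sum_sqr M by apply: sumr_ge0 => i _; apply: sumr_ge0 => j _; exact: sqr_ge0.
have q0 (M : 'M[R]_(n, d)) : 0 <= gram_norm M by apply: sumr_ge0 => i _; apply: sumr_ge0 => j _; exact: sqr_ge0.
have g0 M : 0 <= g M by rewrite /g full_rankE mulr_ge0 ?sqr_ge0.
have mg : measurable_fun setT (g : mx_space R n d -> R).
  apply: measurable_funM => //; apply: measurable_funX; apply: measurable_funB.
    exact: measurable_hotelling.
  exact: measurable_score.
have ms : measurable_fun setT (@sum_sqr R n d : mx_space R n d -> R) by exact: measurable_sum_sqr.
have mq : measurable_fun setT (@gram_norm R n d : mx_space R n d -> R) by exact: measurable_gram_norm.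
have H : (\int[P]_w (g (Z w) + k * sum_sqr (Z w))%:E <= \int[P]_w (h (Z w))%:E)%E.
  apply: (@integral_flip_rows_le (fun M => g M + k * sum_sqr M) h).
  - by apply: measurable_funD => //; apply: measurable_funM.
  - apply: measurable_funD; last exact: measurable_funM.
    by apply: measurable_funD => //; apply: measurable_funM => //; exact: measurable_funX.
  - by move=> M; rewrite addr_ge0 // mulr_ge0.
  - move=> M.
    have sf e : sum_sqr (flip_rows e M) = sum_sqr M.
      by apply: eq_bigr => i _; apply: eq_bigr => j _; rewrite mxE exprMn (sqrr_sign R (e i)) mul1r.
    under eq_bigr do rewrite sf.
    rewrite big_split /= sumr_const -[_ *+ _]mulr_natl.
    suff : \sum_e g (flip_rows e M) <= #|{: {ffun 'I_n -> bool}}|%:R * (h M - k * sum_sqr M).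
      by rewrite mulrBr -lerBrDr.
    (* For a singular Gram matrix the left side is 0, and [q1] is what makes the right side
       nonnegative. *)
    have q1 := sum_sqr_le_gram_norm M n%:R^-1.
    have hE : h M - k * sum_sqr M = (d%:R - sum_sqr M / n%:R) ^+ 2 +
       2 * (d%:R - 2 * (sum_sqr M / n%:R) + gram_norm M / n%:R ^+ 2).
      by rewrite /h /k; field; rewrite gt_eqF.
    have [M0|M0] := eqVneq (gram_det M) 0.
      rewrite big1 => [|e _]; last by rewrite /g full_rankE gram_det_flip_rows M0 eqxx mul0r.
      rewrite hE mulr_ge0 // addr_ge0 ?sqr_ge0 // mulr_ge0 //.
      move: q1; rewrite exprVn; lra.
    rewrite hE; apply: le_trans (sum_hotelling_sub_score M0).
    by apply: ler_sum => e _; rewrite /g full_rankE gram_det_flip_rows M0 mul1r.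
rewrite -/(g _).
have mgZ : measurable_fun setT (fun w => g (Z w)) := measurableT_comp mg (proj1 GZ).
have msZ : measurable_fun setT (fun w => sum_sqr (Z w)) := measurableT_comp ms (proj1 GZ).
have mqZ : measurable_fun setT (fun w => gram_norm (Z w)) := measurableT_comp mq (proj1 GZ).
have EL : (\int[P]_w (g (Z w) + k * sum_sqr (Z w))%:E =
    \int[P]_w (g (Z w))%:E + (k * (n * d)%:R)%:E)%E.
  have mk : measurable_fun setT (fun w => k * sum_sqr (Z w)) by exact: measurable_funM.
  rewrite (integral_addr P mgZ mk) //; last by move=> w; rewrite mulr_ge0.
  by rewrite (integral_mulr P k0 msZ) // integral_sum_sqr // -EFinM.
have EH : (\int[P]_w (h (Z w))%:E = (d%:R ^+ 2 + 2 * d%:R +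
    n%:R ^- 2 * ((n * d)%:R * ((n * d)%:R + 2)) + 2 * n%:R ^- 2 * (n%:R * d%:R * (n%:R + d%:R + 1)))%:E)%E.
  have n2 : 0 <= n%:R ^- 2 :> R by rewrite invr_ge0 sqr_ge0.
  have n22 : 0 <= 2 * n%:R ^- 2 :> R by rewrite mulr_ge0.
  have ms2 : measurable_fun setT (fun w => sum_sqr (Z w) ^+ 2) by exact: measurable_funX.
  have m1 : measurable_fun setT (fun w => n%:R ^- 2 * sum_sqr (Z w) ^+ 2) by exact: measurable_funM.
  have m2 : measurable_fun setT (fun w => d%:R ^+ 2 + 2 * d%:R + n%:R ^- 2 * sum_sqr (Z w) ^+ 2).
    exact: measurable_funD.
  have m3 : measurable_fun setT (fun w => 2 * n%:R ^- 2 * gram_norm (Z w)) by exact: measurable_funM.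
  have p1 w : 0 <= n%:R ^- 2 * sum_sqr (Z w) ^+ 2 by rewrite mulr_ge0 ?sqr_ge0.
  have p2 w : 0 <= d%:R ^+ 2 + 2 * d%:R + n%:R ^- 2 * sum_sqr (Z w) ^+ 2.
    by rewrite !addr_ge0 ?sqr_ge0 ?mulr_ge0.
  have p3 w : 0 <= 2 * n%:R ^- 2 * gram_norm (Z w) by rewrite mulr_ge0.
  rewrite (integral_addr P m2 m3 p2 p3) (integral_addr P (measurable_cst _) m1 _ p1); last first.
    by move=> w; rewrite addr_ge0 ?sqr_ge0 ?mulr_ge0.
  rewrite integral_cstr (integral_mulr P n2 ms2); last by move=> w; exact: sqr_ge0.
  rewrite integral_sum_sqr_sqr // (integral_mulr P n22 mqZ) // integral_gram_norm //.
move: H; rewrite EL EH.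
have : (0 <= \int[P]_w (g (Z w))%:E)%E by apply: integral_ge0 => w _; rewrite lee_fin.
move: (\int[P]_w (g (Z w))%:E)%E => [r| |] //=.
rewrite -EFinD !lee_fin => r0 H.
suff -> : 2 * d%:R * (d%:R + 2) / n%:R = (d%:R ^+ 2 + 2 * d%:R +
    n%:R ^- 2 * ((n * d)%:R * ((n * d)%:R + 2)) + 2 * n%:R ^- 2 * (n%:R * d%:R * (n%:R + d%:R + 1))) -
   k * (n * d)%:R :> R by lra.
by rewrite /k natrM; field; rewrite gt_eqF.
Qed.

(** The rotation makes a given leverage equal to [hotelling / n] of the unrotated matrix; the
    moments of [hotelling] thus become moments of leverages. *)
Lemma integral_hat_diag (f : R -> R) i : measurable_fun setT f -> (forall x, 0 <= f x) ->
  (\int[P]_w (f (hat (Z w) i i))%:E = \int[P]_w (f (hotelling (Z w) / n%:R))%:E)%E.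
Proof.
move=> mf f0; have [ O [OO Oi OZ]] := @exists_mean_rotation R n i.
have mh : measurable_fun setT (fun M : mx_space R n d => (f (hat (M : 'M[R]_(n, d)) i i))%:E).
  apply/measurable_EFinP; apply: (measurableT_comp mf).
  exact: mx_measurable_hat.
rewrite (iid_normal_integral GZ (OZ _ _ _ _ _ GZ) mh); last by move=> M; rewrite lee_fin.
by apply: eq_integral => w _; rewrite hat_rotate_diag.
Qed.

Lemma integral_hat_fit_4 : (0 < n)%N ->
  (\int[P]_w (\sum_i hat_fit (Z w) i ^+ 4)%:E <= (3 * (d%:R ^+ 2 + 2 * d%:R) / n%:R)%:E)%E.
Proof.
move=> n0; have np : 0 < n%:R :> R by rewrite ltr0n.
have p0 (M : 'M[R]_(n, d)) i : 0 <= hat_fit M i ^+ 4 by rewrite (exprM _ 2 2) sqr_ge0.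
rewrite integral_sumr //; last by move=> i; apply: measurable_funX; exact: measurable_hat_fit.
have H i : (\int[P]_w (hat_fit (Z w) i ^+ 4)%:E <= (3 * (d%:R ^+ 2 + 2 * d%:R) / n%:R ^+ 2)%:E)%E.
  apply: (@le_trans _ _ (\int[P]_w (3 * hat (Z w) i i ^+ 2)%:E)%E).
    apply: (@integral_flip_rows_le (fun M => hat_fit M i ^+ 4) (fun M => 3 * hat M i i ^+ 2)) => //.
    - by apply: measurable_funX; exact: measurable_hat_fit.
    - by apply: measurable_funM => //; apply: measurable_funX; exact: mx_measurable_hat.
    - by move=> M; exact: sum_hat_fit_4.
  rewrite integral_mulr //; last 2 first.
  - by apply: measurable_funX; exact: mx_measurable_hat.
  - by move=> w; exact: sqr_ge0.
  rewrite (integral_hat_diag i (f := fun x => x ^+ 2)) //; last by move=> x; exact: sqr_ge0.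
  have -> : (\int[P]_w ((hotelling (Z w) / n%:R) ^+ 2)%:E =
     (n%:R ^- 2)%:E * \int[P]_w (hotelling (Z w) ^+ 2)%:E)%E.
    rewrite -integral_mulr ?invr_ge0 ?sqr_ge0 //; last 2 first.
    - by apply: measurable_funX; exact: measurable_hotelling.
    - by move=> w; exact: sqr_ge0.
    by apply: eq_integral => w _; rewrite exprMn exprVn mulrC.
  rewrite muleA -EFinM.
  have -> : 3 * (d%:R ^+ 2 + 2 * d%:R) / n%:R ^+ 2 = (3 / n%:R ^+ 2) * (d%:R ^+ 2 + 2 * d%:R) :> R by ring.
  rewrite [X in (_ <= X)%E]EFinM lee_wpmul2l ?lee_fin ?divr_ge0 ?sqr_ge0 //; exact: integral_hotelling_sqr.
apply: (@le_trans _ _ (\sum_(i < n) (3 * (d%:R ^+ 2 + 2 * d%:R) / n%:R ^+ 2)%:E)%E).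
  by apply: lee_sum => i _; exact: H.
rewrite sumEFin sumr_const card_ord lee_fin -[_ *+ n]mulr_natl.
by rewrite le_eqVlt; apply/orP; left; apply/eqP; field; rewrite gt_eqF.
Qed.

(** One factor 15 of 225 comes from the sign average of a linear form, the other from the third
    moment of [hotelling]. *)
Lemma integral_hat_fit_6 : (0 < n)%N ->
  (\int[P]_w (\sum_i hat_fit (Z w) i ^+ 6)%:E <= (225 * d%:R ^+ 3 / n%:R ^+ 2)%:E)%E.
Proof.
move=> n0; have np : 0 < n%:R :> R by rewrite ltr0n.
have p0 (M : 'M[R]_(n, d)) i : 0 <= hat_fit M i ^+ 6 by rewrite (exprM _ 3 2) sqr_ge0.
have t0 (M : 'M[R]_(n, d)) : 0 <= hotelling M ^+ 3 by rewrite exprn_ge0 // hotelling_ge0.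
rewrite integral_sumr //; last by move=> i; apply: measurable_funX; exact: measurable_hat_fit.
(* The absolute value makes the cube nonnegative everywhere, as [integral_hat_diag] demands. *)
pose f (x : R) := `|x| ^+ 3.
have fE x : 0 <= x -> f x = x ^+ 3 by move=> x0; rewrite /f ger0_norm.
have mf : measurable_fun setT f by apply: measurable_funX; exact: normr_measurable.
have f0 x : 0 <= f x by rewrite exprn_ge0.
have H i : (\int[P]_w (hat_fit (Z w) i ^+ 6)%:E <= (225 * d%:R ^+ 3 / n%:R ^+ 3)%:E)%E.
  have mfh : measurable_fun setT (fun M : mx_space R n d => f (hat (M : 'M[R]_(n, d)) i i)).
    by apply: (measurableT_comp mf); exact: mx_measurable_hat.
  apply: (@le_trans _ _ (\int[P]_w (15 * f (hat (Z w) i i))%:E)%E).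
    apply: (@integral_flip_rows_le (fun M => hat_fit M i ^+ 6) (fun M => 15 * f (hat M i i))) => //.
    - by apply: measurable_funX; exact: measurable_hat_fit.
    - by apply: measurable_funM.
    - by move=> M; rewrite fE ?hat_diag_ge0 //; exact: sum_hat_fit_6.
  rewrite integral_mulr //; last exact: (measurableT_comp mfh (proj1 GZ)).
  rewrite (integral_hat_diag i mf f0).
  have -> : (\int[P]_w (f (hotelling (Z w) / n%:R))%:E =
     (n%:R ^- 3)%:E * \int[P]_w (hotelling (Z w) ^+ 3)%:E)%E.
    rewrite -integral_mulr ?invr_ge0 ?exprn_ge0 ?ltW //; last first.
      by apply: measurable_funX; exact: measurable_hotelling.
    apply: eq_integral => w _.
    by rewrite fE ?divr_ge0 ?hotelling_ge0 ?ltW // exprMn exprVn mulrC.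
  rewrite muleA -EFinM.
  have -> : 225 * d%:R ^+ 3 / n%:R ^+ 3 = (15 / n%:R ^+ 3) * (15 * d%:R ^+ 3) :> R by field; rewrite gt_eqF.
  rewrite [X in (_ <= X)%E]EFinM lee_wpmul2l ?lee_fin ?divr_ge0 ?exprn_ge0 //; exact: integral_hotelling_cube.
apply: (@le_trans _ _ (\sum_(i < n) (225 * d%:R ^+ 3 / n%:R ^+ 3)%:E)%E).
  by apply: lee_sum => i _; exact: H.
rewrite sumEFin sumr_const card_ord lee_fin -[_ *+ n]mulr_natl.
by rewrite le_eqVlt; apply/orP; left; apply/eqP; field; rewrite gt_eqF.
Qed.

End hat_expectations.

(** * Almost sure full rank *)

Lemma normal_prob_set1 (R : realType) (x : R) : normal_prob (0 : R) 1 [set x] = 0%E.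
Proof. by rewrite /normal_prob integral_set1. Qed.

Lemma measurable_set_eq0 (R : realType) disp (T : measurableType disp) (f : T -> R) :
  measurable_fun setT f -> measurable [set w | f w = 0].
Proof.
move=> mf; rewrite -[X in measurable X]setTI.
exact: (mf measurableT [set 0] (measurable_set1 _)).
Qed.

(** The determinant is affine in the entry (0, 0), with slope the cofactor [a], almost surely
    nonzero by induction. With that entry resampled and the others fixed, at most one value kills
    the determinant, and the normal law has no atoms. *)
Lemma iid_normal_det_neq0 (R : realType) k disp (T : measurableType disp) (P : probability T R)
    (Z : T -> 'M[R]_k) :
  iid_normal P (Z : T -> mx_space R k k) -> P [set w | \det (Z w) = 0] = 0%E.
Proof.
elim: k Z => [|k IH] Z GZ.
  rewrite (_ : [set w | _] = set0) ?measure0 //; apply/seteqP; split => w //=.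
  by rewrite det_mx00 => /eqP; rewrite oner_eq0.
pose a (M : 'M[R]_k.+1) := cofactor M ord0 ord0.
pose b (M : 'M[R]_k.+1) := \sum_(j | j != ord0) M ord0 j * cofactor M ord0 j.
have detE (M : 'M[R]_k.+1) : \det M = M ord0 ord0 * a M + b M.
  by rewrite (expand_det_row _ ord0) (bigD1 ord0).
pose J (i j : 'I_k.+1) := (i == ord0) && (j == ord0).
have GJ := iid_normal_resample J GZ GZ.
set ZJ := (X in iid_normal _ X) in GJ.
have aE (w : T * T) : a (ZJ w) = a (Z w.1).
  rewrite /a /cofactor; congr (_ * \det _); apply/matrixP => i j.
  by rewrite !mxE /J eq_sym (negbTE (neq_lift _ _)).
have bE (w : T * T) : b (ZJ w) = b (Z w.1).
  apply: eq_bigr => j j0; rewrite [ZJ w _ _]mxE /J (negbTE j0) andbF; congr (_ * _).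
  rewrite /cofactor; congr (_ * \det _); apply/matrixP => i l.
  by rewrite !mxE /J eq_sym (negbTE (neq_lift _ _)).
have mZ := iid_mx_measurable GZ.
have mZJ := iid_mx_measurable GJ.
have maZ : measurable_fun setT (fun w => a (Z w)).
  apply: measurable_funM => //; apply: measurable_det => i j.
  by under eq_fun do rewrite !mxE; exact: mZ.
pose E := [set w | \det (ZJ w) = 0].
have mE : measurable E by apply: measurable_set_eq0; exact: measurable_det.
have -> : P [set w | \det (Z w) = 0] = (P \x P)%E E.
  apply: (iid_normal_law GZ GJ (B := [set M : mx_space R k.+1 k.+1 | \det (M : 'M[R]_k.+1) = 0])).
  apply: measurable_set_eq0; apply: measurable_det; exact: measurable_mx_id.
have ma0 : measurable [set w | a (Z w) = 0] by exact: measurable_set_eq0.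
have Pa0 : P [set w | a (Z w) = 0] = 0%E.
  have GS := iid_normal_sub (@lift_inj _ ord0) (@lift_inj _ ord0) GZ.
  rewrite -[RHS](IH _ GS); congr (P _); apply/seteqP; split => w /=.
    rewrite /a /cofactor addn0 expr0 mul1r => <-; congr (\det _).
    by apply/matrixP => i j; rewrite !mxE.
  rewrite /a /cofactor addn0 expr0 mul1r => <-; congr (\det _).
  by apply/matrixP => i j; rewrite !mxE.
apply/eqP; rewrite eq_le measure_ge0 andbT -Pa0.
have -> : P [set w | a (Z w) = 0] = (\int[P]_w (\1_[set w | a (Z w) = 0] w)%:E)%E.
  by rewrite integral_indic // setIT.
apply: ge0_le_integral => //.
- exact: measurable_fun_xsection.
- by apply/measurable_EFinP; exact: measurable_indic.
- move=> w _; rewrite indicE; have [|aw] := boolP (w \in _).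
    by move=> _; rewrite /= probability_le1 //; exact: measurable_xsection.
  rewrite le_eqVlt; apply/orP; left; apply/eqP.
  have {}aw : a (Z w) != 0 by apply: contra aw => /eqP aw; rewrite inE.
  rewrite -[RHS](normal_prob_set1 (- b (Z w) / a (Z w))).
  rewrite -(iid_normal_marginal ord0 ord0 GZ) //; congr (P _); apply/seteqP; split => w' /=.
    rewrite /xsection /= inE /E /= detE aE bE [ZJ _ _ _]mxE /J !eqxx /= => H.
    apply: (mulIf aw); rewrite mulfVK //; apply/eqP; rewrite -subr_eq0 opprK; exact/eqP.
  rewrite /xsection /= inE /E /= detE aE bE [ZJ _ _ _]mxE /J !eqxx /= => ->.
  by rewrite mulfVK // addNr.
Qed.

(** A kernel vector of the Gram matrix is orthogonal to every row of [M], in particular to the first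
    [d] ones. *)
Lemma det_sub_eq0 (R : realType) n d (M : 'M[R]_(n, d)) (dn : (d <= n)%N) :
  gram_det M = 0 -> \det (mxsub (widen_ord dn) id M) = 0.
Proof.
move=> /eqP /det0P[v v0 vM]; apply/eqP; rewrite -det_tr; apply/det0P; exists v => //.
have vMT : v *m M^T = 0.
  have : v *m M^T *m (v *m M^T)^T = 0 by rewrite trmx_mul trmxK mulmxA -[v *m _ *m _]mulmxA vM mul0mx.
  move=> /matrixP/(_ 0 0); rewrite mxE [RHS]mxE => /eqP; rewrite psumr_eq0; last first.
    by move=> i _; rewrite [_^T _ _]mxE -expr2 sqr_ge0.
  move=> /allP H; apply/rowP => i; rewrite [RHS]mxE; apply/eqP.
  have := H i; rewrite mem_index_enum => /(_ isT); rewrite [_^T _ _]mxE -expr2 /= sqrf_eq0.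
  by [].
apply/rowP => i; have /rowP/(_ (widen_ord dn i)) := vMT.
rewrite mxE [in X in X -> _]mxE => H; rewrite mxE [RHS]mxE -[RHS]H.
by apply: eq_bigr => j _; rewrite !mxE.
Qed.

Lemma iid_normal_gram_det_neq0 (R : realType) n d disp (T : measurableType disp)
    (P : probability T R) (Z : T -> 'M[R]_(n, d)) : (d <= n)%N ->
  iid_normal P (Z : T -> mx_space R n d) -> P [set w | gram_det (Z w) = 0] = 0%E.
Proof.
move=> dn GZ.
have winj : injective (widen_ord dn) by move=> i j /(congr1 val) /= ij; exact: val_inj.
have GS := iid_normal_sub winj (@inj_id _) GZ.
have mZ := iid_mx_measurable GZ; have mS := iid_mx_measurable GS.
apply/eqP; rewrite eq_le measure_ge0 andbT -(iid_normal_det_neq0 GS).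
apply: le_measure; rewrite ?inE.
- by apply: measurable_set_eq0; exact: measurable_gram_det.
- by apply: measurable_set_eq0; exact: measurable_det.
- by move=> w /=; exact: det_sub_eq0.
Qed.

(** * Anticoncentration of the chi-square law *)

Lemma normal_prob_small_ball (R : realType) (s : R) : 0 <= s ->
  (normal_prob (0 : R) 1 [set x | (`|x| <= s)%R] <= s%:E)%E.
Proof.
move=> s0.
have -> : [set x | `|x| <= s] = `[- s, s]%classic :> set R.
  by apply/seteqP; split => x /=; rewrite in_itv /= ler_norml.
rewrite /normal_prob.
apply: (@le_trans _ _ (\int[@lebesgue_measure R]_(x in `[(- s)%R, s]) (2^-1)%:E)%E).
  apply: ge0_le_integral => //.
  - by move=> x _; rewrite lee_fin normal_pdf_ge0.
  - apply/measurable_EFinP; apply: measurable_funTS; exact: measurable_normal_pdf.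
  - move=> x _; rewrite lee_fin; apply: le_trans (normal_pdf_ub _ _ (oner_neq0 _)) _.
    (* The density is at most 1/2 since the square root of 2 pi is at least 2; the interval has
       length [2 * s]. *)
    have q : 2 <= Num.sqrt (pi *+ 2 : R).
      have p2 := pi_ge2 R.
      rewrite -[leLHS]ger0_norm // -sqrtr_sqr ler_sqrt -[pi *+ 2]mulr_natr; lra.
    by rewrite /normal_peak expr1n mul1r lef_pV2 ?posrE // (lt_le_trans _ q).
rewrite integral_cst //= lebesgue_measure_itv /= lte_fin.
case: ifP => [_|_]; last by rewrite mule0 lee_fin.
rewrite -EFinD -EFinM lee_fin; lra.
Qed.

Section small_ball.
Variables (R : realType) (d : nat) (disp : measure_display) (T : measurableType disp).
Variable P : probability T R.
Variable Z : T -> 'M[R]_(1, d).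
Hypothesis GZ : iid_normal P (Z : T -> mx_space R 1 d).
Let mZ := iid_mx_measurable GZ.
Implicit Types v : 'I_d -> R.

(** After a rotation of [v] to an axis, the form divided by the norm of [v] is a single standard
    normal entry. Rotations act on rows, hence the transpose. *)
Lemma linear_form_small_ball v j0 (s : R) : 0 <= s -> v j0 != 0 ->
  (P [set w | (`|\sum_j v j * Z w ord0 j| <= s)%R] <=
   (s / Num.sqrt (\sum_j v j ^+ 2))%:E)%E.
Proof.
move=> s0; wlog v0 : v / 0 < v j0.
  move=> H vj; have [/H /(_ vj) //|] := ltP 0 (v j0).
  rewrite le_eqVlt (negbTE vj) /= => vlt.
  have := H (fun j => - v j); rewrite oppr_gt0 oppr_eq0 => /(_ vlt vj).
  under [X in Num.sqrt X]eq_bigr do rewrite sqrrN.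
  move=> /(le_trans _); apply; rewrite le_eqVlt; apply/orP; left; apply/eqP; congr (P _).
  have E w : `|\sum_j - v j * Z w ord0 j| = `|\sum_j v j * Z w ord0 j|.
    by under eq_bigr do rewrite mulNr; rewrite sumrN normrN.
  by apply/seteqP; split => w /=; rewrite E.
move=> vj; have [ O [_ Oj OZ]] := exists_iid_normal_orthogonal v0.
have GT := OZ _ _ _ _ _ (iid_normal_tr GZ).
set r := Num.sqrt _ in Oj *.
have r0 : 0 < r.
  rewrite sqrtr_gt0 (bigD1 j0) //= ltr_pwDl ?exprn_gt0 // sumr_ge0 // => j _; exact: sqr_ge0.
have -> : [set w | `|\sum_j v j * Z w ord0 j| <= s] =
    [set w | [set x | `|x| <= s / r] ((O *m (Z w)^T) j0 ord0)].
  have E w : (O *m (Z w)^T) j0 ord0 = (\sum_j v j * Z w ord0 j) / r.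
    by rewrite mxE mulr_suml; apply: eq_bigr => j _; rewrite Oj mxE mulrAC.
  by apply/seteqP; split => w /=; rewrite E normrM normfV [`|r|]gtr0_norm // ler_pM2r ?invr_gt0.
rewrite (iid_normal_marginal j0 ord0 GT).
  by apply: normal_prob_small_ball; rewrite divr_ge0 // ltW.
have -> : [set x | `|x| <= s / r] = `[- (s / r), s / r]%classic :> set R.
  by apply/seteqP; split => x /=; rewrite in_itv /= ler_norml.
exact: measurable_itv.
Qed.

(** A small sum forces at least three quarters of the coordinates into [B], since each other one
    contributes more than [4 * eta]; the expected number [f] of coordinates in [B] is at most
    [2 * sqrt eta * d], and Markov's inequality at [d / 2] concludes. *)
Lemma sum_sqr_small_ball (eta : R) : 0 < eta -> (0 < d)%N ->
  (P [set w | (\sum_j Z w ord0 j ^+ 2 <= eta * d%:R)%R] <= (4 * Num.sqrt eta)%:E)%E.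
Proof.
move=> ep d0; have e0 := ltW ep; have dp : 0 < d%:R :> R by rewrite ltr0n.
pose B := [set x : R | `|x| <= 2 * Num.sqrt eta].
have mB : measurable B.
  have -> : B = `[- (2 * Num.sqrt eta), 2 * Num.sqrt eta]%classic.
    by apply/seteqP; split => x; rewrite /B /= in_itv /= ler_norml.
  exact: measurable_itv.
pose f w : R := \sum_j \1_B (Z w ord0 j).
have mi j : measurable_fun setT (fun w => \1_B (Z w ord0 j) : R).
  have m1 : measurable_fun setT (\1_B : R -> R) by exact: measurable_indic.
  exact: (measurableT_comp m1 (mZ ord0 j)).
have mf : measurable_fun setT f by exact: measurable_sum.
have f0 w : 0 <= f w by apply: sumr_ge0.
have Ef : (\int[P]_w (f w)%:E <= (2 * Num.sqrt eta * d%:R)%:E)%E.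
  rewrite integral_sumr //.
  apply: (@le_trans _ _ (\sum_(j < d) (2 * Num.sqrt eta)%:E)%E).
    apply: lee_sum => j _.
    rewrite (integral_entry GZ ord0 j (f := \1_B)) //.
    rewrite integral_indic // setIT; apply: normal_prob_small_ball.
    by rewrite mulr_ge0 ?sqrtr_ge0.
  by rewrite sumEFin sumr_const card_ord -[_ *+ d]mulr_natr.
have d2 : 0 < d%:R / 2 :> R by rewrite divr_gt0.
have -> : 4 * Num.sqrt eta = 2 * Num.sqrt eta * d%:R / (d%:R / 2) by field; rewrite gt_eqF.
apply: le_trans (markov_real mf f0 d2 Ef).
have mge : measurable [set w | d%:R / 2 <= f w].
  rewrite (_ : [set w | _] = [set w | - f w <= - (d%:R / 2)]).
    by apply: measurable_set_le; exact: measurable_funN.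
  by apply/seteqP; split => w /=; rewrite lerN2.
apply: le_measure; rewrite ?inE //.
  by apply: measurable_set_le; apply: measurable_sum => j; apply: measurable_funX.
move=> w /= H; rewrite leNgt; apply/negP => fd.
have K : \sum_j (1 - \1_B (Z w ord0 j)) * (4 * eta) <= \sum_j Z w ord0 j ^+ 2.
  apply: ler_sum => j _; rewrite indicE; case: (boolP (_ \in B)) => [_|].
    by rewrite subrr mul0r sqr_ge0.
  rewrite subr0 mul1r; have [//|+ _] := ltP (Z w ord0 j ^+ 2) (4 * eta); last by [].
  move=> zlt /negP []; rewrite inE /B /=.
  rewrite -ler_sqr ?nnegrE // ?mulr_ge0 ?sqrtr_ge0 //.
  by rewrite real_normK ?num_real // exprMn sqr_sqrtr // (le_trans (ltW zlt)) // -natrX.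
move: K; rewrite -mulr_suml sumrB sumr_const card_ord -/(f w) => K.
have : (d%:R - f w) * (4 * eta) <= eta * d%:R := le_trans K H.
rewrite mulrA [eta * _]mulrC ler_pM2r //; lra.
Qed.

End small_ball.

Section anticoncentration.
Variables (R : realType) (d : nat) (disp : measure_display) (T : measurableType disp).
Variable P : probability T R.
Variable Z : T -> 'M[R]_(1, d).
Hypothesis GZ : iid_normal P (Z : T -> mx_space R 1 d).
Let mZ := iid_mx_measurable GZ.

Let stack (w : T * T) : 'M[R]_(2, d) :=
  \matrix_(i, j) if i == ord0 then Z w.1 ord0 j else Z w.2 ord0 j.

Let iid_stack : iid_normal (P \x P)%E (stack : T * T -> mx_space R 2 d).
Proof.
split.
  apply/measurable_mxP => i j; under eq_fun do rewrite mxE.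
  case: (i == ord0).
  - exact: (measurableT_comp (mZ ord0 j) measurable_fst).
  - exact: (measurableT_comp (mZ ord0 j) measurable_snd).
move=> A mA; rewrite big_ord_recl big_ord1.
have mrow i : measurable [set w | forall k j, A i j (Z w k j)].
  rewrite -[X in measurable X]setTI.
  apply: (proj1 GZ measurableT [set M : mx_space R 1 d | forall k j, A i j ((M : 'M[R]_(1, d)) k j)]).
  by apply: sub_sigma_algebra; exists (fun _ => A i).
have Prow i : P [set w | forall k j, A i j (Z w k j)] = (\prod_(j < d) normal_prob 0 1 (A i j))%E.
  by rewrite (proj2 GZ (fun _ => A i)) ?big_ord1.
rewrite (_ : [set w | _] = [set w | forall k j, A ord0 j (Z w k j)] `*`
    [set w | forall k j, A (lift ord0 ord0) j (Z w k j)]); last first.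
  apply/seteqP; split => -[w w'] /=.
    move=> H; split => k j; rewrite (ord1 k).
      by have := H ord0 j; rewrite mxE.
    by have := H (lift ord0 ord0) j; rewrite mxE.
  move=> [H1 H2] i j; rewrite mxE; case: (unliftP ord0 i) => [i' ->|->] //=.
  by rewrite (ord1 i').
transitivity (P [set w | forall k j, A ord0 j (Z w k j)] *
   P [set w | forall k j, A (lift ord0 ord0) j (Z w k j)])%E.
  exact: product_measure1E.
by rewrite !Prow.
Qed.

Let dotZ (w : T * T) : R := \sum_j Z w.1 ord0 j * Z w.2 ord0 j.

Let mdot : measurable_fun setT dotZ.
Proof.
apply: measurable_sum => j; apply: measurable_funM.
- exact: (measurableT_comp (mZ ord0 j) measurable_fst).
- exact: (measurableT_comp (mZ ord0 j) measurable_snd).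
Qed.

Let measurable_abs_le d' (T' : measurableType d') (f : T' -> R) s :
  measurable_fun setT f -> measurable [set w | `|f w| <= s].
Proof.
by move=> mf; apply: (@measurable_set_le R _ T' (fun w => `|f w|)); exact: measurableT_comp.
Qed.

(** Given the first vector the scalar product is normal. Its squared deviation is at most [eps * d]
    with probability at most [4 * sqrt eps] (event [B1]), and otherwise the small ball has
    probability at most [sqrt eps]. *)
Lemma inner_product_small_ball (eps : R) : 0 < eps -> (0 < d)%N ->
  ((P \x P) [set w | (`|dotZ w| <= eps * Num.sqrt d%:R)%R] <= (5 * Num.sqrt eps)%:E)%E.
Proof.
move=> e0 d0; have dp : 0 < d%:R :> R by rewrite ltr0n.
pose j0 : 'I_d := Ordinal d0.
have se0 : 0 < Num.sqrt eps by rewrite sqrtr_gt0.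
have sd0 : 0 < Num.sqrt d%:R :> R by rewrite sqrtr_gt0.
have see : Num.sqrt eps * Num.sqrt eps = eps by rewrite -expr2 sqr_sqrtr // ltW.
set E := [set w | _].
have mE : measurable E by exact: measurable_abs_le.
pose B1 := [set w | \sum_j Z w ord0 j ^+ 2 <= eps * d%:R].
(* A null event, removed because [linear_form_small_ball] needs a nonzero coordinate. *)
pose B2 := [set w | Z w ord0 j0 = 0].
have mB1 : measurable B1.
  by apply: measurable_set_le; apply: measurable_sum => j; apply: measurable_funX.
have mB2 : measurable B2 by exact: measurable_set_eq0.
have PB2 : P B2 = 0%E.
  rewrite -(@normal_prob_set1 R 0) -(iid_normal_marginal ord0 j0 GZ) //.
pose h w : R := \1_B1 w + \1_B2 w + Num.sqrt eps.
have mh : measurable_fun setT h.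
  by apply: measurable_funD => //; apply: measurable_funD; exact: measurable_indic.
apply: (@le_trans _ _ (\int[P]_w (h w)%:E)%E).
  apply: ge0_le_integral => //.
  - exact: measurable_fun_xsection.
  - exact/measurable_EFinP.
  - move=> w _; change (P (xsection E w) <= (h w)%:E)%E; rewrite /h.
    have [wB|wB1] := boolP (w \in B1).
      apply: (@le_trans _ _ 1%E); first by rewrite probability_le1 //; exact: measurable_xsection.
      by rewrite lee_fin !indicE wB /= -addrA lerDl addr_ge0 // ltW.
    have [wB|wB2] := boolP (w \in B2).
      apply: (@le_trans _ _ 1%E); first by rewrite probability_le1 //; exact: measurable_xsection.
      by rewrite lee_fin !indicE wB /= addrAC lerDr addr_ge0 // ltW.
    rewrite !indicE (negbTE wB1) (negbTE wB2) !add0r.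
    have v0 : Z w ord0 j0 != 0 by apply: contra wB2 => /eqP H; rewrite inE.
    have vd : eps * d%:R < \sum_j Z w ord0 j ^+ 2.
      by rewrite ltNge; apply: contra wB1 => H; rewrite inE.
    have -> : xsection E w = [set w' | `|\sum_j Z w ord0 j * Z w' ord0 j| <= eps * Num.sqrt d%:R].
      by apply/seteqP; split => w' /=; rewrite /xsection /= inE.
    have s0 : 0 <= eps * Num.sqrt d%:R by rewrite mulr_ge0 // ltW.
    apply: le_trans (linear_form_small_ball GZ s0 v0) _; rewrite lee_fin.
    rewrite ler_pdivrMr; last by rewrite sqrtr_gt0 (lt_trans _ vd) // mulr_gt0.
    apply: (@le_trans _ _ (Num.sqrt eps * Num.sqrt (eps * d%:R))).
      by rewrite sqrtrM ?(ltW e0) // mulrA see.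
    by rewrite ler_pM2l // ler_wsqrtr // ltW.
have m1 : measurable_fun setT (\1_B1 : T -> R) by exact: measurable_indic.
have m2 : measurable_fun setT (\1_B2 : T -> R) by exact: measurable_indic.
have m12 : measurable_fun setT (fun w => \1_B1 w + \1_B2 w : R) by exact: measurable_funD.
have p1 w : 0 <= \1_B1 w :> R by rewrite indicE ler0n.
have p2 w : 0 <= \1_B2 w :> R by rewrite indicE ler0n.
rewrite (integral_addr P m12 (measurable_cst _)) => [|w|w]; last 2 first.
- exact: addr_ge0.
- exact: ltW.
rewrite (integral_addr P m1 m2 p1 p2).
have -> : (\int[P]_w (\1_B1 w)%:E = P B1)%E by rewrite integral_indic // setIT.
have -> : (\int[P]_w (\1_B2 w)%:E = 0)%E by rewrite integral_indic // setIT; exact: PB2.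
rewrite adde0 integral_cstr.
apply: le_trans (leeD (sum_sqr_small_ball GZ e0 d0) (lexx _)) _.
by rewrite -EFinD lee_fin -[X in _ + X]mul1r -mulrDl natr1.
Qed.

(** The square is the probability that two independent copies both fall in the interval, hence are
    close. Rotating the two rows by 45 degrees turns half their difference into a scalar product, as
    x^2 - y^2 = (x - y) (x + y). *)
Lemma sum_sqr_anticoncentration (x eps : R) : 0 < eps -> (0 < d)%N ->
  (P [set w | (x < \sum_j Z w ord0 j ^+ 2 <= x + eps * Num.sqrt d%:R)%R] ^+ 2
   <= (5 * Num.sqrt eps)%:E)%E.
Proof.
move=> e0 d0; set A := [set w | _].
have mW : measurable_fun setT (fun w => \sum_j Z w ord0 j ^+ 2).
  by apply: measurable_sum => j; apply: measurable_funX.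
have mA : measurable A.
  have -> : A = (fun w => \sum_j Z w ord0 j ^+ 2) @^-1` `]x, x + eps * Num.sqrt d%:R]%classic.
    by apply/seteqP; split => w /=; rewrite in_itv.
  by rewrite -[X in measurable X]setTI; apply: mW => //; exact: measurable_itv.
rewrite expe2 -(product_measure1E P P mA mA).
pose c : R := Num.sqrt 2^-1.
have c0 : 0 < c by rewrite sqrtr_gt0 invr_gt0.
have c2 : c ^+ 2 = 2^-1 by rewrite sqr_sqrtr // invr_ge0.
have cc : c ^+ 2 + c ^+ 2 = 1 by rewrite c2; lra.
pose a : 'I_2 := ord0; pose b : 'I_2 := lift ord0 ord0.
have ab : a != b by [].
have GR := iid_normal_givens ab c0 cc iid_stack.
pose ip (M : 'M[R]_(2, d)) := \sum_j M a j * M b j.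
have mip : measurable_fun setT (ip : mx_space R 2 d -> R).
  by apply: measurable_sum => j; apply: measurable_funM; exact: measurable_mx_entry.
pose B := [set M : mx_space R 2 d | `|ip M| <= eps * Num.sqrt d%:R].
have mB : measurable B by exact: measurable_abs_le.
have ipE w : ip (givens a b c c 1%:M *m stack w) =
    (\sum_j Z w.1 ord0 j ^+ 2 - \sum_j Z w.2 ord0 j ^+ 2) / 2.
  rewrite -givensE // /ip -sumrB mulr_suml; apply: eq_bigr => j _.
  rewrite !mxE !eqxx [b == a]eq_sym (negbTE ab) /= -c2; ring.
apply: (@le_trans _ _ ((P \x P) ((fun w => givens a b c c 1%:M *m stack w : mx_space R 2 d) @^-1` B))%E).
  apply: le_measure; rewrite ?inE.
  - exact: measurableX.
  - by rewrite -[X in measurable X]setTI; apply: (proj1 GR).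
  - move=> [w w'] [] /= /andP[A1 A2] /andP[A3 A4]; rewrite /B /= ipE /=.
    move: (\sum_j Z w ord0 j ^+ 2) (\sum_j Z w' ord0 j ^+ 2) A1 A2 A3 A4 => u v A1 A2 A3 A4.
    rewrite ler_norml; apply/andP; split; lra.
rewrite -(iid_normal_law iid_stack GR mB).
apply: le_trans (inner_product_small_ball e0 d0); rewrite le_eqVlt; apply/orP; left; apply/eqP.
have E w : ip (stack w) = dotZ w by apply: eq_bigr => j _; rewrite !mxE.
by congr ((P \x P)%E _); apply/seteqP; split => w /=; rewrite /B /= E.
Qed.

End anticoncentration.

(** * The null model *)

Lemma measurable_tuple_box (R : realType) d (A : 'I_d -> set R) :
  (forall j, measurable (A j)) ->
  measurable [set t : d.-tuple R | forall j, A j (tnth t j)].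
Proof.
move=> mA; rewrite (_ : [set t : d.-tuple R | _] =
    \bigcap_(j in [set` [set: 'I_d]%SET]) ((fun t => tnth t j) @^-1` A j)).
  apply: fin_bigcap_measurable => // j _; rewrite -[X in measurable X]setTI.
  exact: (@measurable_tnth _ R d j measurableT _ (mA j)).
apply/seteqP; split => t /= H; first by move=> j _; exact: H.
by move=> j; apply: (H j); rewrite /= inE.
Qed.

Lemma std_normal_vector_box (R : realType) disp (T : measurableType disp)
    (P : probability T R) d (X : T -> d.-tuple R) (A : 'I_d -> set R) :
  std_normal_vector P X -> (forall j, measurable (A j)) ->
  P [set w | forall j, A j (tnth (X w) j)] = (\prod_(j < d) normal_prob 0 1 (A j))%E.
Proof.
move=> [ind marg] mA.
have := ind [set: 'I_d]%SET A (fun j _ => mA j).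
rewrite (eq_bigl xpredT) => [|j]; last by rewrite inE.
rewrite (eq_bigr (fun j => normal_prob 0 1 (A j))) => [<-|j _]; last exact: marg.
congr (P _); apply/seteqP; split => w /= H; first by move=> j _; exact: H.
by move=> j; apply: (H j); rewrite /= inE.
Qed.

Lemma iid_normal_row (R : realType) disp (T : measurableType disp)
    (P : probability T R) d (X : {RV P >-> d.-tuple R}) :
  std_normal_vector P X ->
  iid_normal P (fun w => \row_j tnth (X w) j : mx_space R 1 d).
Proof.
move=> SX; split.
  apply/measurable_mxP => i j; under eq_fun do rewrite mxE.
  exact: (measurableT_comp (@measurable_tnth _ R d j) (measurable_funPT X)).
move=> A mA; rewrite big_ord1 -(std_normal_vector_box SX) //.
congr (P _); apply/seteqP; split => w /=.
  by move=> H j; have := H ord0 j; rewrite mxE.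
by move=> H i j; rewrite mxE (ord1 i); exact: H.
Qed.

Lemma chi_square_law (R : realType) disp (T : measurableType disp)
    (P : probability T R) d (Z : T -> 'M[R]_(1, d))
    disp' (T' : measurableType disp') (Q : probability T' R) (V : T' -> R) (A : set R) :
  iid_normal P (Z : T -> mx_space R 1 d) -> chi_square Q d V -> measurable A ->
  Q (V @^-1` A) = P [set w | A (\sum_j Z w ord0 j ^+ 2)].
Proof.
move=> GZ [disp'' [T'' [P' [X [SX QX]]]]] mA; rewrite QX //.
pose B := [set M : mx_space R 1 d | A (\sum_j (M : 'M[R]_(1, d)) ord0 j ^+ 2)].
have mB : measurable B.
  have mf : measurable_fun setT (fun M : mx_space R 1 d => \sum_j (M : 'M[R]_(1, d)) ord0 j ^+ 2).
    by apply: measurable_sum => j; apply: measurable_funX; exact: measurable_mx_entry.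
  by rewrite -[X in measurable X]setTI; exact: mf.
rewrite -[RHS](iid_normal_law (iid_normal_row SX) GZ mB).
have E w : \sum_j (\row_j tnth (X w) j) ord0 j ^+ 2 = \sum_j tnth (X w) j ^+ 2 :> R.
  by apply: eq_bigr => j _; rewrite mxE.
by congr (P' _); apply/seteqP; split => w; rewrite /B /= E.
Qed.

Lemma measure_bigsetU_le (R : realType) disp (T : measurableType disp)
    (P : probability T R) (I : Type) (s : seq I) (A : I -> set T) :
  (forall i, measurable (A i)) ->
  (P (\big[setU/set0]_(i <- s) A i) <= \sum_(i <- s) P (A i))%E.
Proof.
move=> mA; elim: s => [|i s IH]; first by rewrite !big_nil measure0.
rewrite !big_cons; apply: le_trans (measureU2 _ _ _) _ => //.
  exact: bigsetU_measurable.
exact: leeD2l.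
Qed.

Section model.
Variables (R : realType) (n d : nat) (disp : measure_display) (T : measurableType disp).
Variable P : probability T R.
Variables (X : 'I_n -> {RV P >-> d.-tuple R}) (Y : 'I_n -> {RV P >-> R}).
Hypothesis XY : null_logistic_model X Y.

Definition design (w : T) : 'M[R]_(n, d) := \matrix_(i, j) (Y i w * tnth (X i w) j).

(** The labels are real-valued, so these events cover the space only up to a null set ([Pcover]). *)
Let label_event (e : {ffun 'I_n -> bool}) : set T :=
  [set w | forall i, Y i w = (-1) ^+ e i].

Let g_sigma_preimage_bigcap disp' (T' : measurableType disp') (F : 'I_n -> T -> T') (A : 'I_n -> set T') :
  (forall i, measurable (A i)) ->
  g_sigma_preimage F [set w | forall i, A i (F i w)].
Proof.
move=> mA; pose S := \big[setU/set0]_(i < n) preimage_set_system setT (F i) measurable.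
have -> : [set w | forall i, A i (F i w)] =
    \bigcap_(i in [set` [set: 'I_n]%SET]) (F i @^-1` A i).
  apply/seteqP; split => w /= H; first by move=> i _; exact: H.
  by move=> i; apply: (H i); rewrite /= inE.
apply: (@fin_bigcap_measurable _ (g_sigma_algebraType S)) => // i _.
apply: sub_sigma_algebra => /=; rewrite /S -bigcup_seq /=; exists i => /=.
  by rewrite mem_index_enum.
by exists (A i) => //; rewrite setTI.
Qed.

Let label_set1 (b : bool) : measurable [set ((-1) ^+ b : R)].
Proof. exact: measurable_set1. Qed.

Let measurable_label_event e : measurable (label_event e).
Proof.
have -> : label_event e = \bigcap_(i in [set` [set: 'I_n]%SET]) (Y i @^-1` [set (-1) ^+ e i]).
  apply/seteqP; split => w /= H; first by move=> i _; exact: H.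
  by move=> i; apply: (H i); rewrite /= inE.
apply: fin_bigcap_measurable => // i _; rewrite -[X in measurable X]setTI.
Qed.

Let trivIset_label_event : trivIset setT label_event.
Proof.
move=> e e' _ _ [w [We We']]; apply/ffunP => i.
have := We i; rewrite (We' i) => /eqP; rewrite (inj_eq (@signr_inj R)).
by move=> /eqP.
Qed.

Let Pcover : P (\bigcup_e label_event e) = 1%E.
Proof.
have [_ _ HY _ _] := XY.
have mU : measurable (\bigcup_e label_event e).
  by apply: fin_bigcup_measurable => // e _; exact: measurable_label_event.
suff : P (~` (\bigcup_e label_event e)) = 0%E.
  rewrite probability_setC // -(fineK (fin_num_measure P _ mU)) -EFinB => -[H].
  by congr EFin; apply/eqP; rewrite eq_sym -subr_eq0 H.
pose N i : set T := ~` (Y i @^-1` [set -1] `|` Y i @^-1` [set 1]).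
have mY i (x : R) : measurable (Y i @^-1` [set x]).
  by rewrite -[X in measurable X]setTI; exact: (measurable_funPT (Y i)).
have mN i : measurable (N i) by apply: measurableC; exact: measurableU.
have N0 i : P (N i) = 0%E.
  have [Y1 Y2] := HY i.
  rewrite probability_setC; last exact: measurableU.
  rewrite [X in (1 - X)%E = _]measureU //; last first.
    by apply/seteqP; split => w //= [->] => /eqP; rewrite eq_sym -addr_eq0 -mulr2n pnatr_eq0.
  by rewrite [X in (1 - (X + _)%R)%E]Y1 [X in (1 - (_ + X)%R)%E]Y2 -[LHS]/((1 - (2^-1 + 2^-1))%:E); congr EFin; lra.
apply/eqP; rewrite eq_le measure_ge0 andbT.
apply: (@le_trans _ _ (P (\big[setU/set0]_(i < n) N i))).
  apply: le_measure; rewrite ?inE; first exact: measurableC.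
    by apply: bigsetU_measurable => i _.
  move=> w Hw; rewrite -bigcup_seq /=; apply: contrapT => Hn; apply: Hw.
  exists [ffun i => Y i w == -1] => // i; rewrite ffunE.
  have : ~ N i w by move=> Ni; apply: Hn; exists i => //=; rewrite mem_index_enum.
  move=> /contrapT [] /= ->; first by rewrite eqxx expr1.
  by case: eqP => // /eqP; rewrite eq_sym -addr_eq0 -mulr2n pnatr_eq0.
apply: (@le_trans _ _ (\sum_(i < n) P (N i))%E); last by rewrite big1.
exact: measure_bigsetU_le.
Qed.

(** On each label event the rows are the [X i] with fixed signs; by symmetry and independence of the
    families, the box has conditional probability [c] whatever the signs. The disjoint label events
    are then summed. *)
Lemma iid_normal_design : iid_normal P (design : T -> mx_space R n d).
Proof.
have [HX IX HY IY IXY] := XY.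
have mX i j : measurable_fun setT (fun w => tnth (X i w) j).
  exact: (measurableT_comp (@measurable_tnth _ R d j) (measurable_funPT (X i))).
have mD : mx_measurable design.
  move=> i j; under eq_fun do rewrite mxE.
  by apply: measurable_funM => //; exact: (measurable_funPT (Y i)).
split; first by apply/measurable_mxP.
move=> A mA; set B := [set w | _].
set c := (\prod_(i < n) _)%E.
have mB : measurable B.
  rewrite -[X in measurable X]setTI.
  apply: ((proj1 (measurable_mxP (design : T -> mx_space R n d)) mD) measurableT
    [set M : mx_space R n d | forall i j, A i j ((M : 'M[R]_(n, d)) i j)]).
  by apply: sub_sigma_algebra; exists A.
pose Ae (e : {ffun 'I_n -> bool}) i j := if e i then -%R @^-1` A i j else A i j.
have mAe e i j : measurable (Ae e i j).
  rewrite /Ae; case: ifP => // _; rewrite -[X in measurable X]setTI.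
  exact: (@oppr_measurable R setT).
pose De e i := [set t : d.-tuple R | forall j, Ae e i j (tnth t j)].
have mDe e i : measurable (De e i) by exact: measurable_tuple_box.
have PX e : P [set w | forall i, De e i (X i w)] = c.
  have := IX [set: 'I_n]%SET (De e) (fun i _ => mDe e i).
  rewrite (eq_bigl xpredT) => [H|i]; last by rewrite inE.
  transitivity (\prod_(i < n) P (X i @^-1` De e i))%E.
    rewrite -H; congr (P _); apply/seteqP; split => w /= K; first by move=> i _; exact: K.
    by move=> i; apply: (K i); rewrite /= inE.
  apply: eq_bigr => i _; rewrite -[LHS]/(P [set w | forall j, Ae e i j (tnth (X i w) j)]).
  rewrite (std_normal_vector_box (HX i)) //; apply: eq_bigr => j _.
  by rewrite /Ae; case: ifP => // _; rewrite normal_probN.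
have PBe e : P (B `&` label_event e) = (c * P (label_event e))%E.
  rewrite -(PX e) -(IXY [set w | forall i, De e i (X i w)] (label_event e)); last 2 first.
  - exact: g_sigma_preimage_bigcap.
  - apply: (@g_sigma_preimage_bigcap _ _ (fun i => Y i) (fun i => [set (-1) ^+ e i])) => i.
    exact: label_set1.
  congr (P _); apply/seteqP; split => w /= [H We]; split => //.
    move=> i j; have := H i j; rewrite mxE We /Ae.
    by case: (e i); rewrite ?expr1 ?expr0 ?mulN1r ?mul1r.
  move=> i j; have := H i j; rewrite mxE We /Ae.
  by case: (e i); rewrite /= ?expr1 ?expr0 ?mulN1r ?mul1r.
have trB : trivIset setT (fun e => B `&` label_event e).
  move=> e e' _ _ [w [[_ We] [_ We']]]; apply: (trivIset_label_event I I); exists w; split; [exact: We|exact: We'].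
pose U := \bigcup_e label_event e; have PU : P U = 1%E := Pcover.
have mU : measurable U.
  by apply: fin_bigcup_measurable => // e _; exact: measurable_label_event.
have EB : P B = P (B `&` U).
  apply/eqP; rewrite eq_le; apply/andP; split; last first.
    by apply: le_measure; rewrite ?inE //; exact: measurableI.
  have PU0 : P (~` U) = 0%E by rewrite probability_setC // PU subee.
  rewrite -[leRHS]adde0 -PU0; apply: le_trans (measureU2 _ _ _) => //.
  - apply: le_measure; rewrite ?inE //; last by move=> w Bw; have [Uw|Uw] := pselect (U w); [left|right].
    by apply: measurableU; [exact: measurableI|exact: measurableC].
  - exact: measurableI.
  - exact: measurableC.
have fB : finite_set [set: {ffun 'I_n -> bool}] by exact: finite_finset.
rewrite EB setI_bigcupr measure_fin_bigcup //; last first.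
  by move=> e _; apply: measurableI => //; exact: measurable_label_event.
transitivity (\sum_(e \in [set: {ffun 'I_n -> bool}]) (c * P (label_event e)))%E.
  by apply: eq_fsbigr => e _; exact: PBe.
rewrite -ge0_mule_fsumr //.
by rewrite -measure_fin_bigcup // [X in (_ * X)%E]PU mule1.
Qed.

End model.

(** * Separable data, and measurability of the maximized likelihood *)

(** With [n] columns forming an invertible matrix, all the margins can be given a common value [t],
    and the bound [n * ln 2] is approached as [t] grows. *)
Lemma max_loglik_saturated (R : realType) n d (M : 'M[R]_(n, d)) (f : 'I_n -> 'I_d) :
  \det (colsub f M) != 0 -> max_loglik M = n%:R * ln 2.
Proof.
move=> M0; apply/eqP; rewrite eq_le max_loglik_le /=; last exact: loglik_le_ln2.
apply/ler_addgt0Pr => e e0.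
have a0 : 0 < e / n.+1%:R by rewrite divr_gt0.
(* Then [expR (- t) = e / n.+1], which bounds the loss per row, and [n] rows lose at most [e];
   [n.+1] avoids dividing by 0. *)
pose t := - ln (e / n.+1%:R); pose u := invmx (colsub f M) *m const_mx t : 'cV[R]_n.
pose eta j := \sum_(k | f k == j) u k ord0.
have Me i : \sum_j M i j * eta j = t.
  transitivity ((colsub f M *m u) i ord0); last by rewrite mulKVmx ?unitmxE ?unitfE // mxE.
  rewrite mxE (partition_big f xpredT) //=; apply: eq_bigr => j _.
  by rewrite mulr_sumr; apply: eq_bigr => k /eqP <-; rewrite [colsub _ _ _ _]mxE.
have L : ln 2 - e / n.+1%:R <= ln (2 * sigmoid t).
  have p0 : 0 < 1 + expR (- t) by rewrite addr_gt0 ?expR_gt0.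
  rewrite /sigmoid lnM ?posrE ?invr_gt0 // lnV ?posrE // lerD2l lerN2.
  apply: le_trans (le_ln1Dx _) _; first by rewrite (lt_trans _ (expR_gt0 _)).
  by rewrite opprK lnK.
apply: le_trans (lerD (loglik_le_max M eta) (lexx e)).
have -> : loglik M eta = n%:R * ln (2 * sigmoid t).
  rewrite mulr_natl -[n in RHS]card_ord -sumr_const.
  by apply: eq_bigr => i _; rewrite Me.
have n0 : 0 <= n%:R :> R by [].
have n1 : 0 < n.+1%:R :> R by [].
have H := ler_wpM2l n0 L.
rewrite -lerBlDr; apply: le_trans H; rewrite mulrBr lerD2l lerN2 mulrA ler_pdivrMr // mulrC.
by rewrite ler_pM2l // ler_nat.
Qed.

Lemma loglik_lipschitz (R : realType) n d (M : 'M[R]_(n, d)) (eta eta' : 'I_d -> R) (e : R) :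
  (forall j, `|eta j - eta' j| <= e) ->
  loglik M eta <= loglik M eta' + (\sum_i \sum_j `|M i j|) * e.
Proof.
move=> H; rewrite /loglik mulr_suml -big_split /=; apply: ler_sum => i _.
apply: le_trans (ln_sigmoid_lipschitz _ (\sum_j M i j * eta' j)) _; rewrite lerD2l.
rewrite -sumrB mulr_suml; apply: le_trans (ler_norm_sum _ _ _) _.
by apply: ler_sum => j _; rewrite -mulrBr normrM ler_wpM2l.
Qed.

(** By Lipschitz continuity rational coefficients suffice, so that the event [max_loglik M <= x] is
    a countable intersection. *)
Lemma max_loglik_le_rat (R : realType) n d (M : 'M[R]_(n, d)) (x : R) :
  (forall q : {ffun 'I_d -> rat}, loglik M (fun j => ratr (q j)) <= x) ->
  max_loglik M <= x.
Proof.
move=> H; apply: max_loglik_le => eta; apply/ler_addgt0Pr => e e0.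
pose C := \sum_i \sum_j `|M i j|.
have C0 : 0 <= C by apply: sumr_ge0 => i _; apply: sumr_ge0.
pose a := e / (C + 1); have a0 : 0 < a by rewrite divr_gt0 // ltr_wpDl.
have rat_near j : {q : rat | `|eta j - ratr q| <= a}.
  have : eta j - a < eta j + a by lra.
  move=> /rat_in_itvoo /cid [q]; rewrite in_itv /= => /andP[q1 q2].
  by exists q; rewrite ler_norml; apply/andP; split; lra.
have Hq j : `|eta j - ratr ([ffun j => sval (rat_near j)] j)| <= a.
  by rewrite ffunE; exact: svalP (rat_near j).
apply: le_trans (loglik_lipschitz M Hq) _; apply: lerD; first exact: H.
rewrite -/C /a mulrA ler_pdivrMr ?ltr_wpDl //; nra.
Qed.

Lemma measurable_max_loglik_le (R : realType) disp (T : measurableType disp) n d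
    (A : T -> 'M[R]_(n, d)) (x : R) :
  mx_measurable A -> measurable [set w | max_loglik (A w) <= x].
Proof.
move=> mA.
have mS (q : {ffun 'I_d -> rat}) :
    measurable [set w | loglik (A w) (fun j => ratr (q j)) <= x].
  apply: measurable_set_le; apply: measurable_sum => i.
  apply: (measurableT_comp (@measurable_ln R)); apply: measurable_funM => //.
  apply: measurable_invr; apply: measurable_funD => //.
  apply: (measurableT_comp (@measurable_expR R)); apply: (measurableT_comp (@oppr_measurable R setT)).
  by apply: measurable_sum => j; apply: measurable_funM.
pose F k := if unpickle k is Some q
  then [set w | loglik (A w) (fun j => ratr ((q : {ffun 'I_d -> rat}) j)) <= x] else setT.
have -> : [set w | max_loglik (A w) <= x] = \bigcap_k F k.
  apply/seteqP; split => w /= H.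
    by move=> k _; rewrite /F; case: unpickle => // q; apply: (proj1 (max_loglik_leP _ _) H).
  by apply: max_loglik_le_rat => q; have := H (pickle q) I; rewrite /F pickleK.
by apply: bigcapT_measurable => k; rewrite /F; case: unpickle.
Qed.

(** * Deviation probabilities *)

Section real_probability.
Variables (R : realType) (disp : measure_display) (T : measurableType disp).
Variable P : probability T R.
Implicit Types A B : set T.

(** The real number that occurs in [dKS], convenient for linear arithmetic. *)
Definition pr A : R := fine (P A).

Lemma prE A : measurable A -> P A = (pr A)%:E.
Proof. by move=> mA; rewrite /pr fineK // fin_num_measure. Qed.

Lemma pr_ge0 A : 0 <= pr A.
Proof. exact: fine_ge0. Qed.

Lemma pr_le A B : measurable A -> measurable B -> A `<=` B -> pr A <= pr B.
Proof.
move=> mA mB AB; rewrite -lee_fin -!prE //.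
by apply: le_measure => //; rewrite inE.
Qed.

Lemma pr_setU A B : measurable A -> measurable B -> pr (A `|` B) <= pr A + pr B.
Proof.
move=> mA mB; rewrite -lee_fin EFinD -!prE //; last exact: measurableU.
exact: measureU2.
Qed.

Lemma pr_setC A : measurable A -> pr (~` A) = 1 - pr A.
Proof.
move=> mA; apply: EFin_inj; rewrite EFinB -!prE //; last exact: measurableC.
exact: probability_setC.
Qed.

Lemma pr_le1 A : measurable A -> pr A <= 1.
Proof. by move=> mA; rewrite -lee_fin -prE // probability_le1. Qed.

Lemma pr_le_add A B C : measurable A -> measurable B -> measurable C ->
  A `<=` B `|` C -> pr A <= pr B + pr C.
Proof.
move=> mA mB mC ABC; apply: le_trans (pr_setU mB mC).
by apply: pr_le => //; exact: measurableU.
Qed.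

Lemma pr_le_markov (f : T -> R) (a e : R) : measurable_fun setT f ->
  (forall w, 0 <= f w) -> 0 < a -> (\int[P]_w (f w)%:E <= e%:E)%E ->
  pr [set w | a <= f w] <= e / a.
Proof.
move=> mf f0 a0 fe; rewrite -lee_fin -prE; first exact: markov_real.
rewrite -[X in measurable X]setTI; rewrite (_ : [set w | _] = f @^-1` `[a, +oo[%classic).
  exact: mf.
by apply/seteqP; split => w /=; rewrite in_itv /= andbT.
Qed.

End real_probability.

Lemma measurable_set_ge (R : realType) disp (T : measurableType disp) (f : T -> R) (x : R) :
  measurable_fun setT f -> measurable [set w | x <= f w].
Proof.
move=> mf; have := measurable_set_le (- x) (measurableT_comp (@oppr_measurable R setT) mf).
by congr measurable; apply/seteqP; split => w /=; rewrite lerN2.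
Qed.

Lemma measurable_set_le_itv (R : realType) disp (T : measurableType disp) (f : T -> R) (x y : R) :
  measurable_fun setT f -> measurable [set w | x < f w <= y].
Proof.
move=> mf; rewrite (_ : [set w | _] = [set w | f w <= y] `\` [set w | f w <= x]).
  by apply: measurableD; exact: measurable_set_le.
apply/seteqP; split => w /=.
  by move=> /andP[xf ->]; split => //; apply/negP; rewrite -ltNge.
by move=> [-> /negP]; rewrite -ltNge => ->.
Qed.

(** * The law of the score *)

Section row_score.
Variables (R : realType) (n d : nat).
Variables (disp : measure_display) (T : measurableType disp) (P : probability T R).
Variable Z : T -> 'M[R]_(n, d).
Hypothesis GZ : iid_normal P (Z : T -> mx_space R n d).
Hypothesis n0 : (0 < n)%N.

(** After the rotation of 1 to an axis, the score is the squared norm of one row of normal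
    entries. *)
Lemma score_iid_row : exists Z1 : T -> 'M[R]_(1, d),
  iid_normal P (Z1 : T -> mx_space R 1 d) /\
  forall w, score (Z w) = \sum_j Z1 w ord0 j ^+ 2.
Proof.
pose i0 := Ordinal n0; have [ O [OO Oi OZ]] := @exists_mean_rotation R n i0.
exists (fun w => mxsub (fun=> i0) id (O *m Z w)); split.
  apply: (@iid_normal_sub _ _ _ 1 _ _ _ _ (fun w => O *m Z w) (fun=> i0) id) => //.
    by move=> i j _; rewrite (ord1 i) (ord1 j).
  exact: OZ.
by move=> w; rewrite (score_rotate Oi); apply: eq_bigr => j _; rewrite [mxsub _ _ _ _ _]mxE.
Qed.

Lemma score_chi_square disp' (T' : measurableType disp') (Q : probability T' R)
    (V : T' -> R) (x : R) : chi_square Q d V ->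
  Q [set v | V v <= x] = P [set w | score (Z w) <= x].
Proof.
have [Z1 [GZ1 E]] := score_iid_row => QV.
have H := chi_square_law GZ1 QV (measurable_itv `]-oo, x]).
transitivity (Q (V @^-1` `]-oo, x]%classic)).
  by congr (Q _); apply/seteqP; split => v /=; rewrite in_itv.
rewrite H; congr (P _); apply/seteqP; split => v /=; rewrite in_itv /= E //.
Qed.

Lemma score_variance : (0 < d)%N ->
  (\int[P]_w ((score (Z w) - d%:R) ^+ 2)%:E = (2 * d%:R)%:E)%E.
Proof.
move=> d0; have [Z1 [GZ1 E]] := score_iid_row.
have mS : measurable_fun setT (fun w => score (Z w)) := measurable_score (iid_mx_measurable GZ).
have S0 w : 0 <= score (Z w) by rewrite E sumr_ge0 // => j _; exact: sqr_ge0.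
have ES w : score (Z w) = sum_sqr (Z1 w) by rewrite E /sum_sqr big_ord1.
have I1 : (\int[P]_w (score (Z w))%:E = d%:R%:E)%E.
  by under eq_integral do rewrite ES; rewrite integral_sum_sqr // mul1n.
have I2 : (\int[P]_w (score (Z w) ^+ 2)%:E = (d%:R * (d%:R + 2))%:E)%E.
  by under eq_integral do rewrite ES; rewrite integral_sum_sqr_sqr // mul1n.
have mV : measurable_fun setT (fun w => (score (Z w) - d%:R) ^+ 2).
  by apply: measurable_funX; apply: measurable_funB.
have m2 : measurable_fun setT (fun w => score (Z w) ^+ 2) by exact: measurable_funX.
have mk : measurable_fun setT (fun w => 2 * d%:R * score (Z w)) by exact: measurable_funM.
have k0 : 0 <= 2 * d%:R :> R by rewrite mulr_ge0.
(* The expansion of the square with the cross term moved to the left, where every integrand is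
   nonnegative. *)
have := integral_addr P mV mk (fun w => sqr_ge0 _) (fun w => mulr_ge0 k0 (S0 w)).
have -> : (fun w => ((score (Z w) - d%:R) ^+ 2 + 2 * d%:R * score (Z w))%:E) =
          (fun w => (score (Z w) ^+ 2 + d%:R ^+ 2)%:E).
  by apply/funext => w; congr EFin; ring.
rewrite (integral_addr P m2 (measurable_cst _) (fun w => sqr_ge0 _) (fun w => sqr_ge0 _)).
rewrite integral_cstr I2 (integral_mulr P k0 mS S0) I1.
case: (\int[P]_w ((score (Z w) - d%:R) ^+ 2)%:E)%E => //= r [] H.
by congr EFin; lra.
Qed.

Lemma score_anticoncentration (x eps : R) : 0 < eps -> (0 < d)%N ->
  pr P [set w | x < score (Z w) <= x + eps * Num.sqrt d%:R] ^+ 2 <= 5 * Num.sqrt eps.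
Proof.
move=> e0 d0; have [Z1 [GZ1 E]] := score_iid_row.
have mS : measurable_fun setT (fun w => score (Z w)) := measurable_score (iid_mx_measurable GZ).
have := sum_sqr_anticoncentration GZ1 x e0 d0.
have -> : [set w | x < \sum_j Z1 w ord0 j ^+ 2 <= x + eps * Num.sqrt d%:R] =
          [set w | x < score (Z w) <= x + eps * Num.sqrt d%:R].
  by apply/seteqP; split => w /=; rewrite E.
by rewrite prE ?lee_fin //; exact: measurable_set_le_itv.
Qed.

End row_score.

Section deviation.
Variables (R : realType) (n d : nat).
Variables (disp : measure_display) (T : measurableType disp) (P : probability T R).
Variable Z : T -> 'M[R]_(n, d).
Hypothesis GZ : iid_normal P (Z : T -> mx_space R n d).
Hypotheses (d0 : (0 < d)%N) (dn : (d <= n)%N).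
Notation s := (Num.sqrt d%:R : R).

Let mZ := iid_mx_measurable GZ.
Let n0 : (0 < n)%N := leq_trans d0 dn.
Let np : 0 < n%:R :> R. Proof. by rewrite ltr0n. Qed.
Let dp : 0 < d%:R :> R. Proof. by rewrite ltr0n. Qed.
Let sp : 0 < s. Proof. by rewrite sqrtr_gt0. Qed.
Let s2 : s ^+ 2 = d%:R. Proof. by rewrite sqr_sqrtr // ltW. Qed.

Let mT : measurable_fun setT (fun w => hotelling (Z w)) := measurable_hotelling mZ.
Let mW : measurable_fun setT (fun w => score (Z w)) := measurable_score mZ.
Let mG : measurable [set w | gram_det (Z w) = 0].
Proof. by apply: measurable_set_eq0; exact: measurable_gram_det. Qed.
Let mfr : measurable_fun setT (fun w => full_rank (Z w)).
Proof.
apply: measurable_funM; first exact: measurable_gram_det.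
by apply: measurable_invr; exact: measurable_gram_det.
Qed.

Lemma pr_gram_det_eq0 : pr P [set w | gram_det (Z w) = 0] = 0.
Proof. by rewrite /pr iid_normal_gram_det_neq0. Qed.

Lemma pr_chebyshev (f : T -> R) (a e : R) : measurable_fun setT f -> 0 < a ->
  (\int[P]_w (f w ^+ 2)%:E <= e%:E)%E ->
  pr P [set w | a * s <= `|f w|] <= e / (a ^+ 2 * d%:R).
Proof.
move=> mf a0 fe; have := @pr_le_markov _ _ _ P (fun w => f w ^+ 2) (a ^+ 2 * d%:R) e.
rewrite (_ : [set w | a ^+ 2 * d%:R <= f w ^+ 2] = [set w | a * s <= `|f w|]).
  apply => //; first exact: measurable_funX.
  - by move=> w; exact: sqr_ge0.
  - by rewrite mulr_gt0 // exprn_gt0.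
have as0 : 0 <= a * s by rewrite mulr_ge0 // ltW.
have E w : (a ^+ 2 * d%:R <= f w ^+ 2) = (a * s <= `|f w|).
  have -> : a ^+ 2 * d%:R = (a * s) ^+ 2 by rewrite exprMn s2.
  by rewrite -[f w ^+ 2]real_normK ?num_real // ler_pXn2r.
by apply/seteqP; split => w /=; rewrite E.
Qed.

(** For [d <= n] the factor [full_rank] is almost surely 1, so it drops out of the event. *)
Let pr_chebyshev_full_rank (f : T -> R) (a e : R) : measurable_fun setT f -> 0 < a ->
  (\int[P]_w (full_rank (Z w) * f w ^+ 2)%:E <= e%:E)%E ->
  pr P [set w | a * s <= `|f w|] <= e / (a ^+ 2 * d%:R).
Proof.
move=> mf a0 fe; pose g w := full_rank (Z w) * f w.
have mg : measurable_fun setT g by exact: measurable_funM.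
have ge : (\int[P]_w (g w ^+ 2)%:E <= e%:E)%E.
  under eq_integral => w _.
    rewrite (_ : g w ^+ 2 = full_rank (Z w) * f w ^+ 2); first over.
    by rewrite /g exprMn full_rankE; case: eqP => _ /=; rewrite ?expr1n ?expr0n.
  exact: fe.
apply: le_trans (pr_chebyshev mg a0 ge).
rewrite -[leRHS]add0r -pr_gram_det_eq0.
have mge (h : T -> R) : measurable_fun setT h -> measurable [set w | a * s <= `|h w|].
  by move=> mh; apply: measurable_set_ge; exact: (measurableT_comp (@normr_measurable R setT)).
apply: pr_le_add => //; [exact: mge|exact: mge|move=> w /= H].
have [->|M0] := eqVneq (gram_det (Z w)) 0; [by left|right].
by rewrite /g full_rankE M0 mul1r.
Qed.

Lemma pr_hotelling_deviation (a : R) : 0 < a ->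
  pr P [set w | a * s <= `|hotelling (Z w) - d%:R|] <= 2 / a ^+ 2.
Proof.
move=> a0; have mf : measurable_fun setT (fun w => hotelling (Z w) - d%:R) by exact: measurable_funB.
apply: le_trans (pr_chebyshev_full_rank mf a0 (integral_hotelling_variance GZ)) _.
by rewrite invfM mulrACA divff ?gt_eqF // mulr1.
Qed.

Lemma pr_hotelling_sub_score (a : R) : 0 < a ->
  pr P [set w | a * s <= `|hotelling (Z w) - score (Z w)|] <= 6 * d%:R / (n%:R * a ^+ 2).
Proof.
move=> a0; have mf : measurable_fun setT (fun w => hotelling (Z w) - score (Z w)) by exact: measurable_funB.
apply: le_trans (pr_chebyshev_full_rank mf a0 (integral_hotelling_sub_score GZ n0)) _.
have -> : 2 * d%:R * (d%:R + 2) / n%:R / (a ^+ 2 * d%:R) = 2 * (d%:R + 2) / (n%:R * a ^+ 2) :> R.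
  by field; rewrite !gt_eqF.
rewrite ler_pM2r ?invr_gt0 ?mulr_gt0 ?exprn_gt0 //.
have : 1 <= d%:R :> R by rewrite ler1n.
lra.
Qed.

Lemma pr_score_deviation (a : R) : 0 < a ->
  pr P [set w | a * s <= `|score (Z w) - d%:R|] <= 2 / a ^+ 2.
Proof.
move=> a0; have mf : measurable_fun setT (fun w => score (Z w) - d%:R) by exact: measurable_funB.
have H : (\int[P]_w ((score (Z w) - d%:R) ^+ 2)%:E <= (2 * d%:R)%:E)%E by rewrite score_variance.
apply: le_trans (pr_chebyshev mf a0 H) _.
by rewrite invfM mulrACA divff ?gt_eqF // mulr1.
Qed.

Lemma pr_hat_fit_4 (a : R) : 0 < a ->
  pr P [set w | a * s <= 2 / 3 * \sum_i hat_fit (Z w) i ^+ 4] <= 6 * (d%:R * s / n%:R) / a.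
Proof.
move=> a0; have as0 : 0 < 3 / 2 * (a * s) by rewrite mulr_gt0 // mulr_gt0.
have mf : measurable_fun setT (fun w => \sum_i hat_fit (Z w) i ^+ 4).
  by apply: measurable_sum => i; apply: measurable_funX; exact: measurable_hat_fit.
have f0 w : 0 <= \sum_i hat_fit (Z w) i ^+ 4.
  by apply: sumr_ge0 => i _; rewrite (exprM _ 2 2) sqr_ge0.
have := pr_le_markov mf f0 as0 (integral_hat_fit_4 GZ n0).
rewrite (_ : [set w | 3 / 2 * (a * s) <= \sum_i hat_fit (Z w) i ^+ 4] =
  [set w | a * s <= 2 / 3 * \sum_i hat_fit (Z w) i ^+ 4]); last first.
  by apply/seteqP; split => w /=; lra.
move=> /le_trans; apply.
have -> : 6 * (d%:R * s / n%:R) / a = 3 * (3 * d%:R ^+ 2) / n%:R / (3 / 2 * (a * s)) :> R.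
  have E (t q N b : R) : t != 0 -> N != 0 -> b != 0 -> q = t ^+ 2 ->
      6 * (q * t / N) / b = 3 * (3 * q ^+ 2) / N / (3 / 2 * (b * t)).
    by move=> t0 N0 b0 ->; field; rewrite t0 N0 b0.
  by apply: E; rewrite ?gt_eqF.
rewrite ler_pM2r ?invr_gt0 // ler_pM2r ?invr_gt0 //.
have : 1 <= d%:R :> R by rewrite ler1n.
nra.
Qed.

Lemma measurable_hat_fit_ge1 : measurable [set w | exists i, 1 <= `|hat_fit (Z w) i|].
Proof.
rewrite (_ : [set w | _] = \bigcup_(i in [set` [set: 'I_n]%SET]) [set w | 1 <= `|hat_fit (Z w) i|]).
  apply: fin_bigcup_measurable => // i _; apply: measurable_set_ge.
  by apply: (measurableT_comp (@normr_measurable R setT)); exact: measurable_hat_fit.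
apply/seteqP; split => w /= [i]; first by move=> H; exists i => //; rewrite /= inE.
by move=> _ H; exists i.
Qed.

(** Markov's inequality for the sum of sixth powers; fourth powers would only give a multiple of d^2
    / n, which may be large although rho is small. *)
Lemma pr_hat_fit_ge1 :
  pr P [set w | exists i, 1 <= `|hat_fit (Z w) i|] <= 225 * (d%:R * s / n%:R) ^+ 2.
Proof.
have mf : measurable_fun setT (fun w => \sum_i hat_fit (Z w) i ^+ 6).
  by apply: measurable_sum => i; apply: measurable_funX; exact: measurable_hat_fit.
have p0 w i : 0 <= hat_fit (Z w) i ^+ 6 by rewrite (exprM _ 3 2) sqr_ge0.
have f0 w : 0 <= \sum_i hat_fit (Z w) i ^+ 6 by apply: sumr_ge0 => i _.
have := pr_le_markov mf f0 ltr01 (integral_hat_fit_6 GZ n0).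
have -> : 225 * d%:R ^+ 3 / n%:R ^+ 2 / 1 = 225 * (d%:R * s / n%:R) ^+ 2 :> R.
  have E (t q N : R) : N != 0 -> q = t ^+ 2 ->
      225 * q ^+ 3 / N ^+ 2 / 1 = 225 * (q * t / N) ^+ 2.
    by move=> N0 ->; field.
  by apply: E; rewrite ?gt_eqF.
apply: le_trans; apply: pr_le; [exact: measurable_hat_fit_ge1|exact: measurable_set_ge|].
move=> w /= [i Hi]; rewrite (bigD1 i) //=.
rewrite -[1]addr0; apply: lerD; last by apply: sumr_ge0 => k _.
by rewrite -[hat_fit _ _ ^+ 6]ger0_norm // normrX; exact: exprn_ege1.
Qed.

End deviation.

(** * Comparison of distribution functions *)

Section comparison.
Variables (R : realType) (n d : nat).
Variables (disp : measure_display) (T : measurableType disp) (P : probability T R).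
Variable Z : T -> 'M[R]_(n, d).
Hypothesis GZ : iid_normal P (Z : T -> mx_space R n d).
Hypotheses (n0 : (0 < n)%N) (d0 : (0 < d)%N).
Notation s := (Num.sqrt d%:R : R).
Notation rho := (d%:R * s / n%:R : R).

Let mZ := iid_mx_measurable GZ.
Let np : 0 < n%:R :> R. Proof. by rewrite ltr0n. Qed.
Let dp : 0 < d%:R :> R. Proof. by rewrite ltr0n. Qed.
Let d1 : 1 <= d%:R :> R. Proof. by rewrite ler1n. Qed.
Let sp : 0 < s. Proof. by rewrite sqrtr_gt0. Qed.
Let s2 : s ^+ 2 = d%:R. Proof. by rewrite sqr_sqrtr // ltW. Qed.
Let s1 : 1 <= s. Proof. by rewrite -[leLHS]sqrtr1 ler_sqrt. Qed.
Let rho_ge : d%:R / n%:R <= rho.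
Proof. by rewrite ler_pM2r ?invr_gt0 // ler_peMr // ltW. Qed.

Let mT : measurable_fun setT (fun w => hotelling (Z w)) := measurable_hotelling mZ.
Let mW : measurable_fun setT (fun w => score (Z w)) := measurable_score mZ.
Let mG : measurable [set w | gram_det (Z w) = 0].
Proof. by apply: measurable_set_eq0; exact: measurable_gram_det. Qed.
Let mTW a : measurable [set w | a * s <= `|hotelling (Z w) - score (Z w)|].
Proof.
apply: measurable_set_ge; apply: (measurableT_comp (@normr_measurable R setT)).
exact: measurable_funB.
Qed.
Let mTd a : measurable [set w | a * s <= `|hotelling (Z w) - d%:R|].
Proof.
apply: measurable_set_ge; apply: (measurableT_comp (@normr_measurable R setT)).
exact: measurable_funB.
Qed.
Let mWd a : measurable [set w | a * s <= `|score (Z w) - d%:R|].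
Proof.
apply: measurable_set_ge; apply: (measurableT_comp (@normr_measurable R setT)).
exact: measurable_funB.
Qed.
Let mp4 a : measurable [set w | a * s <= 2 / 3 * \sum_i hat_fit (Z w) i ^+ 4].
Proof.
apply: measurable_set_ge; apply: measurable_funM => //.
by apply: measurable_sum => i; apply: measurable_funX; exact: measurable_hat_fit.
Qed.
Let mWx x : measurable [set w | score (Z w) <= x].
Proof. exact: measurable_set_le. Qed.

Lemma measurable_max_loglik2_le x : measurable [set w | 2 * max_loglik (Z w) <= x].
Proof.
have := measurable_max_loglik_le (2^-1 * x) mZ.
by congr measurable; apply/seteqP; split => w /=; rewrite ler_pdivlMl.
Qed.
Let mLx := measurable_max_loglik2_le.

Notation F x := (pr P [set w | 2 * max_loglik (Z w) <= x]).
Notation G x := (pr P [set w | score (Z w) <= x]).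

(** Off the event [B], [2 * max_loglik] and the score differ by less than [eps * s], so they lie on
    different sides of [x] only if the score is in the window [A] around [x]. The square root undoes
    the squared probability of the anticoncentration bound. *)
Lemma cdf_upper_bound (x eps : R) : (d <= n)%N -> 0 < eps ->
  `|F x - G x| <= 24 * rho / eps ^+ 2 + 12 * rho / eps + 225 * rho ^+ 2
    + Num.sqrt (5 * Num.sqrt (2 * eps)).
Proof.
(* Half of the tolerance is for [hotelling - score], half for the quartic term. *)
move=> dn e0; pose a := eps / 2; have a0 : 0 < a by rewrite divr_gt0.
pose B1 := [set w | gram_det (Z w) = 0].
pose B2 := [set w | a * s <= `|hotelling (Z w) - score (Z w)|].
pose B3 := [set w | a * s <= 2 / 3 * \sum_i hat_fit (Z w) i ^+ 4].
pose B4 := [set w | exists i, 1 <= `|hat_fit (Z w) i|].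
pose B := B1 `|` B2 `|` B3 `|` B4.
pose A := [set w | x - eps * s < score (Z w) <= x - eps * s + 2 * eps * s].
have mB4 : measurable B4 := measurable_hat_fit_ge1 GZ.
have mA : measurable A by exact: measurable_set_le_itv.
have mB12 : measurable (B1 `|` B2) by apply: measurableU => //; exact: mTW.
have mB123 : measurable (B1 `|` B2 `|` B3) by apply: measurableU => //; exact: mp4.
have mB : measurable B by exact: measurableU.
have good w : ~ B w -> `|2 * max_loglik (Z w) - score (Z w)| < eps * s.
  move=> nB.
  have M0 : gram_det (Z w) != 0 by apply/eqP => H; apply: nB; left; left; left.
  have H2 : `|hotelling (Z w) - score (Z w)| < a * s.
    by rewrite ltNge; apply/negP => H; apply: nB; left; left; right.
  have H3 : 2 / 3 * \sum_i hat_fit (Z w) i ^+ 4 < a * s.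
    by rewrite ltNge; apply/negP => H; apply: nB; left; right.
  have H4 i : `|hat_fit (Z w) i| < 1.
    by rewrite ltNge; apply/negP => H; apply: nB; right; exists i.
  have U := max_loglik_le_hotelling M0 H4.
  have L := max_loglik_ge M0 n0.
  have q0 : 0 <= hotelling (Z w) ^+ 2 / (36 * n%:R).
    by rewrite divr_ge0 ?sqr_ge0 // mulr_ge0 // ltW.
  have -> : eps * s = a * s + a * s by rewrite /a; lra.
  move: H2; rewrite !ltr_norml => /andP[H21 H22]; apply/andP; split; lra.
have PB : pr P B <= 24 * rho / eps ^+ 2 + 12 * rho / eps + 225 * rho ^+ 2.
  have b2 : pr P B2 <= 24 * rho / eps ^+ 2.
    apply: le_trans (pr_hotelling_sub_score GZ d0 dn a0) _.
    have -> : 6 * d%:R / (n%:R * a ^+ 2) = 24 * (d%:R / n%:R) / eps ^+ 2 :> R.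
      by rewrite /a; field; rewrite !gt_eqF.
    by rewrite ler_pM2r ?invr_gt0 ?exprn_gt0 // ler_pM2l.
  have b3 : pr P B3 <= 12 * rho / eps.
    apply: le_trans (pr_hat_fit_4 GZ d0 dn a0) _.
    by rewrite /a invf_div mulrACA mulrA; lra.
  have b4 : pr P B4 <= 225 * rho ^+ 2 by exact: pr_hat_fit_ge1.
  have := pr_setU P mB123 mB4; have := pr_setU P mB12 (mp4 a); have := pr_setU P mG (mTW a).
  rewrite (pr_gram_det_eq0 GZ dn) -/B2 -/B3 -/B; lra.
have PA : pr P A <= Num.sqrt (5 * Num.sqrt (2 * eps)).
  have e20 : 0 < 2 * eps by rewrite mulr_gt0.
  have := score_anticoncentration GZ n0 (x - eps * s) e20 d0.
  rewrite -/A => H; rewrite -[leLHS]ger0_norm ?pr_ge0 // -sqrtr_sqr; exact: ler_wsqrtr.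
have mBA : measurable (B `|` A) by exact: measurableU.
have PBA := pr_setU P mB mA.
have H1 : F x <= G x + pr P (B `|` A).
  apply: pr_le_add => // w /= H; have [Bw|nB] := pselect (B w); first by right; left.
  have := good w nB; rewrite ltr_norml => /andP[g1 g2].
  have [?|?] := leP (score (Z w)) x; first by left.
  by right; right; apply/andP; split; rewrite -?mulrA; lra.
have H2 : G x <= F x + pr P (B `|` A).
  apply: pr_le_add => // w /= H; have [Bw|nB] := pselect (B w); first by right; left.
  have := good w nB; rewrite ltr_norml => /andP[g1 g2].
  have [?|?] := leP (2 * max_loglik (Z w)) x; first by left.
  by right; right; apply/andP; split; rewrite -?mulrA; lra.
rewrite ler_norml; apply/andP; split; lra.
Qed.

Lemma max_loglik_ge_rho (M : 'M[R]_(n, d)) : gram_det M != 0 ->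
  d%:R / 2 <= hotelling M -> hotelling M + rho * s / 144 <= 2 * max_loglik M.
Proof.
move=> M0 HT; apply: le_trans (max_loglik_ge M0 n0); rewrite lerD2l.
have -> : rho * s / 144 = (d%:R / 2) ^+ 2 / (36 * n%:R).
  have E (t q N : R) : N != 0 -> q = t ^+ 2 -> q * t / N * t / 144 = (q / 2) ^+ 2 / (36 * N).
    by move=> N0 ->; field.
  by apply: E; rewrite ?gt_eqF.
rewrite ler_pM2r ?invr_gt0 ?mulr_gt0 // ler_pXn2r // nnegrE.
  by rewrite divr_ge0 // ltW.
exact: hotelling_ge0.
Qed.

Lemma cdf_score_ge : (d <= n)%N -> 7 / 8 <= G (d%:R + 4 * s).
Proof.
move=> dn; have h4 : 0 < 4 :> R by [].
have H := pr_score_deviation GZ d0 dn h4.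
have : 1 - G (d%:R + 4 * s) <= 2 / 4 ^+ 2.
  rewrite -pr_setC //; apply: le_trans H; apply: pr_le => //; first exact: measurableC.
  by move=> w /= /negP; rewrite -ltNge => Hw; rewrite ler_normr; apply/orP; left; lra.
lra.
Qed.

Lemma cdf_score_le : (d <= n)%N -> G (d%:R - 4 * s) <= 1 / 8.
Proof.
move=> dn; have h4 : 0 < 4 :> R by [].
have H := pr_score_deviation GZ d0 dn h4.
have : G (d%:R - 4 * s) <= 2 / 4 ^+ 2.
  apply: le_trans H; apply: pr_le => //.
  by move=> w /= Hw; rewrite ler_normr; apply/orP; right; lra.
lra.
Qed.

(** The maximum being almost surely constant, [F] jumps from 0 to 1 across a short interval on which
    [G] grows by at most 1/2; one of its ends shows a gap of at least 1/4. *)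
Lemma cdf_lower_bound_saturated : (n <= d)%N -> exists x, 1 / 4 <= `|F x - G x|.
Proof.
move=> nd; pose f := widen_ord nd; pose x := 2 * (n%:R * ln 2) : R.
have finj : injective f by move=> i j /(congr1 val) /= ij; exact: val_inj.
have GZ' := @iid_normal_sub _ _ _ _ _ _ _ _ Z id f (@inj_id _) finj GZ.
pose B := [set w | \det (colsub f (Z w)) = 0].
have mB : measurable B.
  by apply: measurable_set_eq0; apply: measurable_det; exact: (iid_mx_measurable GZ').
have PB : pr P B = 0 by rewrite /pr (iid_normal_det_neq0 GZ').
have LE w : ~ B w -> 2 * max_loglik (Z w) = x.
  by move=> Bw; rewrite (@max_loglik_saturated _ _ _ _ f) //; apply/eqP.
have F1 : 1 <= F x.
  rewrite -[leLHS]subr0 -[X in _ - X <= _]PB -pr_setC //; apply: pr_le => //; first exact: measurableC.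
  by move=> w /= Bw; rewrite LE.
(* Then [5 * sqrt e = 1 / 4] bounds the squared probability of the interval, which is therefore at
   most 1/2. *)
pose e : R := 1 / 400; have e0 : 0 < e by rewrite /e; lra.
pose x0 := x - e * s.
have F0 : F x0 <= 0.
  rewrite -[leRHS]PB; apply: pr_le => // w /= H; apply: contrapT => Bw.
  by move: H; rewrite LE // /x0 lerBrDl gerDr leNgt mulr_gt0.
have sqe : Num.sqrt e = 1 / 20.
  by rewrite (_ : e = (1 / 20) ^+ 2) ?sqrtr_sqr ?ger0_norm //; rewrite /e; lra.
have GG : G x <= G x0 + 1 / 2.
  have mA : measurable [set w | x0 < score (Z w) <= x0 + e * s] by exact: measurable_set_le_itv.
  have := score_anticoncentration GZ n0 x0 e0 d0; rewrite sqe.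
  have := pr_ge0 P [set w | x0 < score (Z w) <= x0 + e * s].
  have : G x <= G x0 + pr P [set w | x0 < score (Z w) <= x0 + e * s].
    apply: pr_le_add => // w /= H; have [?|?] := leP (score (Z w)) x0; first by left.
    by right; apply/andP; split => //; rewrite /x0 subrK.
  nra.
have [H|H] := leP (3 / 4) (G x).
  exists x0; rewrite ler_normr; apply/orP; right; lra.
exists x; rewrite ler_normr; apply/orP; left; lra.
Qed.

(** As 1152 = 8 * 144, the shift is at least [8 * s] and carries the lower deviation [d - 4 * s] of
    [hotelling] beyond the upper deviation [d + 4 * s] of the score. Also [rho <= s], so [d] is at
    least [1152 * s] and [hotelling] exceeds [d / 2]. *)
Lemma cdf_lower_bound_large : (d <= n)%N -> 1152 <= rho -> exists x, 3 / 4 <= `|F x - G x|.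
Proof.
move=> dn rK; exists (d%:R + 4 * s).
have rs : rho <= s.
  by rewrite ler_pdivrMr // mulrC ler_pM2l // ler_nat.
have h4 : 0 < 4 :> R by [].
have HT := pr_hotelling_deviation GZ d0 dn h4.
have sd : 1152 * s <= d%:R.
  have := ler_wpM2r (ltW sp) (le_trans rK rs).
  by rewrite -[X in _ <= X -> _]expr2 s2.
have : F (d%:R + 4 * s) <= 0 + 2 / 4 ^+ 2.
  apply: le_trans (lerD (lexx _) HT); rewrite -(pr_gram_det_eq0 GZ dn).
  apply: pr_le_add => // w /= H; apply: contrapT => /not_orP[/eqP M0 /negP].
  rewrite -ltNge ltr_norml => /andP[T1 T2].
  have /(max_loglik_ge_rho M0) : d%:R / 2 <= hotelling (Z w) by lra.
  have : 1152 * s <= rho * s by rewrite ler_pM2r.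
  lra.
have := cdf_score_ge dn => ? ?; rewrite ler_normr; apply/orP; right; lra.
Qed.

(* If all the differences were smaller, the distribution function of the score
   would grow by less than [1 / (2 * m)] over each of the [m] steps of length
   [delta * s] that cover the interval of radius [4 * s] around its mean. *)
Lemma cdf_lower_bound (delta : R) (m : nat) : (d <= n)%N -> 0 < delta -> 288 * delta <= rho ->
  8 / delta <= m%:R ->
  exists x, 1 / (2 * m%:R) - (8 / d%:R + 6 * d%:R / (n%:R * delta ^+ 2)) <= `|F x - G x|.
Proof.
move=> dn dl0 dlr dlm; set fail := 8 / d%:R + _.
have m0 : 0 < m%:R :> R by apply: lt_le_trans dlm; rewrite divr_gt0.
(* The shift [rho * s / 144] is at least [2 * delta * s]: one half absorbs the deviation of
   [hotelling] from the score, the other is the step of the argument. *)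
have step x : F (x + delta * s) <= G x + fail.
  (* This deviation, [s / 2 * s = d / 2], is what [max_loglik_ge_rho] needs. *)
  have h0 : 0 < s / 2 by rewrite divr_gt0.
  have HT := pr_hotelling_deviation GZ d0 dn h0.
  have HW := pr_hotelling_sub_score GZ d0 dn dl0.
  have E : 2 / (s / 2) ^+ 2 = 8 / d%:R :> R.
    by rewrite expr_div_n s2; field; rewrite gt_eqF.
  rewrite E in HT.
  pose B2 := [set w | delta * s <= `|hotelling (Z w) - score (Z w)|].
  pose B5 := [set w | s / 2 * s <= `|hotelling (Z w) - d%:R|].
  pose B1 := [set w | gram_det (Z w) = 0].
  have mB25 : measurable (B2 `|` B5) by apply: measurableU; [exact: mTW|exact: mTd].
  have mB : measurable (B1 `|` (B2 `|` B5)) by exact: measurableU.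
  have := pr_setU P mG mB25; have := pr_setU P (mTW delta) (mTd (s / 2)).
  rewrite (pr_gram_det_eq0 GZ dn) -/B1 -/B2 -/B5 => b1 b2.
  have : F (x + delta * s) <= G x + pr P (B1 `|` (B2 `|` B5)).
    apply: pr_le_add => // w /= H; have [?|xW] := leP (score (Z w)) x; [by left|right].
    apply: contrapT => /not_orP[/eqP M0 /not_orP[/negP]].
    rewrite -ltNge ltr_norml => /andP[W1 W2] /negP.
    rewrite -ltNge ltr_norml mulrAC -expr2 s2 => /andP[T1 T2].
    have /(max_loglik_ge_rho M0) : d%:R / 2 <= hotelling (Z w) by lra.
    have : 288 * delta * s <= rho * s by rewrite ler_pM2r.
    lra.
  rewrite /fail; lra.
apply: contrapT => /forallNP H.
have {}H x : `|F x - G x| < 1 / (2 * m%:R) - fail by rewrite ltNge; apply/negP.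
pose x0 := d%:R - 4 * s.
have K k : G (x0 + k%:R * (delta * s)) <= G x0 + k%:R / (2 * m%:R).
  elim: k => [|k IH]; first by rewrite mul0r !addr0 mul0r addr0.
  have := step (x0 + k%:R * (delta * s)).
  have := H (x0 + k.+1%:R * (delta * s)).
  have -> : x0 + k.+1%:R * (delta * s) = x0 + k%:R * (delta * s) + delta * s.
    by rewrite -natr1; ring.
  have -> : k.+1%:R / (2 * m%:R) = k%:R / (2 * m%:R) + 1 / (2 * m%:R) :> R.
    by rewrite -natr1 mulrDl.
  rewrite ltr_norml => /andP[H1 _] H2; lra.
have := K m; have := cdf_score_le dn; have := cdf_score_ge dn; rewrite -/x0.
have -> : m%:R / (2 * m%:R) = 1 / 2 :> R by field; rewrite gt_eqF.
have : G (d%:R + 4 * s) <= G (x0 + m%:R * (delta * s)).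
  apply: pr_le => // w /= Hw; apply: le_trans Hw _.
  have : 8 * s <= m%:R * (delta * s).
    by rewrite mulrA ler_pM2r // -ler_pdivrMr.
  by rewrite /x0; lra.
lra.
Qed.

End comparison.

(** * Kolmogorov-Smirnov distance *)

Section dKS_bounds.
Variables (R : realType) (disp disp' : measure_display).
Variables (T : measurableType disp) (T' : measurableType disp').
Variables (P : probability T R) (Q : probability T' R) (U : T -> R) (V : T' -> R).
Hypothesis mU : forall x, measurable [set w | U w <= x].
Hypothesis mV : forall x, measurable [set w | V w <= x].

Let dKS_ub x : `|pr P [set w | U w <= x] - pr Q [set w | V w <= x]| <= 1.
Proof.
have := pr_ge0 P [set w | U w <= x]; have := pr_ge0 Q [set w | V w <= x].
have := pr_le1 P (mU x); have := pr_le1 Q (mV x).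
by rewrite ler_norml => ? ? ? ?; apply/andP; split; lra.
Qed.

Lemma dKS_ge x : `|pr P [set w | U w <= x] - pr Q [set w | V w <= x]| <= dKS P Q U V.
Proof.
apply: sup_upper_bound; last by exists x.
split; first by exists `|pr P [set w | U w <= 0] - pr Q [set w | V w <= 0]|, 0.
by exists 1 => _ [y _ <-]; exact: dKS_ub.
Qed.

Lemma dKS_ge0 : 0 <= dKS P Q U V.
Proof. exact: le_trans (normr_ge0 _) (dKS_ge 0). Qed.

Lemma dKS_le b :
  (forall x, `|pr P [set w | U w <= x] - pr Q [set w | V w <= x]| <= b) ->
  dKS P Q U V <= b.
Proof.
move=> H; apply: sup_le_ub; last by move=> _ [y _ <-]; exact: H.
by exists `|pr P [set w | U w <= 0] - pr Q [set w | V w <= 0]|, 0.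
Qed.

Lemma dKS_le1 : dKS P Q U V <= 1.
Proof. exact: dKS_le. Qed.

End dKS_bounds.

Lemma limn_sup_gt0 (R : realType) (u : nat -> R) (c : R) :
  (forall n, 0 <= u n <= 1) -> 0 < c ->
  (forall N, exists2 n, (N <= n)%N & c <= u n) -> 0 < limn_sup u.
Proof.
move=> u01 c0 H; apply: lt_le_trans c0 _; rewrite limn_supE.
  apply: lb_le_inf; first by exists (sups u 0%N), 0%N.
  move=> _ [N _ <-]; have [n Nn cu] := H N; apply: le_trans cu _.
  apply: sup_upper_bound; last by exists n.
  split; first by exists (u N), N => /=.
  by exists 1 => _ [k _ <-]; have /andP[] := u01 k.
exists 1; split => // x x1 n _ /=; have /andP[u0 u1] := u01 n.
by rewrite ger0_norm // (le_trans u1) // ltW.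
Qed.

(** A ratio of at least [e] forces [d] to grow with [n], since [e * n <= d * sqrt d <= d ^ 2]. The
    second term is 6 times the ratio over [delta ^ 2 * sqrt d], small because the ratio is at most
    [K]. *)
Lemma small_failure_probability (R : realType) (e delta K : R) (m : nat) :
  0 < e -> 0 < delta -> 0 < K -> (0 < m)%N ->
  exists N, forall n d, (N <= n)%N -> (0 < n)%N -> (0 < d)%N ->
    e <= d%:R * Num.sqrt d%:R / n%:R :> R -> d%:R * Num.sqrt d%:R / n%:R <= K ->
    8 / d%:R + 6 * d%:R / (n%:R * delta ^+ 2) <= 1 / (4 * m%:R).
Proof.
move=> e0 dl0 K0 m0.
have mp : 0 < m%:R :> R by rewrite ltr0n.
(* Each term is to be at most [1 / (8 * m)]: [64 * m <= d] suffices for the first and [S <= sqrt d]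
   for the second. *)
pose S := 48 * K * m%:R / delta ^+ 2; have S0 : 0 < S.
  by rewrite !mulr_gt0 ?invr_gt0 ?exprn_gt0.
pose D := 64 * m%:R + S ^+ 2.
have D0 : 0 < D by rewrite addr_gt0 ?exprn_gt0 //; lra.
exists (Num.bound (D ^+ 2 / e)) => n d Nn n0 d0 er rK.
have np : 0 < n%:R :> R by rewrite ltr0n.
have dp : 0 < d%:R :> R by rewrite ltr0n.
have d1 : 1 <= d%:R :> R by rewrite ler1n.
set s := Num.sqrt d%:R in er rK.
have sp : 0 < s by rewrite sqrtr_gt0.
have s2 : s ^+ 2 = d%:R by rewrite sqr_sqrtr // ltW.
have sd : s <= d%:R by rewrite -s2 expr2 ler_peMl ?(ltW sp) // -[leLHS]sqrtr1 ler_sqrt.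
have Dd : D <= d%:R.
  rewrite leNgt; apply/negP => dD.
  have : D ^+ 2 / e < n%:R.
    apply: lt_le_trans (archi_boundP _) _; last by rewrite ler_nat.
    by rewrite divr_ge0 ?sqr_ge0 // ltW.
  rewrite ltr_pdivrMr // ltNge => /negP; apply.
  move: er; rewrite ler_pdivlMr // mulrC => er; apply: le_trans er _.
  rewrite expr2; apply: ler_pM; rewrite ?(ltW dp) ?(ltW sp) ?(ltW dD) //.
  exact: le_trans sd (ltW dD).
have H1 : 8 / d%:R <= 1 / (8 * m%:R) :> R.
  rewrite ler_pdivrMr // mulrAC ler_pdivlMr ?mulr_gt0 //.
  have : 64 * m%:R <= D by rewrite lerDl sqr_ge0.
  lra.
have Ss : S <= s.
  rewrite -(ler_pXn2r (n := 2)) ?nnegrE ?(ltW S0) ?(ltW sp) // s2.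
  by apply: le_trans Dd; rewrite lerDr mulr_ge0 // ltW.
have H2 : 6 * d%:R / (n%:R * delta ^+ 2) <= 1 / (8 * m%:R).
  have -> : 6 * d%:R / (n%:R * delta ^+ 2) = 6 * (d%:R * s / n%:R) / (delta ^+ 2 * s).
    by field; rewrite !gt_eqF.
  have k0 : 0 < delta ^+ 2 * s by rewrite mulr_gt0 // exprn_gt0.
  rewrite ler_pdivrMr // [X in _ <= X]mulrAC ler_pdivlMr ?mulr_gt0 //.
  have : 48 * K * m%:R <= s * delta ^+ 2.
    by rewrite -ler_pdivrMr ?exprn_gt0.
  have := ler_wpM2r (ltW mp) rK; lra.
have -> : 1 / (4 * m%:R) = 1 / (8 * m%:R) + 1 / (8 * m%:R) :> R by field; rewrite gt_eqF.
exact: lerD.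
Qed.

Lemma powR32 (R : realType) (d : nat) : (0 < d)%N -> d%:R `^ (3 / 2) = d%:R * Num.sqrt d%:R :> R.
Proof.
move=> d0; have -> : 3 / 2 = 1 + 2^-1 :> R by lra.
rewrite powRD ?powRr1 ?powR12_sqrt //.
by rewrite pnatr_eq0 -lt0n d0 implybT.
Qed.

(** * From normal matrices to the logistic model *)

Section null_model.
Variables (R : realType) (n d : nat) (disp disp' : measure_display).
Variables (T : measurableType disp) (S : measurableType disp').
Variables (P : probability T R) (Q : probability S R).
Variables (X : 'I_n -> {RV P >-> d.-tuple R}) (Y : 'I_n -> {RV P >-> R}).
Variable V : {RV Q >-> R}.
Hypotheses (XY : null_logistic_model X Y) (QV : chi_square Q d V) (d0 : (0 < d)%N).
Notation D := (dKS P Q (fun w => 2 * Lambda (fun i => X i w) (fun i => Y i w)) V).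
Notation Z := (design X Y).
Notation rho := (d%:R * Num.sqrt d%:R / n%:R : R).

Let GZ := iid_normal_design XY.

Let LambdaE w : Lambda (fun i => X i w) (fun i => Y i w) = max_loglik (Z w).
Proof. exact: Lambda_max_loglik. Qed.

Let mU x : measurable [set w | 2 * Lambda (fun i => X i w) (fun i => Y i w) <= x].
Proof.
have := measurable_max_loglik2_le GZ x.
by congr measurable; apply/seteqP; split => w /=; rewrite LambdaE.
Qed.

Let mV x : measurable [set v | V v <= x].
Proof. by apply: measurable_set_le; exact: measurable_funPT. Qed.

Let prU x : pr P [set w | 2 * Lambda (fun i => X i w) (fun i => Y i w) <= x] =
  pr P [set w | 2 * max_loglik (Z w) <= x].
Proof. by congr pr; apply/seteqP; split => w /=; rewrite LambdaE. Qed.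

Lemma dKS_Lambda_itv : 0 <= D <= 1.
Proof. by rewrite (dKS_ge0 P Q mU mV) (dKS_le1 P Q mU mV). Qed.

Hypothesis n0 : (0 < n)%N.

Let prV x : pr Q [set v | V v <= x] = pr P [set w | score (Z w) <= x].
Proof. by rewrite /pr (score_chi_square GZ n0 x QV). Qed.

Lemma dKS_Lambda_le (eps : R) : (d <= n)%N -> 0 < eps ->
  D <= 24 * rho / eps ^+ 2 + 12 * rho / eps + 225 * rho ^+ 2
    + Num.sqrt (5 * Num.sqrt (2 * eps)).
Proof.
by move=> dn e0; apply: dKS_le => x; rewrite prU prV; exact: cdf_upper_bound.
Qed.

Let dKS_Lambda_ge (c : R) : (exists x, c <= `|pr P [set w | 2 * max_loglik (Z w) <= x] -
  pr P [set w | score (Z w) <= x]|) -> c <= D.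
Proof. by move=> [x] /le_trans; apply; rewrite -prU -prV; exact: dKS_ge. Qed.

Lemma dKS_Lambda_ge_saturated : (n <= d)%N -> 1 / 4 <= D.
Proof. by move=> nd; apply: dKS_Lambda_ge; exact: cdf_lower_bound_saturated. Qed.

Lemma dKS_Lambda_ge_large : (d <= n)%N -> 1152 <= rho -> 3 / 4 <= D.
Proof. by move=> dn H; apply: dKS_Lambda_ge; exact: cdf_lower_bound_large. Qed.

Lemma dKS_Lambda_ge_moderate (delta : R) (m : nat) : (d <= n)%N -> 0 < delta ->
  288 * delta <= rho -> 8 / delta <= m%:R ->
  1 / (2 * m%:R) - (8 / d%:R + 6 * d%:R / (n%:R * delta ^+ 2)) <= D.
Proof. by move=> dn H1 H2 H3; apply: dKS_Lambda_ge; exact: cdf_lower_bound. Qed.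

End null_model.

Unset Implicit Arguments.

Theorem proposition4p2 (R : realType) (d : nat -> nat)
    (d_gt0 : forall n, (0 < d n)%N)
    (disp : nat -> measure_display) (T : forall n, measurableType (disp n))
    (P : forall n, probability (T n) R)
    (X : forall n, 'I_n -> {RV (P n) >-> (d n).-tuple R})
    (Y : forall n, 'I_n -> {RV (P n) >-> R})
    (XY : forall n, null_logistic_model (X n) (Y n))
    (disp' : nat -> measure_display) (S : forall n, measurableType (disp' n))
    (Q : forall n, probability (S n) R)
    (V : forall n, {RV (Q n) >-> R})
    (chi2V : forall n, chi_square (Q n) (d n) (V n)) :
  let ratio n : R := (d n)%:R `^ (3 / 2) / n%:R in
  let dist n : R :=
    dKS (P n) (Q n)
      (fun w => 2 * Lambda (fun i => X n i w) (fun i => Y n i w)) (V n) in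
  (ratio n @[n --> \oo] --> (0 : R) -> dist n @[n --> \oo] --> (0 : R)) /\
  (~ (ratio n @[n --> \oo] --> (0 : R)) -> 0 < limn_sup dist).
Proof.
move=> ratio dist.
have ratioE n : ratio n = (d n)%:R * Num.sqrt (d n)%:R / n%:R by rewrite /ratio powR32.
have ratio_ge0 n : 0 <= ratio n by rewrite ratioE divr_ge0 // mulr_ge0 // sqrtr_ge0.
have dist01 n : 0 <= dist n <= 1 by exact: (dKS_Lambda_itv (V n) (XY n)).
split.
  move=> /cvgr0Pnorm_le ratio0; apply/cvgr0Pnorm_le => e e0.
  (* Chosen so that the anticoncentration term equals [e / 2]; the other terms will be at most
     [ratio n * C]. *)
  pose t := (e / 2) ^+ 2 / 5; pose eps := t ^+ 2 / 2.
  have t0 : 0 < t by rewrite divr_gt0 // exprn_gt0 // divr_gt0.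
  have eps0 : 0 < eps by rewrite divr_gt0 // exprn_gt0.
  have sqrt_eps : Num.sqrt (5 * Num.sqrt (2 * eps)) = e / 2.
    have -> : 2 * eps = t ^+ 2 by rewrite /eps; field.
    rewrite sqrtr_sqr ger0_norm ?ltW //.
    have -> : 5 * t = (e / 2) ^+ 2 by rewrite /t; field.
    by rewrite sqrtr_sqr ger0_norm // divr_ge0 // ltW.
  pose C := 24 / eps ^+ 2 + 12 / eps + 225.
  have C0 : 0 < C.
    have k2 : 0 < 24 / eps ^+ 2 by rewrite divr_gt0 // exprn_gt0.
    have k1 : 0 < 12 / eps by rewrite divr_gt0.
    by rewrite /C; lra.
  have h2 : 0 < 1 / 2 :> R by [].
  have eC : 0 < e / 2 / C by rewrite !divr_gt0.
  near=> n.
  have n0 : (0 < n)%N by near: n; exact: nbhs_infty_gt.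
  have np : 0 < n%:R :> R by rewrite ltr0n.
  (* Used twice: [d n / n <= ratio n] then gives [d n <= n], and [ratio n ^+ 2 <= ratio n]. *)
  have r1 : ratio n <= 1 / 2.
    by apply: le_trans (ler_norm _) _; near: n; exact: ratio0.
  have rC : ratio n * C <= e / 2.
    rewrite -ler_pdivlMr //; apply: le_trans (ler_norm _) _; near: n; exact: ratio0.
  have dn : (d n <= n)%N.
    rewrite -(ler_nat R) -[leRHS]mul1r -ler_pdivrMr //.
    have : (d n)%:R / n%:R <= ratio n.
      rewrite ratioE ler_pM2r ?invr_gt0 // ler_peMr //.
      by rewrite -[leLHS]sqrtr1 ler_sqrt // ler1n.
    lra.
  have /andP[D0 _] := dist01 n; rewrite ger0_norm //.
  apply: le_trans (dKS_Lambda_le (XY n) (chi2V n) (d_gt0 n) n0 dn eps0) _.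
  rewrite sqrt_eps -ratioE.
  have : ratio n ^+ 2 <= ratio n.
    by rewrite expr2 ler_piMl //; lra.
  have -> : 24 * ratio n / eps ^+ 2 + 12 * ratio n / eps =
    ratio n * (24 / eps ^+ 2 + 12 / eps) by ring.
  move: rC; rewrite /C mulrDr; lra.
move=> ratio0.
have [e [e0 He]] : exists e, 0 < e /\ forall N, exists2 n, (N <= n)%N & e <= ratio n.
  apply: contrapT => /forallNP H; apply: ratio0; apply/cvgr0Pnorm_le => e e0.
  have := H e => /not_andP[//|/existsNP[N HN]].
  exists N => // n /= Nn; rewrite ger0_norm //; apply/ltW; rewrite ltNge.
  by apply/negP => en; apply: HN; exists n.
(* The largest step allowed by a ratio of at least [e] in [cdf_lower_bound]; [m] such steps cover
   the window of length [8 * s]. *)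
pose delta := e / 288; have dl0 : 0 < delta by rewrite /delta; lra.
pose m := Num.bound (8 / delta).
have dlm : 8 / delta < m%:R by apply: archi_boundP; rewrite divr_ge0 // ltW.
have mp : 0 < m%:R :> R by apply: lt_trans dlm; rewrite divr_gt0.
have m0 : (0 < m)%N by rewrite -(ltr0n R).
have m1 : 1 <= m%:R :> R by rewrite ler1n.
have K0 : 0 < 1152 :> R by lra.
have [N0 HN0] := small_failure_probability e0 dl0 K0 m0.
have c4 : 1 / (4 * m%:R) <= 1 / 4 :> R.
  by rewrite ler_pdivrMr ?mulr_gt0 //; lra.
apply: (@limn_sup_gt0 _ _ (1 / (4 * m%:R))) => // [|N].
  by rewrite divr_gt0 // mulr_gt0.
(* The successor makes [n] positive as well as beyond both bounds. *)
have [n] := He (maxn N0 N).+1; rewrite gtn_max => /andP[N0n Nn]; rewrite ratioE => er.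
exists n; first exact: ltnW.
have n0 : (0 < n)%N by exact: leq_ltn_trans Nn.
(* Three regimes, with the common lower bound [1 / (4 * m)]: separable data, a ratio beyond 1152,
   and a ratio between [e] and 1152, where the failure probability vanishes. *)
have [nd|/ltnW dn] := leqP n (d n).
  apply: le_trans c4 _; exact: dKS_Lambda_ge_saturated.
have [rK|/ltW rK] := leP 1152 ((d n)%:R * Num.sqrt (d n)%:R / n%:R : R).
  apply: (@le_trans _ _ (3 / 4)); first by lra.
  exact: dKS_Lambda_ge_large.
have dlr : 288 * delta <= (d n)%:R * Num.sqrt (d n)%:R / n%:R.
  by apply: le_trans er; rewrite /delta; lra.
apply: le_trans (dKS_Lambda_ge_moderate (XY n) (chi2V n) (d_gt0 n) n0 dn dl0 dlr (ltW dlm)).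
have := HN0 n (d n) (ltnW N0n) n0 (d_gt0 n) er rK.
have -> : 1 / (2 * m%:R) = 1 / (4 * m%:R) + 1 / (4 * m%:R) :> R by field; rewrite gt_eqF.
lra.
Unshelve. all: by end_near.
Qed.
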